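(* Let $B$ and $\tilde B$ be balls with $B\Subset\tilde B\Subset\Omega$. Assume $1<p<q<\infty$, $\alpha\in(0,1]$, $0\le a(\cdot)\in C^{0,\alpha}(\Omega)$, $\frac qp\le1+\frac\alpha n$, that the matrix weight $\mathbb{M}$ satisfies $|\mathbb{M}(x)||\mathbb{M}^{-1}(x)|\le\Lambda$ for a.e. $x\in\mathbb{R}^n$ with a constant $\Lambda\ge1$, and that $$|\log\mathbb{M}|_{\mathrm{BMO}(\tilde B)}\le\beta\min\left\{\frac1{p'},\frac1s\right\},\qquad \frac1s=\frac1p-\frac{\alpha}{nq},$$ where $\beta=\beta(n)>0$ is the constant described in the context. Set $\omega=|\mathbb{M}|$. Then for every function $f\in W^{1,p}_{\omega^p}(\Omega)$ with $H(x,\mathbb{M}Df)\in L^1(\tilde B)$ there exists a sequence $\{f_k\}\subset W^{1,\infty}(B)$ such that, as $k\to\infty$, $$f_k\to f\ \text{ in } W^{1,p}_{\omega^p}(B)\qquad\text{and}\qquad \int_BH(x,\mathbb{M}(x)Df_k(x))\,dx\to\int_BH(x,\mathbb{M}(x)Df(x))\,dx.$$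
   Context: $\Omega\subset\mathbb{R}^n$, $n\ge2$, is a bounded domain; $p'=p/(p-1)$; $H(x,z)=|z|^p+a(x)|z|^q$. $\mathbb{M}:\mathbb{R}^n\to\mathbb{R}^{n\times n}$ is symmetric and almost everywhere positive definite; $|\cdot|$ on matrices is the spectral norm; $\log\mathbb{M}$ is the matrix logarithm. For an open set $D$, $|g|_{\mathrm{BMO}(D)}=\sup_{B'\subset D}\frac1{|B'|}\int_{B'}|g-(g)_{B'}|\,dx$, supremum over balls $B'\subset D$, $(g)_{B'}=\frac1{|B'|}\int_{B'}g\,dx$. Weighted spaces (with $\omega\in L^p_{\mathrm{loc}}(\mathbb{R}^n)$): $L^p_{\omega^p}(D)$ is the set of measurable $f$ with $\omega f\in L^p(D)$, normed by $\|f\|_{L^p_{\omega^p}(D)}=\|f\omega\|_{L^p(D)}$; $W^{1,p}_{\omega^p}(D)$ is the set of $f\in W^{1,1}(D)$ with $f,|Df|\in L^p_{\omega^p}(D)$, normed by $\|f\|_{L^p_{\omega^p}(D)}+\||Df|\|_{L^p_{\omega^p}(D)}$. The constant $\beta$: the logarithmic mean over a ball $B'$ is $(\mathbb{M})^{\log}_{B'}=\exp\big(\frac1{|B'|}\int_{B'}\log\mathbb{M}\,dx\big)$, and similarly $(\omega)^{\log}_{B'}$. It is known that there are positive constants $\kappa,c_b$ depending only on $n$ such that, for every $\sigma\ge1$ and every ball $B'$, $|\log\mathbb{M}|_{\mathrm{BMO}(B')}\le\kappa/\sigma$ implies $$\left(\frac1{|B'|}\int_{B'}\Big(\frac{|\mathbb{M}(x)-(\mathbb{M})^{\log}_{B'}|}{|(\mathbb{M})^{\log}_{B'}|}\Big)^\sigma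 dx\right)^{1/\sigma}\le c_b\,\sigma\,|\log\mathbb{M}|_{\mathrm{BMO}(B')},$$ and the same holds with $\omega$ in place of $\mathbb{M}$. Such $\kappa,c_b$ are fixed and $\beta=\beta(n)=\min\{\kappa,1/c_b\}$. (With this choice, $|\log\omega|_{\mathrm{BMO}(B')}\le\beta/\sigma$ with $\sigma\ge1$ implies $\big(\frac1{|B'|}\int_{B'}\omega^\sigma\big)^{1/\sigma}\le2(\omega)^{\log}_{B'}$ and $\big(\frac1{|B'|}\int_{B'}\omega^{-\sigma}\big)^{1/\sigma}\le2/(\omega)^{\log}_{B'}$.) *)

(* Defs.v *)
From HB Require Import structures.
From mathcomp Require Import all_boot all_order all_algebra.
From mathcomp Require Import all_classical all_reals all_analysis.

Set Implicit Arguments.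
Unset Strict Implicit.
Unset Printing Implicit Defensive.

Import Order.TTheory GRing.Theory Num.Theory.
Import numFieldNormedType.Exports.

Local Open Scope classical_set_scope.
Local Open Scope ring_scope.

Section tuple_power_measure.
Context d (T : measurableType d) (R : realType).
Variable l : {sigma_finite_measure set T -> \bar R}.

Definition cons_pair n (x : T * n.-tuple T) : n.+1.-tuple T :=
  [the n.+1.-tuple T of x.1 :: x.2].

Lemma measurable_cons_pair n : measurable_fun [set: _] (@cons_pair n).
Proof.
apply: measurable_cons; [exact: measurable_fst|exact: measurable_snd].
Qed.

Section cons_measure.
Context n (m : {sigma_finite_measure set (n.-tuple T) -> \bar R}).

Definition cons_measure : set (n.+1.-tuple T) -> \bar R :=
  pushforward (l \x m)%E (@cons_pair n).

Let M : {measure set (n.+1.-tuple T) -> \bar R} :=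
  measure_function_pushforward__canonical__measure_function_Measure
    (l \x m)%E (@measurable_cons_pair n).

HB.instance Definition _ := Measure.copy cons_measure M.

Let cons_measure_sigma_finite : sigma_finite setT cons_measure.
Proof.
have /sigma_finiteP[F [TF ndF Foo]] := sigma_finiteT l.
have /sigma_finiteP[G [TG ndG Goo]] := sigma_finiteT m.
pose u (y : n.+1.-tuple T) := (thead y, [tuple of behead y]).
have uK x : u (cons_pair x) = x.
  by case: x => a t; congr pair; exact/val_inj.
have mu : measurable_fun [set: n.+1.-tuple T] u.
  apply/measurable_fun_pairP; split; first exact: measurable_tnth.
  exact: measurable_behead.
exists (fun k => u @^-1` (F k `*` G k)).
  apply/seteqP; split => // y _.
  have : [set: T] (u y).1 by []. rewrite TF => -[i _ Fi].
  have : [set: n.-tuple T] (u y).2 by []. rewrite TG => -[j _ Gj].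
  exists (maxn i j) => //; split.
    by move: Fi; exact/subsetPset/ndF/leq_maxl.
  by move: Gj; exact/subsetPset/ndG/leq_maxr.
move=> k; have [mF Fk] := Foo k; have [mG Gk] := Goo k; split.
  by rewrite -[X in measurable X]setTI; apply: mu => //; exact: measurableX.
rewrite /cons_measure /pushforward (_ : _ @^-1` _ = F k `*` G k).
  by rewrite product_measure1E// lte_mul_pinfty// ge0_fin_numE.
by apply/funext => x; rewrite -[in RHS](uK x).
Qed.

HB.instance Definition _ := Measure_isSigmaFinite.Build _ _ _
  cons_measure cons_measure_sigma_finite.

End cons_measure.

Fixpoint tuple_power n : {sigma_finite_measure set (n.-tuple T) -> \bar R} :=
  match n with
  | 0 => dirac [tuple]
  | k.+1 => cons_measure (tuple_power k)
  end.

End tuple_power_measure.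

Section lebesgue_cV.
Context {R : realType}.
Variable n : nat.
Local Notation lebesgue_tuple :=
  (@tuple_power _ (measurableTypeR R) R lebesgue_measure n).

Definition cV_of_tuple (t : n.-tuple R) : 'cV[R]_n := \col_i tnth t i.

(* R^n is 'cV[R]_n, with the sigma-algebra of Lebesgue-measurable sets: the
   Caratheodory completion of the product of n copies of the one-dimensional
   Lebesgue measure (on Borel sets). *)
Definition lebesgue_measurable : set (set 'cV[R]_n) := fun A =>
  (lebesgue_tuple^*)%mu.-cara.-measurable (cV_of_tuple @^-1` A).

Let lebesgue_measurable0 : lebesgue_measurable set0.
Proof. exact: caratheodory_measurable_set0. Qed.

Let lebesgue_measurableC A :
  lebesgue_measurable A -> lebesgue_measurable (~` A).
Proof. exact: caratheodory_measurable_setC. Qed.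

Let lebesgue_measurable_bigcup (F : (set 'cV[R]_n)^nat) :
  (forall i, lebesgue_measurable (F i)) ->
  lebesgue_measurable (\bigcup_i F i).
Proof.
move=> mF; rewrite /lebesgue_measurable preimage_bigcup.
exact: caratheodory_measurable_bigcup.
Qed.

HB.instance Definition _ := @isMeasurable.Build default_measure_display
  'cV[R]_n lebesgue_measurable lebesgue_measurable0 lebesgue_measurableC
  lebesgue_measurable_bigcup.

Definition lebesgue_cV : set 'cV[R]_n -> \bar R :=
  pushforward (@completed_measure_extension _ _ _ lebesgue_tuple) cV_of_tuple.

Let measurable_cV_of_tuple :
  measurable_fun [set: caratheodory_type (lebesgue_tuple^*)%mu]
    (cV_of_tuple : caratheodory_type (lebesgue_tuple^*)%mu -> 'cV[R]_n).
Proof. by move=> _ A mA; rewrite setTI. Qed.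

Let M : {measure set 'cV[R]_n -> \bar R} :=
  measure_function_pushforward__canonical__measure_function_Measure
    (@completed_measure_extension _ _ _ lebesgue_tuple) measurable_cV_of_tuple.

HB.instance Definition _ := Measure.copy lebesgue_cV M.

Let tuple_of_cV (x : 'cV[R]_n) : n.-tuple R := [tuple x i 0 | i < n].

Let cV_of_tupleK : cancel cV_of_tuple tuple_of_cV.
Proof. by move=> t; apply: eq_from_tnth => i; rewrite tnth_mktuple mxE. Qed.

Let lebesgue_cV_sigma_finite : sigma_finite setT lebesgue_cV.
Proof.
have [F TF Foo] := @completed_measure_extension_sigma_finite _ _ _
  lebesgue_tuple (sigma_finiteT lebesgue_tuple).
have FE k : cV_of_tuple @^-1` (tuple_of_cV @^-1` F k) = F k.
  by apply/funext => t; rewrite -[in RHS](cV_of_tupleK t).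
exists (fun k => tuple_of_cV @^-1` F k).
  by rewrite -preimage_bigcup -TF preimage_setT.
move=> k; have [mF Fk] := Foo k; split.
  by rewrite /measurable/= /lebesgue_measurable FE.
by rewrite /lebesgue_cV /pushforward FE.
Qed.

HB.instance Definition _ := Measure_isSigmaFinite.Build _ _ _
  lebesgue_cV lebesgue_cV_sigma_finite.

End lebesgue_cV.
Arguments lebesgue_cV {R} n.

Section vectors_and_matrices.
Context {R : realType} {n : nat}.
Implicit Types (x z : 'cV[R]_n) (A L : 'M[R]_n) (D : set 'cV[R]_n).

(* The library norm of matrices is the maximum norm. *)
Definition enorm z : R := Num.sqrt (\sum_i z i 0 ^+ 2).

Definition eball x (r : R) : set 'cV[R]_n := [set y | enorm (y - x) < r].

Definition is_eball D := exists x r, 0 < r /\ D = eball x r.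

Definition opnorm A : R :=
  sup [set enorm (A *m z) | z in [set z | enorm z <= 1]].

Definition posdef A := forall z, z != 0 -> 0 < (z^T *m A *m z) 0 0.

Definition expmx A : 'M[R]_n :=
  limn (fun k => \sum_(i < k) (i`!%:R)^-1 *: A ^+ i).

(* The unique symmetric logarithm when A is symmetric positive definite. *)
Definition logmx A : 'M[R]_n := get [set L | L^T = L /\ expmx L = A].

Definition compactly_contained D E := compact (closure D) /\ closure D `<=` E.

Definition holder_space (al : R) D (a : 'cV[R]_n -> R) :=
  (exists C, forall x, D x -> `|a x| <= C) /\
  (exists C, forall x y, D x -> D y -> `|a x - a y| <= C * enorm (x - y) `^ al).

End vectors_and_matrices.

Section weights.
Context {R : realType} {n : nat}.
Local Notation leb := (@lebesgue_cV R n).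
Implicit Types (D : set 'cV[R]_n) (M : 'cV[R]_n -> 'M[R]_n)
  (w g : 'cV[R]_n -> R).

Definition emean D (f : 'cV[R]_n -> \bar R) : \bar R :=
  (((fine (leb D))^-1)%:E * \int[leb]_(x in D) f x)%E.

Definition mean D g : R := (fine (leb D))^-1 * \int[leb]_(x in D) g x.

Definition mxmean D M : 'M[R]_n := \matrix_(i, j) mean D (fun x => M x i j).

Definition bmo D g : \bar R := ereal_sup
  [set emean B (fun x => `|g x - mean B g|%:E) |
    B in [set B | is_eball B /\ B `<=` D]].

Definition mxbmo D M : \bar R := ereal_sup
  [set emean B (fun x => (opnorm (M x - mxmean B M))%:E) |
    B in [set B | is_eball B /\ B `<=` D]].

Definition weight w :=
  measurable_fun setT w /\ {ae leb, forall x, 0 < w x}.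

Definition matrix_weight M :=
  [/\ forall i j, measurable_fun setT (fun x => M x i j),
      forall x, (M x)^T = M x &
      {ae leb, forall x, posdef (M x)}].

Definition logmean D w : R := expR (mean D (fun x => ln (w x))).

Definition mxlogmean D M : 'M[R]_n := expmx (mxmean D (fun x => logmx (M x))).

(* The quantitative John-Nirenberg estimate that the constants kappa and c_b
   are chosen to satisfy, for all matrix weights and all scalar weights. *)
Definition log_bmo_constants (kappa cb : R) :=
  (forall M, matrix_weight M -> forall (s : R) B, 1 <= s -> is_eball B ->
    let b := mxbmo B (fun x => logmx (M x)) in
    (b <= (kappa / s)%:E)%E ->
    (emean B (fun x => ((opnorm (M x - mxlogmean B M) /
                         opnorm (mxlogmean B M)) `^ s)%:E) `^ s^-1
      <= (cb * s)%:E * b)%E) /\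
  (forall w, weight w -> forall (s : R) B, 1 <= s -> is_eball B ->
    let b := bmo B (fun x => ln (w x)) in
    (b <= (kappa / s)%:E)%E ->
    (emean B (fun x => ((`|w x - logmean B w| / `|logmean B w|) `^ s)%:E)
        `^ s^-1
      <= (cb * s)%:E * b)%E).

End weights.
Arguments log_bmo_constants {R} n kappa cb.

Section sobolev.
Context {R : realType} {n : nat}.
Local Notation leb := (@lebesgue_cV R n).
Implicit Types (D : set 'cV[R]_n) (p : \bar R) (w f phi : 'cV[R]_n -> R)
  (G : 'cV[R]_n -> 'cV[R]_n).

Definition partial (i : 'I_n) f : 'cV[R]_n -> R :=
  fun x => 'D_(delta_mx i 0) f x.

Fixpoint Ck (k : nat) phi : Prop :=
  match k with
  | 0 => continuous phi
  | m.+1 => continuous phi /\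
      forall i, (forall x, derivable phi x (delta_mx i 0)) /\
        Ck m (partial i phi)
  end.

Definition test_function D phi :=
  (forall k, Ck k phi) /\
  compactly_contained [set x | phi x != 0] D.

Definition Lpnorm D p f : \bar R := 'N[leb]_p[(EFin \o f) \_ D].

Definition Lp D p f := measurable_fun D f /\ (Lpnorm D p f < +oo)%E.

Definition Lploc D p f :=
  measurable_fun D f /\ forall K, compact K -> K `<=` D -> Lp K p f.

(* G is a weak gradient of f on D; it is unique up to null sets. *)
Definition weak_gradient D f G :=
  [/\ Lploc D 1%:E f, forall i, Lploc D 1%:E (fun x => G x i 0) &
      forall phi i, test_function D phi ->
        \int[leb]_(x in D) (f x * partial i phi x) =
        - \int[leb]_(x in D) (G x i 0 * phi x)].

(* f is in W^{1,p}(D) and Df = G *)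
Definition W1 D p f G :=
  [/\ weak_gradient D f G, Lp D p f & Lp D p (fun x => enorm (G x))].

(* The weight multiplies f before the p-th power: the norm is that of w f. *)
Definition wLpnorm D w p f : \bar R := Lpnorm D p (fun x => w x * f x).

Definition wLp D w p f := measurable_fun D f /\ Lp D p (fun x => w x * f x).

(* f is in W^{1,p}_{w^p}(D) and Df = G *)
Definition wW1 D w p f G :=
  [/\ W1 D 1%:E f G, wLp D w p f & wLp D w p (fun x => enorm (G x))].

Definition wW1norm D w p f G : \bar R :=
  (wLpnorm D w p f + wLpnorm D w p (fun x => enorm (G x)))%E.

End sobolev.

Definition Hfun {R : realType} {n : nat} (p q : R) (a : 'cV[R]_n -> R)
    (x z : 'cV[R]_n) : R :=
  enorm z `^ p + a x * enorm z `^ q.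

(* Main.v *)
(* The approximations are f_e(x) = mean of f over the ball of radius e around x,
   with Df_e the mean of Df; no smooth kernel is needed, since f_e is bounded and
   the average of a test function is a test function, which gives the weak
   gradient by Fubini.

   The matrix weight is replaced by the scalar weight w = (det M)^(1/n), which is
   comparable to |M| and to the norm of M z / |z| because the condition number of
   M is bounded. As ln w = tr(log M)/n, the mean oscillation of ln w is at most
   that of log M, so the John-Nirenberg constants apply to w and 1/w with the
   exponents p, q, p', q'. The resulting two-sided bounds on balls play the role
   of Muckenhoupt conditions: together with q/p <= 1 + alpha/n and the Hoelder
   continuity of a they show that averaging is bounded for the modular
   g |-> int (w|g|)^p + a (w|g|)^q. A truncation argument upgrades boundedness to
   convergence of the modular of f_e - f and Df_e - Df to 0, and convexity turns
   this into convergence of the energies. *)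
Require Import Defs.
From mathcomp Require Import all_boot all_order all_algebra.
From mathcomp Require Import all_classical all_reals all_analysis.
From mathcomp Require Import measurable_realfun ring lra.
Import Order.TTheory GRing.Theory Num.Theory.
Import numFieldNormedType.Exports.
Local Open Scope classical_set_scope.
Local Open Scope ring_scope.

Set Implicit Arguments.
Unset Strict Implicit.
Unset Printing Implicit Defensive.

(** * The Euclidean norm *)

(** The bound for averages is nonlinear: passing from L^p to L^q on a ball leaves a factor J^(q/p -
    1), J being the p-energy on the ball, so the constant depends on a bound of the p-energy. The
    tail of a truncation has no more p-energy than the function itself, hence one constant serves
    all tails. On a ball of radius 2e the coefficient is split into a frozen number a0 and an
    oscillation. For a0 the exponent is q on both sides and the bound is scale invariant; the
    oscillation, of order e^alpha, pays for the loss |ball|^(1 - q/p). The local bounds compare a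
    ball with its double and are summed by integrating over all centres instead of choosing a
    covering. Two exponents in the hypothesis control four: 1/s <= 1/q is q/p <= 1 + alpha/n
    rewritten, and p < q gives 1/q <= 1/p and 1/p' <= 1/q'. The weight is built from the determinant
    because ln |M| is not linear in log M while the trace is, which leaves the John-Nirenberg
    constants unchanged. For f itself the hypothesis controls only a p-energy, so there the modular
    is taken with coefficient zero. *)

Section euclidean_norm.
Context {R : realType} {n : nat}.
Implicit Types (x y z : 'cV[R]_n).

(** Lagrange's identity: the difference of the two sides is half the sum of the squares of all 2 x 2
    minors. *)
Lemma cauchy_schwarz_sum (I : finType) (u v : I -> R) :
  (\sum_i u i * v i) ^+ 2 <= (\sum_i u i ^+ 2) * (\sum_i v i ^+ 2).
Proof.
rewrite -subr_ge0.
have -> : (\sum_i u i ^+ 2) * (\sum_i v i ^+ 2) - (\sum_i u i * v i) ^+ 2 =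
    2^-1 * \sum_i \sum_j (u i * v j - u j * v i) ^+ 2.
  have -> : \sum_i \sum_j (u i * v j - u j * v i) ^+ 2 =
      \sum_i \sum_j (u i ^+ 2 * v j ^+ 2) + \sum_i \sum_j (u j ^+ 2 * v i ^+ 2) -
      2 * \sum_i \sum_j ((u i * v i) * (u j * v j)).
    rewrite mulr_sumr -big_split/= -sumrB; apply: eq_bigr => i _.
    rewrite mulr_sumr -big_split/= -sumrB; apply: eq_bigr => j _; ring.
  by rewrite [X in _ + X - _]exchange_big/= -!big_distrlr/= -expr2; field.
by apply: mulr_ge0 => //; apply: sumr_ge0 => i _; apply: sumr_ge0 => j _;
  exact: sqr_ge0.
Qed.

Lemma enorm_ge0 x : 0 <= enorm x. Proof. exact: sqrtr_ge0. Qed.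

Lemma sqr_enorm x : enorm x ^+ 2 = \sum_i x i 0 ^+ 2.
Proof. by rewrite sqr_sqrtr// sumr_ge0// => i _; exact: sqr_ge0. Qed.

Lemma enorm0 : enorm (0 : 'cV[R]_n) = 0.
Proof. by rewrite /enorm big1 ?sqrtr0// => i _; rewrite mxE expr0n. Qed.

Lemma enormZ (k : R) x : enorm (k *: x) = `|k| * enorm x.
Proof.
rewrite /enorm (_ : \sum_i _ = k ^+ 2 * \sum_i x i 0 ^+ 2).
  by rewrite sqrtrM ?sqr_ge0// sqrtr_sqr.
by rewrite mulr_sumr; apply: eq_bigr => i _; rewrite mxE exprMn.
Qed.

Lemma enormN x : enorm (- x) = enorm x.
Proof. by rewrite -scaleN1r enormZ normrN1 mul1r. Qed.

Lemma enormBC x y : enorm (x - y) = enorm (y - x).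
Proof. by rewrite -opprB enormN. Qed.

Lemma cauchy_schwarz x y : \sum_i x i 0 * y i 0 <= enorm x * enorm y.
Proof.
apply: le_trans (ler_norm _) _.
rewrite -(@ler_pXn2r _ 2)// ?nnegrE ?mulr_ge0 ?enorm_ge0//.
by rewrite -normrX ger0_norm ?sqr_ge0// exprMn !sqr_enorm cauchy_schwarz_sum.
Qed.

Lemma enormD x y : enorm (x + y) <= enorm x + enorm y.
Proof.
rewrite -(@ler_pXn2r _ 2)// ?nnegrE ?addr_ge0 ?enorm_ge0//.
rewrite sqrrD !sqr_enorm.
have -> : \sum_i (x + y) i 0 ^+ 2 =
   \sum_i x i 0 ^+ 2 + (\sum_i x i 0 * y i 0) *+ 2 + \sum_i y i 0 ^+ 2.
  rewrite -sumrMnl -!big_split/=; apply: eq_bigr => i _; rewrite !mxE; ring.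
by rewrite lerD2r lerD2l lerMn2r/= cauchy_schwarz.
Qed.

Lemma enorm_dist x y z : enorm (x - z) <= enorm (x - y) + enorm (y - z).
Proof. by rewrite (_ : x - z = (x - y) + (y - z)) ?enormD// addrA subrK. Qed.

Lemma coord_le_enorm x i : `|x i 0| <= enorm x.
Proof.
rewrite -(@ler_pXn2r _ 2)// ?nnegrE ?enorm_ge0// sqr_enorm -normrX.
rewrite ger0_norm ?sqr_ge0// (bigD1 i)//= lerDl sumr_ge0// => j _.
exact: sqr_ge0.
Qed.

Lemma enorm_le_sum x : enorm x <= \sum_i `|x i 0|.
Proof.
have E : x = \sum_i x i 0 *: delta_mx i 0.
  by rewrite [LHS]matrix_sum_delta; apply: eq_bigr => i _; rewrite big_ord1.
rewrite {1}E; apply: (big_ind2 (fun (a : 'cV[R]_n) b => enorm a <= b)).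
- by rewrite enorm0.
- by move=> u1 u2 v1 v2 h1 h2; apply: le_trans (enormD _ _) _; exact: lerD.
- move=> i _; rewrite enormZ (_ : enorm _ = 1) ?mulr1//.
  rewrite /enorm (bigD1 i)//= mxE !eqxx big1 ?addr0 ?expr1n ?sqrtr1//.
  by move=> j ji; rewrite mxE (negbTE ji) expr0n.
Qed.

(** The topology of ['cV[R]_n] comes from the maximum norm; this bound and [enorm_le_mxnorm] make
    Euclidean balls a basis of neighbourhoods. *)
Lemma mxnorm_le_enorm x : `|x| <= enorm x.
Proof.
have [->|x0] := eqVneq x 0; first by rewrite normr0 enorm_ge0.
have [/= i ->] : exists i, `|x| = `|x i.1 i.2|.
  by apply: mx_norm_neq0; apply: contra_neq x0 => /mx_norm_eq0.
by rewrite (ord1 i.2) coord_le_enorm.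
Qed.

Lemma coord_le_mxnorm x i : `|x i 0| <= `|x|.
Proof.
rewrite [leRHS]mx_normrE.
by apply: le_trans (le_bigmax _ _ (i, 0)).
Qed.

Lemma enorm_le_mxnorm x : enorm x <= n%:R * `|x|.
Proof.
apply: le_trans (enorm_le_sum x) _.
apply: le_trans (ler_sum _ (fun i _ => coord_le_mxnorm x i)) _.
by rewrite sumr_const card_ord mulr_natl.
Qed.

End euclidean_norm.

(** * Lebesgue measure on R^n *)

Section tuple_measure.
Context {R : realType}.
Local Notation T := (measurableTypeR R).
Local Notation lt n := (@tuple_power _ T R lebesgue_measure n).

(** The translated measure agrees with Lebesgue measure on half-open intervals, which determine
    it. *)
Lemma lebesgue_measure_shift (a : R) (A : set T) : measurable A ->
  lebesgue_measure ((fun x : T => (x + a : T)) @^-1` A) = lebesgue_measure A.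
Proof.
move=> mA; apply/esym.
have mf : measurable_fun setT ((fun x : T => (x + a : T))).
  exact: measurable_funD.
pose m' : {measure set T -> \bar R} :=
  measure_function_pushforward__canonical__measure_function_Measure
    lebesgue_measure mf.
apply: (@lebesgue_measure_unique R m') => //= _ [[x y]] _ <-.
rewrite /pushforward.
have -> : (fun x : T => x + a) @^-1` `]x, y]%classic = `](x - a), (y - a)]%classic.
  by apply/seteqP; split=> z /=; rewrite !in_itv/= ltrBlDr lerBrDr.
rewrite !lebesgue_measure_itv/= !lte_fin ltrD2r; case: ifP => // _.
by congr EFin; ring.
Qed.

Definition tshift n (v t : n.-tuple T) : n.-tuple T :=
  [tuple (tnth t i + tnth v i : T) | i < n].

Lemma measurable_tshift n (v : n.-tuple T) : measurable_fun setT (tshift v).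
Proof.
apply/measurable_fun_tnthP => i.
rewrite (_ : _ \o _ = fun t => tnth t i + tnth v i :> T); last first.
  by apply/funext => t /=; rewrite tnth_mktuple.
apply: measurable_funD => //; exact: measurable_tnth.
Qed.

Lemma tuple_powerS n (A : set (n.+1.-tuple T)) :
  lt n.+1 A = (lebesgue_measure \x lt n)%E (@cons_pair _ T n @^-1` A).
Proof. by []. Qed.

(** The translated measure and the product measure agree on rectangles, one factor by
    [lebesgue_measure_shift] and the other by induction; uniqueness of the product measure does the
    rest. *)
Lemma tuple_power_shift n (v : n.-tuple T) (A : set (n.-tuple T)) :
  measurable A -> lt n (tshift v @^-1` A) = lt n A.
Proof.
elim: n v A => [|n IH] v A mA.
  by congr (lt 0 _); apply/funext => t /=; congr A; rewrite tuple0 [RHS]tuple0.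
pose w : n.-tuple T := [tuple of behead v].
pose ps (x : T * n.-tuple T) : T * n.-tuple T := (x.1 + thead v : T, tshift w x.2).
have mps : measurable_fun setT ps.
  apply: measurable_fun_pair => /=.
    by apply: measurable_funD => //; exact: measurable_fst.
  by apply: (measurableT_comp (measurable_tshift w)); exact: measurable_snd.
rewrite !tuple_powerS.
have -> : @cons_pair _ T n @^-1` (tshift v @^-1` A) =
    ps @^-1` (@cons_pair _ T n @^-1` A).
  apply/funext => -[x t] /=; congr A; apply: eq_from_tnth => i.
  rewrite tnth_mktuple; case: (unliftP ord0 i) => [j|] ->.
    rewrite /cons_pair/= !tnthS tnth_mktuple; congr (_ + _).
    by rewrite [in LHS](tuple_eta v) tnthS.
  by rewrite /cons_pair/= !tnth0 /thead.
have mB : measurable (@cons_pair _ T n @^-1` A).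
  by rewrite -[X in measurable X]setTI; exact: measurable_cons_pair.
pose m' : {measure set (T * n.-tuple T) -> \bar R} :=
  measure_function_pushforward__canonical__measure_function_Measure
    (lebesgue_measure \x lt n)%E mps.
apply/esym; apply: (@product_measure_unique _ _ _ _ _ _ _ m') => // C D mC mD.
rewrite /m'/= /pushforward.
have -> : ps @^-1` (C `*` D) =
   ((fun x : T => (x + thead v : T)) @^-1` C) `*` (tshift w @^-1` D) by [].
rewrite product_measure1E; first by congr (_ * _)%E; [exact: lebesgue_measure_shift|exact: IH].
- rewrite -[X in measurable X]setTI.
  by apply: (measurable_funD (f:=id)).
- by rewrite -[X in measurable X]setTI; exact: measurable_tshift.
Qed.

Definition tcube n (c : n.-tuple T) (r : R) : set (n.-tuple T) :=
  [set t | forall i, `|tnth t i - tnth c i| < r].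

Lemma measurable_tcube n (c : n.-tuple T) (r : R) : measurable (tcube c r).
Proof.
have -> : tcube c r = \big[setI/setT]_(i < n) [set t | `|tnth t i - tnth c i| < r].
  rewrite -bigcap_seq; apply/seteqP; split => [t ct i _|t ct i]; first exact: ct.
  by apply: ct; rewrite /= mem_index_enum.
apply: bigsetI_measurable => i _.
have mt : measurable_fun setT (fun t : n.-tuple T => `|tnth t i - tnth c i| : R).
  apply: measurableT_comp => //; apply: measurable_funB => //.
  exact: measurable_tnth.
rewrite -[X in measurable X]setTI; apply: (measurable_fun_ltr mt) => //.
Qed.

Lemma tuple_power_cube n (c : n.-tuple T) (r : R) : 0 < r ->
  lt n (tcube c r) = ((2 * r) ^+ n)%:E.
Proof.
move=> r0; elim: n c => [|n IH] c.
  by rewrite expr0 /= diracE mem_set// => -[].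
rewrite tuple_powerS.
have -> : @cons_pair _ T n @^-1` tcube c r =
   `](thead c - r), (thead c + r)[%classic `*` tcube [tuple of behead c] r.
  apply/seteqP; split => [[x t] /= H|[x t] [/= H1 H2] i].
    split; first by have := H ord0; rewrite tnth0 /= in_itv/= ltr_distl.
    move=> i; have := H (lift ord0 i).
    by rewrite tnthS [in tnth c _](tuple_eta c) tnthS.
  case: (unliftP ord0 i) => [j|] ->.
    by rewrite tnthS [in tnth c _](tuple_eta c) tnthS; exact: H2.
  by rewrite tnth0 ltr_distl; move: H1; rewrite in_itv.
rewrite product_measure1E ?IH//; last exact: measurable_tcube.
have E : lebesgue_measure (`](thead c - r), (thead c + r)[%classic : set T) =
    (2 * r)%:E.
  rewrite lebesgue_measure_itv/= lte_fin ltrD2l gtrN//=.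
  by congr EFin; ring.
by rewrite exprS EFinM; congr (_ * _)%E; exact: E.
Qed.

End tuple_measure.

Section lebesgue_cV_theory.
Context {R : realType} {n : nat}.
Local Notation T := (measurableTypeR R).
Local Notation lt := (@tuple_power _ T R lebesgue_measure n).
Local Notation leb := (@lebesgue_cV R n).
Local Notation cV := 'cV[R]_n.
Local Notation t2v := (@cV_of_tuple R n).
Implicit Types (A D : set cV).

Lemma cV_of_tuple_surj (x : cV) : exists t, t2v t = x.
Proof.
exists [tuple x i 0 | i < n]; apply/colP => i.
by rewrite mxE tnth_mktuple.
Qed.

Lemma cV_of_tuple_inj : injective t2v.
Proof.
move=> t u tu; apply: eq_from_tnth => i.
by move/colP : tu => /(_ i); rewrite !mxE.
Qed.

(** Bridge from the product sigma-algebra on tuples to its completion on vectors: explicit sets are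
    measured on the tuple side. *)
Lemma tuple_measurable_cV A : measurable (t2v @^-1` A : set (n.-tuple T)) ->
  measurable A /\ leb A = lt (t2v @^-1` A).
Proof.
move=> mA; split; first exact: caratheodory_measurable_mu_ext.
exact: measurable_mu_extE.
Qed.

Lemma measurable_coord (i : 'I_n) : measurable_fun setT (fun x : cV => x i 0).
Proof.
move=> _ Y mY; rewrite setTI; apply: (tuple_measurable_cV _).1.
have := @measurable_tnth _ T n i measurableT Y mY; rewrite setTI.
by congr (measurable _); apply/funext => t /=; rewrite mxE.
Qed.

Lemma leb_complete : measure_is_complete leb.
Proof.
move=> N [A [mA A0 NA]].
apply: measure_is_complete_caratheodory; exists (t2v @^-1` A); split => //.
by move=> t; exact: NA.
Qed.

(** [A'] is the union of a nearly optimal cover in the definition of the outer measure. It brings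
    sets of the completed sigma-algebra back to the product one, where arguments on generators
    apply. *)
Lemma leb_approx A (e : R) : measurable A -> (leb A < +oo)%E -> 0 < e ->
  exists A', [/\ measurable (t2v @^-1` A' : set (n.-tuple T)), A `<=` A' &
    (leb (A' `\` A) <= e%:E)%E].
Proof.
move=> mA Aoo e0.
have Afin : leb A \is a fin_num by rewrite ge0_fin_numE.
have : (leb A < leb A + e%:E)%E by rewrite lteDl// lte_fin.
rewrite {1}/lebesgue_cV /pushforward /completed_measure_extension /mu_ext.
move=> /ereal_inf_lt[_ [F [mF AF] <-] Fe].
pose A' : set cV := [set x | exists t, x = t2v t /\ (\bigcup_k F k) t].
have A'E : t2v @^-1` A' = \bigcup_k F k.
  apply/seteqP; split => [t [u [/cV_of_tuple_inj <- Fu]]//|t Ft].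
  by exists t.
have mA' : measurable (t2v @^-1` A' : set (n.-tuple T)).
  by rewrite A'E; apply: bigcupT_measurable => k; exact: mF.
have AA' : A `<=` A'.
  move=> x Ax; have [t tx] := cV_of_tuple_surj x; exists t; split => //.
  by apply: AF; rewrite /= tx.
have [mA'' A'm] := tuple_measurable_cV mA'.
have A'le : (leb A' <= leb A + e%:E)%E.
  rewrite A'm A'E; apply: le_trans (ltW Fe).
  apply: measure_sigma_subadditive => //.
  by apply: bigcupT_measurable => k; exact: mF.
exists A'; split => //.
rewrite measureD//; last first.
  by apply: le_lt_trans A'le _; rewrite lte_add_pinfty// ltry.
rewrite setIidr//.
by rewrite leeBlDl.
Qed.

Lemma t2v_shift (v : n.-tuple T) A :
  t2v @^-1` ((fun x => x + t2v v) @^-1` A) = tshift v @^-1` (t2v @^-1` A).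
Proof.
apply/funext => t /=; congr A; apply/colP => i.
by rewrite !mxE tnth_mktuple.
Qed.

Lemma tshiftK (v : n.-tuple T) :
  exists w : n.-tuple T, cancel (tshift v) (tshift w) /\ cancel (tshift w) (tshift v).
Proof.
exists [tuple (- tnth v i : T) | i < n]; split => t; apply: eq_from_tnth => i;
  by rewrite !tnth_mktuple ?addrK// subrK.
Qed.

(** Translating a cover gives one inequality for every shift; since the inverse of a shift is a
    shift, equality follows. *)
Lemma mu_ext_shift (v : n.-tuple T) (X : set (n.-tuple T)) :
  ((lt^*)%mu (tshift v @^-1` X) = (lt^*)%mu X)%E.
Proof.
have H : forall (u : n.-tuple T) Y, ((lt^*)%mu (tshift u @^-1` Y) <= (lt^*)%mu Y)%E.
  move=> u Y; apply: le_ereal_inf_tmp => _ [F [mF YF] <-].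
  apply: ereal_inf_lbound; exists (fun k => tshift u @^-1` F k).
    split; first by move=> k; rewrite -[X in measurable X]setTI; exact: measurable_tshift.
    by rewrite -preimage_bigcup => t /= /YF.
  by apply: eq_eseriesr => k _; rewrite tuple_power_shift.
apply/eqP; rewrite eq_le H/=.
have [w [vw wv]] := tshiftK v.
rewrite -{1}(_ : tshift w @^-1` (tshift v @^-1` X) = X) ?H//.
by apply/funext => t /=; rewrite wv.
Qed.

Lemma caratheodory_shift (v : n.-tuple T) (X : set (n.-tuple T)) :
  caratheodory_measurable (lt^*)%mu X ->
  caratheodory_measurable (lt^*)%mu (tshift v @^-1` X).
Proof.
have [w [vw wv]] := tshiftK v.
move=> mX Y; have := mX (tshift w @^-1` Y).
have {1 2}-> : X = tshift w @^-1` (tshift v @^-1` X).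
  by apply/funext => t /=; rewrite wv.
by rewrite preimage_setC -!preimage_setI !mu_ext_shift.
Qed.

Lemma leb_shift (v : cV) A : measurable A ->
  measurable ((fun x => x + v) @^-1` A) /\ leb ((fun x => x + v) @^-1` A) = leb A.
Proof.
have [u <-] := cV_of_tuple_surj v.
move=> mA; split; last first.
  rewrite /lebesgue_cV /pushforward t2v_shift /completed_measure_extension.
  exact: mu_ext_shift.
rewrite /measurable/= /lebesgue_measurable t2v_shift.
exact: caratheodory_shift.
Qed.

Lemma measurable_shift (v : cV) : measurable_fun setT (fun x : cV => x + v).
Proof. by move=> _ A mA; rewrite setTI; exact: (leb_shift v mA).1. Qed.

Lemma ge0_integral_shift (v : cV) (f : cV -> \bar R) : measurable_fun setT f ->
  (forall x, 0 <= f x)%E ->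
  (\int[leb]_x f (x + v)%R = \int[leb]_x f x)%E.
Proof.
move=> mf f0.
have -> : (\int[leb]_x f x =
  \int[pushforward leb (fun x : cV => x + v)%R]_x f x)%E.
  apply: (@eq_measure_integral _ _ _ _ (measure_function_pushforward__canonical__measure_function_Measure leb (measurable_shift v))) => A mA _.
  by apply: esym; exact: (leb_shift v mA).2.
by rewrite (ge0_integral_pushforward (measurable_shift v))// preimage_setT.
Qed.

(** The domain [S] is arbitrary so that the lemma also applies to pairs of points, for the relation
    of lying within a given distance. *)
Lemma measurable_enormB d (S : measurableType d) (f g : S -> cV) :
  (forall i, measurable_fun setT (fun x => f x i 0)) ->
  (forall i, measurable_fun setT (fun x => g x i 0)) ->
  measurable_fun setT (fun x => enorm (f x - g x)).
Proof.
move=> mf mg.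
have ms : measurable_fun setT (@Num.sqrt R).
  by apply: continuous_measurable_fun; exact: sqrt_continuous.
apply: (measurableT_comp ms).
apply: measurable_sum => i; apply: measurable_funX.
rewrite (_ : (fun x => _) = fun x => f x i 0 - g x i 0).
  exact: measurable_funB.
by apply/funext => x; rewrite !mxE.
Qed.

End lebesgue_cV_theory.

Section balls.
Context {R : realType} {n : nat}.
Local Notation T := (measurableTypeR R).
Local Notation lt := (@tuple_power _ T R lebesgue_measure n).
Local Notation leb := (@lebesgue_cV R n).
Local Notation cV := 'cV[R]_n.
Local Notation t2v := (@cV_of_tuple R n).
Implicit Types (A D : set cV) (x y : cV) (r : R).

Lemma measurable_eball x r : measurable (eball x r).
Proof.
have m1 : measurable_fun setT (fun y : cV => enorm (y - x)).
  exact: measurable_enormB (fun i => measurable_coord i) (fun i => measurable_cst (x i 0)).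
rewrite -[X in measurable X]setTI.
exact: (measurable_fun_ltr m1 (measurable_cst r)).
Qed.

Lemma leb_cube x r : 0 < r ->
  measurable [set y : cV | forall i, `|y i 0 - x i 0| < r] /\
  leb [set y : cV | forall i, `|y i 0 - x i 0| < r] = ((2 * r) ^+ n)%:E.
Proof.
move=> r0; have [c <-] := cV_of_tuple_surj x.
have E : t2v @^-1` [set y : cV | forall i, `|y i 0 - t2v c i 0| < r] = tcube c r.
  by apply/seteqP; split=> t /= H i; have := H i; rewrite !mxE.
have [] := @tuple_measurable_cV R n [set y : cV | forall i, `|y i 0 - t2v c i 0| < r].
  by rewrite E; exact: measurable_tcube.
by rewrite E tuple_power_cube.
Qed.

Lemma leb_eball_le x r : 0 < r -> (leb (eball x r) <= ((2 * r) ^+ n)%:E)%E.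
Proof.
move=> r0; have [mc <-] := leb_cube x r0.
apply: le_measure; rewrite ?inE//; first exact: measurable_eball.
move=> y /= yx i; apply: le_lt_trans yx.
by have := coord_le_enorm (y - x) i; rewrite !mxE.
Qed.

(** The cube of half-side r / (n + 1) lies in the ball, the norm being at most the sum of the [n]
    coordinates; [n.+1] in place of [n] keeps the inequality strict and covers n = 0. *)
Lemma leb_eball_ge x r : 0 < r ->
  (((2 * (r / n.+1%:R)) ^+ n)%:E <= leb (eball x r))%E.
Proof.
move=> r0; have rn0 : 0 < r / n.+1%:R by rewrite divr_gt0.
have [mc <-] := leb_cube x rn0.
apply: le_measure; rewrite ?inE//; first exact: measurable_eball.
move=> y /= yx; apply: le_lt_trans (enorm_le_sum _) _.
apply: le_lt_trans (_ : \sum_(i < n) (r / n.+1%:R) < r).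
  by apply: ler_sum => i _; have := ltW (yx i); rewrite !mxE.
rewrite sumr_const card_ord -[ltLHS]mulr_natr -mulrA -[ltRHS]mulr1 ltr_pM2l//.
by rewrite mulrC ltr_pdivrMr// mul1r ltr_nat.
Qed.

Lemma leb_eball_fin x r : leb (eball x r) \is a fin_num.
Proof.
rewrite ge0_fin_numE//; have [r0|r0] := ltP 0 r.
  by apply: le_lt_trans (leb_eball_le x r0) _; rewrite ltry.
rewrite (_ : eball x r = set0) ?measure0//.
apply/seteqP; split=> y // yr.
by have := le_lt_trans (enorm_ge0 (y - x)) (lt_le_trans yr r0); rewrite ltxx.
Qed.

Definition vol r : R := fine (leb (eball 0 r)).

Lemma leb_eball x r : leb (eball x r) = (vol r)%:E.
Proof.
rewrite fineK ?leb_eball_fin//.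
rewrite -(leb_shift (- x) (measurable_eball 0 r)).2; congr (leb _).
by apply/funext => y; rewrite /eball/= subr0.
Qed.

Lemma vol_gt0 r : 0 < r -> 0 < vol r.
Proof.
move=> r0; rewrite -lte_fin -(leb_eball 0); apply: lt_le_trans (leb_eball_ge 0 r0).
by rewrite lte_fin exprn_gt0// mulr_gt0// divr_gt0.
Qed.

Lemma vol_le r : 0 < r -> vol r <= (2 * r) ^+ n.
Proof. by move=> r0; rewrite -lee_fin -(leb_eball 0); exact: leb_eball_le. Qed.

Lemma vol_ge r : 0 < r -> (2 * (r / n.+1%:R)) ^+ n <= vol r.
Proof. by move=> r0; rewrite -lee_fin -(leb_eball 0); exact: leb_eball_ge. Qed.

Lemma vol_double r : 0 < r -> vol (2 * r) <= (2 * n.+1%:R) ^+ n * vol r.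
Proof.
move=> r0; apply: le_trans (vol_le _) _; first by rewrite mulr_gt0.
have -> : (2 * (2 * r)) ^+ n =
    (2 * n.+1%:R) ^+ n * (2 * (r / n.+1%:R)) ^+ n :> R.
  rewrite -exprMn; congr (_ ^+ n).
  have : n.+1%:R != 0 :> R by rewrite pnatr_eq0.
  by move: (n.+1%:R : R) => m m0; field.
by apply: ler_wpM2l (vol_ge r0); rewrite exprn_ge0.
Qed.

(** An open set is the union of the cubes with rational centre and half-side 1/(k + 1) that it
    contains, a countable family. *)
Lemma open_measurable_cV A : open A -> measurable A.
Proof.
move=> oA.
pose box (c : 'cV[rat]_n) (k : nat) : set cV :=
  [set y | forall i, `|y i 0 - (\col_j (ratr (c j 0) : R)) i 0| < k.+1%:R^-1].
have -> : A = \bigcup_(ck in [set ck : 'cV[rat]_n * nat | box ck.1 ck.2 `<=` A])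
    box ck.1 ck.2.
  apply/seteqP; split => [x Ax|x [ck /= ckA]]; last exact: ckA.
  have /nbhs_ballP[e /= e0 eA] : nbhs x A by move: oA; rewrite openE; apply.
  have [k _ ke] : exists2 k, (0 <= k)%N & k.+1%:R^-1 < e / 2.
    have /cvgr0Pnorm_lt := @cvg_harmonic R.
    move=> /(_ (e / 2)); rewrite divr_gt0// => /(_ isT)[k _ H].
    exists k => //; have := H k (leqnn _).
    by rewrite /harmonic /= ger0_norm// invr_ge0.
  have /choice[c cE] i : exists q : rat, `|x i 0 - ratr q| < k.+1%:R^-1.
    have : x i 0 - k.+1%:R^-1 < x i 0 + k.+1%:R^-1.
      by rewrite ltrBlDr -addrA ltrDl addr_gt0// invr_gt0.
    move=> /rat_in_itvoo[q]; rewrite in_itv/= => /andP[q1 q2].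
    by exists q; rewrite distrC ltr_distl q1.
  exists (\col_i c i, k) => /=; last by move=> i; rewrite !mxE.
  move=> y /= yc; apply: eA; rewrite -[y](subrK x) => //.
  split=> // i j; rewrite (ord1 j) subrK.
  rewrite /ball/=.
  have := yc i; have := cE i; rewrite !mxE => h1 h2.
  rewrite (_ : x i 0 - y i 0 = (x i 0 - ratr (c i)) - (y i 0 - ratr (c i))).
    apply: le_lt_trans (ler_normB _ _) _.
    by rewrite (splitr e) ltrD// (lt_trans _ ke).
  by rewrite opprB addrA subrK.
rewrite bigcup_mkcond; apply: countable_bigcupT_measurable.
  exact: countableP.
move=> ck; case: ifP => _; last exact: measurable0.
by apply: (leb_cube _ _).1; rewrite invr_gt0.
Qed.

End balls.
Arguments vol {R} n r.

(** * Euclidean balls and continuity *)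

Section topology_cV.
Context {R : realType} {n : nat}.
Local Notation cV := 'cV[R]_n.
Implicit Types (x y : cV) (A : set cV) (f : cV -> R).

Lemma nbhs_eballP x A : nbhs x A <-> exists2 e, 0 < e & eball x e `<=` A.
Proof.
split=> [/nbhs_ballP[e /= e0 eA]|[e e0 eA]].
  exists e => // y yx; apply: eA; rewrite mx_norm_ball /ball_/= distrC.
  exact: le_lt_trans (mxnorm_le_enorm _) yx.
apply/nbhs_ballP; exists (e / n.+1%:R); first by rewrite /= divr_gt0.
move=> y; rewrite mx_norm_ball /ball_/= distrC => yx; apply: eA => /=.
apply: le_lt_trans (enorm_le_mxnorm _) _.
apply: le_lt_trans (_ : n%:R * (e / n.+1%:R) < e).
  by rewrite ler_wpM2l// ltW.
by rewrite mulrCA -[ltRHS]mulr1 ltr_pM2l// ltr_pdivrMr// mul1r ltr_nat.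
Qed.

Lemma open_eball x e : open (eball x e).
Proof.
rewrite openE => y /= yx; apply/nbhs_eballP; exists (e - enorm (y - x)).
  by rewrite subr_gt0.
move=> z; rewrite /eball/= ltrBrDr => H.
exact: le_lt_trans (enorm_dist _ y _) H.
Qed.

Lemma continuous_eballP f x : {for x, continuous f} <->
  forall e, 0 < e -> exists2 d, 0 < d & forall y, enorm (y - x) < d -> `|f y - f x| < e.
Proof.
split=> [/cvgrPdist_lt fx e e0|H].
  have /nbhs_eballP[d d0 dP] := fx _ e0.
  by exists d => // y yx; rewrite distrC; exact: dP.
apply/(@cvgrPdist_lt _ _ _ (nbhs x) _) => e e0; have [d d0 dP] := H _ e0.
by apply/nbhs_eballP; exists d => // y yx; rewrite distrC; exact: dP.
Qed.

Lemma measurable_fun_of_rays d (S : measurableType d) (D : set S) (g : S -> R) :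
  (forall c, measurable (D `&` [set x | c < g x])) -> measurable_fun D g.
Proof.
move=> H; apply: (measurability _ (@RGenOInfty.measurableE R)).
move=> _ [_ [c ->] <-]; have := H c; congr (measurable (_ `&` _)).
by apply/seteqP; split => x /=; rewrite in_itv/= andbT.
Qed.

Lemma continuous_on_measurable_cV A f : open A ->
  (forall x, A x -> {for x, continuous f}) -> measurable_fun A f.
Proof.
move=> oA cf; apply: measurable_fun_of_rays => c; apply: open_measurable_cV.
rewrite openE => x [Ax cfx].
have /continuous_eballP fx := cf _ Ax.
have [e e0 eP] : exists2 e, 0 < e & forall y, enorm (y - x) < e -> `|f y - f x| < f x - c.
  by apply: fx; rewrite subr_gt0.
apply: filterI; first by move: oA; rewrite openE; apply.
apply/nbhs_eballP; exists e => // y yx /=.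
have := eP _ yx; rewrite distrC ltr_distl => /andP[_ ]; lra.
Qed.

Lemma continuous_measurable_cV f : continuous f -> measurable_fun setT f.
Proof.
by move=> cf; apply: continuous_on_measurable_cV; [exact: openT|move=> x _; exact: cf].
Qed.

Lemma holder_continuous f A (C al : R) : open A -> 0 < al ->
  (forall x y, A x -> A y -> `|f x - f y| <= C * enorm (x - y) `^ al) ->
  forall x, A x -> {for x, continuous f}.
Proof.
move=> oA al0 H x Ax; apply/continuous_eballP => e e0.
have /nbhs_eballP[d1 d10 d1A] : nbhs x A by move: oA; rewrite openE; apply.
(* [C] may be zero or negative; [K] is a positive constant above it. *)
pose K := `|C| + 1.
have K0 : 0 < K by rewrite ltr_wpDl.
exists (Num.min d1 ((e / K) `^ al^-1)).
  by rewrite lt_min d10 powR_gt0// divr_gt0.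
move=> y; rewrite lt_min => /andP[yd1 yd2].
apply: le_lt_trans (H _ _ (d1A _ yd1) Ax) _.
apply: le_lt_trans (_ : _ <= K * enorm (y - x) `^ al) _.
  by rewrite ler_wpM2r ?powR_ge0// (le_trans (ler_norm _))// lerDl.
rewrite mulrC -ltr_pdivlMr//.
apply: lt_le_trans (_ : _ < ((e / K) `^ al^-1) `^ al) _.
  by rewrite gt0_ltr_powR// nnegrE ?enorm_ge0// powR_ge0.
by rewrite -powRrM mulVf ?gt_eqF// powRr1// divr_ge0// ltW.
Qed.

End topology_cV.

(** * Bounded Lipschitz functions *)

Section lipschitz.
Context {R : realType} {n : nat}.
Local Notation cV := 'cV[R]_n.

(** The dense class for L^1: it is closed under sums and products, and averaging over radius e moves
    its members by at most C e. *)
Definition bounded_lipschitz (h : cV -> R) :=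
  exists C, (forall x, `|h x| <= C) /\ forall x y, `|h x - h y| <= C * enorm (x - y).

Lemma bounded_lipschitz_cst (c : R) : bounded_lipschitz (fun=> c).
Proof.
exists `|c|; split=> // x y.
by rewrite subrr normr0 mulr_ge0// enorm_ge0.
Qed.

Lemma bounded_lipschitz_ge0 (h : cV -> R) : bounded_lipschitz h ->
  exists C, [/\ 0 <= C, (forall x, `|h x| <= C) &
    forall x y, `|h x - h y| <= C * enorm (x - y)].
Proof.
move=> [C [hC hL]]; exists C; split => //.
exact: le_trans (hC 0).
Qed.

Lemma bounded_lipschitzD (h k : cV -> R) : bounded_lipschitz h ->
  bounded_lipschitz k -> bounded_lipschitz (fun x => h x + k x).
Proof.
move=> [C [hC hL]] [D [kD kL]]; exists (C + D); split=> [x|x y].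
  by apply: le_trans (ler_normD _ _) _; exact: lerD.
rewrite (_ : _ - _ = (h x - h y) + (k x - k y)); last by ring.
by apply: le_trans (ler_normD _ _) _; rewrite mulrDl; exact: lerD.
Qed.

Lemma bounded_lipschitzM (h k : cV -> R) : bounded_lipschitz h ->
  bounded_lipschitz k -> bounded_lipschitz (fun x => h x * k x).
Proof.
move=> /bounded_lipschitz_ge0[C [C0 hC hL]] /bounded_lipschitz_ge0[D [D0 kD kL]].
exists (Num.max (C * D) (2 * (C * D))); split=> [x|x y].
  by rewrite le_max normrM ler_pM.
rewrite (_ : _ - _ = (h x - h y) * k x + h y * (k x - k y)); last by ring.
apply: le_trans (_ : _ <= (2 * (C * D)) * enorm (x - y)) _; last first.
  by rewrite ler_wpM2r ?enorm_ge0// le_max lexx orbT.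
apply: le_trans (ler_normD _ _) _; rewrite !normrM.
have := hL x y; have := kL x y; have := kD x; have := hC y; move=> h1 h2 h3 h4.
have -> : 2 * (C * D) * enorm (x - y) = C * enorm (x - y) * D + C * (D * enorm (x - y)).
  by ring.
by apply: lerD; apply: ler_pM.
Qed.

Lemma bounded_lipschitz_measurable (h : cV -> R) : bounded_lipschitz h ->
  measurable_fun setT h.
Proof.
move=> [C [_ hL]]; apply: continuous_measurable_cV => x.
apply: (@holder_continuous _ _ h setT C 1) => //; first exact: openT.
by move=> y z _ _; rewrite powRr1 ?enorm_ge0.
Qed.

End lipschitz.

(* Otherwise [done] unfolds the Caratheodory completion on measurability goals. *)
#[local] Opaque lebesgue_measurable lebesgue_cV.

(** * Monotonicity of integrals of nonnegative functions *)

Section nonnegative_integral.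
Context d (T : measurableType d) {R : realType}.
Variable mu : {measure set T -> \bar R}.
Implicit Types (D : set T) (f g : T -> \bar R).
Local Open Scope ereal_scope.

(** The integral of a nonnegative function is a supremum over the simple functions below it, and a
    larger function has more of them. *)
Lemma le_integral_nonneg D f g : (forall x, D x -> 0 <= f x) ->
  (forall x, D x -> f x <= g x) ->
  \int[mu]_(x in D) f x <= \int[mu]_(x in D) g x.
Proof.
move=> f0 fg; rewrite !(integral_mkcond D).
have h10 x : 0 <= (f \_ D) x by apply: erestrict_ge0.
have h20 x : 0 <= (g \_ D) x.
  by apply: erestrict_ge0 => // t Dt; exact: le_trans (f0 _ Dt) (fg _ Dt).
rewrite !ge0_integralTE//; apply: le_ereal_sup => _ [h hf <-].
by exists h => // x; apply: le_trans (hf x) _; exact: lee_restrict.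
Qed.

Lemma subset_integral_nonneg D E f : D `<=` E -> (forall x, E x -> 0 <= f x) ->
  \int[mu]_(x in D) f x <= \int[mu]_(x in E) f x.
Proof.
move=> DE f0; rewrite integral_mkcond [leRHS]integral_mkcond.
apply: le_integral_nonneg => x _.
  by apply: erestrict_ge0 => t /DE; exact: f0.
rewrite !patchE; case: ifPn => xD; first by rewrite ifT// inE; apply: DE; rewrite -inE.
by case: ifP => // /[!inE]; exact: f0.
Qed.

End nonnegative_integral.

(** * Averages over a symmetric kernel *)

Section kernel_averages.
Context d (T : measurableType d) {R : realType}.
Variable mu : {sigma_finite_measure set T -> \bar R}.
(** [U x] models the ball around [x]. Symmetry of the relation and the constant measure [v] make
    averaging over [U x] self-adjoint and a contraction of L^1. *)
Variables (U : T -> set T) (v : R).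
Hypothesis mU : measurable [set z : T * T | U z.1 z.2].
Hypothesis symU : forall x y, U x y -> U y x.
Hypothesis muU : forall x, mu (U x) = v%:E.
Hypothesis v0 : 0 < v.

Let near_set := [set z : T * T | U z.1 z.2].

Let near_setE x y : \1_near_set (x, y) = \1_(U x) y :> R.
Proof. by []. Qed.

Let U_sym x y : \1_(U x) y = \1_(U y) x :> R.
Proof. by rewrite !indicE; congr ((_ _)%:R); apply/idP/idP; rewrite !inE => /symU. Qed.

Lemma measurable_kernel x : measurable (U x).
Proof.
have := measurable_xsection x mU; congr (measurable _).
by apply/funext => y; rewrite /xsection/= inE.
Qed.

Let mindic x : measurable_fun setT (fun y => (\1_(U x) y)%:E : \bar R).
Proof. by apply/measurable_EFinP; apply: measurable_indic; exact: measurable_kernel. Qed.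

Lemma integral_kernel (h : T -> \bar R) x :
  (\int[mu]_(y in U x) h y = \int[mu]_y (h y * (\1_(U x) y)%:E))%E.
Proof.
rewrite integral_mkcond; apply: eq_integral => y _; rewrite patchE indicE.
by case: ifP => _; rewrite ?mule1 ?mule0.
Qed.

Let measurable_kernel2 (h : T -> \bar R) : measurable_fun setT h ->
  measurable_fun setT (fun z : T * T => h z.2 * (\1_near_set z)%:E)%E.
Proof.
move=> mh; apply: emeasurable_funM.
  by apply: (measurableT_comp mh); exact: measurable_snd.
by apply/measurable_EFinP; exact: measurable_indic.
Qed.

(** After exchanging the integrals, [y] is counted by the [x] with [U x y], which by symmetry is the
    set [U y] of measure [v]. *)
Lemma tonelli_kernel (h : T -> \bar R) : measurable_fun setT h ->
  (forall x, 0 <= h x)%E ->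
  (\int[mu]_x \int[mu]_(y in U x) h y = v%:E * \int[mu]_y h y)%E.
Proof.
move=> mh h0; under eq_integral do rewrite integral_kernel.
have f0 (z : T * T) : (0 <= h z.2 * (\1_near_set z)%:E)%E by rewrite mule_ge0// lee_fin.
rewrite (fubini_tonelli _ (measurable_kernel2 mh) f0)/=.
rewrite -ge0_integralZl//; last by rewrite lee_fin ltW.
apply: eq_integral => y _.
under eq_integral do rewrite near_setE U_sym.
rewrite ge0_integralZl//=.
rewrite integral_indic//; last exact: measurable_kernel.
by rewrite setIT muleC; congr (_ * _)%E; exact: muU.
Qed.

Lemma measurable_integral_kernel (h : T -> \bar R) : measurable_fun setT h ->
  (forall x, 0 <= h x)%E ->
  measurable_fun setT (fun x => \int[mu]_(y in U x) h y)%E.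
Proof.
move=> mh h0.
have f0 (z : T * T) : (0 <= h z.2 * (\1_near_set z)%:E)%E by rewrite mule_ge0// lee_fin.
have := measurable_fun_fubini_tonelli_F (m2 := mu) _ (measurable_kernel2 mh) f0.
by apply: eq_measurable_fun => x _; rewrite integral_kernel.
Qed.

Section fubini.
Variables (g eta : T -> R) (C : R).
Hypothesis ig : mu.-integrable setT (EFin \o g).
Hypothesis meta : measurable_fun setT eta.
Hypothesis C0 : 0 <= C.
Hypothesis beta : forall x, `|eta x| <= C.

Let f (z : T * T) := ((eta z.1 * g z.2 * \1_near_set z)%R%:E : \bar R).

Let mg : measurable_fun setT g.
Proof. by apply/measurable_EFinP; exact: measurable_int ig. Qed.

Let measurable_f : measurable_fun setT f.
Proof.
apply/measurable_EFinP; apply: measurable_funM; last exact: measurable_indic.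
apply: measurable_funM; apply: measurableT_comp => //; exact: measurable_snd.
Qed.

Let integrable_f : (mu \x mu)%E.-integrable setT f.
Proof.
apply/(integrable12ltyP _ _ measurable_f).
apply: (@le_lt_trans _ _ (\int[mu]_x (C%:E * \int[mu]_(y in U x) `|(g y)%:E|))%E).
  apply: le_integral_nonneg => x _; first exact: integral_ge0.
  rewrite integral_kernel -ge0_integralZl//.
  - apply: le_integral_nonneg => y _ //.
    rewrite /f/= near_setE !normrM [X in (_ * X)%:E]ger0_norm//.
    by rewrite -EFinM lee_fin -mulrA ler_wpM2r// mulr_ge0.
  - apply: emeasurable_funM => //.
    by apply: measurableT_comp => //; exact/measurable_EFinP.
have mag : measurable_fun setT (fun y => `|(g y)%:E|%E).
  by apply: measurableT_comp => //; exact/measurable_EFinP.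
rewrite (ge0_integralZl mu measurableT (measurable_integral_kernel mag _))//; last first.
  by move=> x _; exact: integral_ge0.
rewrite tonelli_kernel//.
by move/integrableP : ig => [_ goo]; rewrite lte_mul_pinfty// lte_mul_pinfty// lee_fin ltW.
Qed.

Lemma integrable_kernel x : mu.-integrable (U x) (EFin \o g).
Proof. by apply: integrableS ig => //; exact: measurable_kernel. Qed.

Let FE x : (\int[mu]_y f (x, y) = (eta x * \int[mu]_(y in U x) g y)%R%:E)%E.
Proof.
rewrite EFinM /Rintegral fineK; last by apply: integrable_fin_num; [exact: measurable_kernel|exact: integrable_kernel].
rewrite integral_kernel -integralZl//.
  by apply: eq_integral => y _; rewrite /f/= near_setE !EFinM muleA.
have /(integrable_mkcond _ (measurable_kernel x)) := integrable_kernel x.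
apply: eq_integrable => // y _; rewrite patchE indicE.
by case: ifP => _; rewrite ?mule1 ?mule0.
Qed.

Lemma integrable_kernel_bounded y : mu.-integrable (U y) (EFin \o eta).
Proof.
apply: measurable_bounded_integrable => //.
- exact: measurable_kernel.
- by rewrite [X in (X < _)%E](_ : _ = v%:E) ?ltry//; exact: muU.
- exact: measurable_funTS.
- exists C; split; first exact: num_real.
  by move=> D CD x _ /=; exact: le_trans (beta x) (ltW CD).
Qed.

Let GE y : (\int[mu]_x f (x, y) = (g y * \int[mu]_(x in U y) eta x)%R%:E)%E.
Proof.
rewrite EFinM /Rintegral fineK; last by apply: integrable_fin_num; [exact: measurable_kernel|exact: integrable_kernel_bounded].
rewrite integral_kernel -integralZl//.
  apply: eq_integral => x _; rewrite /f/= near_setE U_sym -!EFinM.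
  by congr EFin; ring.
have /(integrable_mkcond _ (measurable_kernel y)) := integrable_kernel_bounded y.
apply: eq_integrable => // x _; rewrite patchE indicE.
by case: ifP => _; rewrite ?mule1 ?mule0.
Qed.

Lemma fubini_kernel :
  (\int[mu]_x (eta x * \int[mu]_(y in U x) g y)%R%:E =
   \int[mu]_y (g y * \int[mu]_(x in U y) eta x)%R%:E)%E.
Proof.
under eq_integral do rewrite -FE.
by rewrite (Fubini integrable_f); apply: eq_integral => y _; rewrite GE.
Qed.

Lemma measurable_Rintegral_kernel_bounded :
  measurable_fun setT (fun x => eta x * \int[mu]_(y in U x) g y).
Proof.
apply/measurable_EFinP; have := measurable_fubini_F integrable_f.
by apply: eq_measurable_fun => x _; rewrite /fubini_F FE.
Qed.

End fubini.

End kernel_averages.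

Section average_operator.
Context d (T : measurableType d) {R : realType}.
Variable mu : {sigma_finite_measure set T -> \bar R}.

(** Integrating the local inequality over all centres [z] counts every point with weight [v1] on the
    left and [v2] on the right. This does the work of a covering with bounded overlap. *)
Lemma le_integral_of_le_kernel (U1 U2 : T -> set T) (v1 v2 : R) (f h : T -> \bar R) :
  measurable [set z : T * T | U1 z.1 z.2] -> (forall x y, U1 x y -> U1 y x) ->
  (forall x, mu (U1 x) = v1%:E) -> 0 < v1 ->
  measurable [set z : T * T | U2 z.1 z.2] -> (forall x y, U2 x y -> U2 y x) ->
  (forall x, mu (U2 x) = v2%:E) -> 0 < v2 ->
  measurable_fun setT f -> (forall x, 0 <= f x)%E ->
  measurable_fun setT h -> (forall x, 0 <= h x)%E ->
  (forall z, \int[mu]_(x in U1 z) f x <= \int[mu]_(x in U2 z) h x)%E ->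
  (\int[mu]_x f x <= (v2 / v1)%:E * \int[mu]_x h x)%E.
Proof.
move=> mU1 sU1 muU1 v10 mU2 sU2 muU2 v20 mf f0 mh h0 fh.
rewrite mulrC EFinM -muleA -(tonelli_kernel mU2 sU2 muU2)//.
rewrite -lee_pdivrMl ?invr_gt0// invrK -(tonelli_kernel mU1 sU1 muU1)//.
by apply: le_integral_nonneg => z _; [exact: integral_ge0|exact: fh].
Qed.

Variables (U : T -> set T) (v : R).
Hypothesis mU : measurable [set z : T * T | U z.1 z.2].
Hypothesis symU : forall x y, U x y -> U y x.
Hypothesis muU : forall x, mu (U x) = v%:E.
Hypothesis v0 : 0 < v.

Definition average (g : T -> R) (x : T) : R := v^-1 * \int[mu]_(y in U x) g y.

Section integrable.
Variable g : T -> R.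
Hypothesis ig : mu.-integrable setT (EFin \o g).

Lemma le_average x : ((`|average g x|)%:E <=
  (v^-1)%:E * \int[mu]_(y in U x) (`|g y|)%:E)%E.
Proof.
have mUx := measurable_kernel mU x.
rewrite /average normrM gtr0_norm ?invr_gt0// EFinM lee_pmul2l ?lte_fin ?invr_gt0//.
rewrite EFin_normr_Rintegral//; last exact: integrable_kernel.
apply: le_abse_integral => //; apply: measurable_funTS.
exact: measurable_int ig.
Qed.

(** The absolute value moves inside the average; integrating over centres then produces a factor [v]
    that cancels the normalisation. *)
Lemma integral_average_le :
  (\int[mu]_x (`|average g x|)%:E <= \int[mu]_x (`|g x|)%:E)%E.
Proof.
have mg : measurable_fun setT (fun x => (`|g x|)%:E).
  apply/measurable_EFinP; apply: measurableT_comp => //.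
  by apply/measurable_EFinP; exact: measurable_int ig.
apply: le_trans (_ : _ <= \int[mu]_x ((v^-1)%:E * \int[mu]_(y in U x) (`|g y|)%:E))%E _.
  by apply: le_integral_nonneg => x _; [rewrite lee_fin|exact: le_average].
rewrite (ge0_integralZl mu measurableT (measurable_integral_kernel mu mU mg _))//; last 2 first.
- by move=> x _; exact: integral_ge0.
- by rewrite lee_fin invr_ge0 ltW.
by rewrite (tonelli_kernel mU symU muU)// muleA -EFinM mulVf ?gt_eqF// mul1e.
Qed.

Lemma measurable_average : measurable_fun setT (average g).
Proof.
rewrite /average.
have := @measurable_Rintegral_kernel_bounded _ _ _ _ _ _ mU symU muU v0 g
  (fun=> v^-1) (`|v^-1|) ig.
by apply.
Qed.

End integrable.

Lemma averageB (g h : T -> R) x : mu.-integrable setT (EFin \o g) ->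
  mu.-integrable setT (EFin \o h) ->
  average (fun y => g y - h y) x = average g x - average h x.
Proof.
move=> ig ih; rewrite /average -mulrBr; congr (_ * _).
by apply: RintegralB; [exact: measurable_kernel|exact: integrable_kernel|exact: integrable_kernel].
Qed.

Lemma integral_average_mul (g eta : T -> R) (C : R) :
  mu.-integrable setT (EFin \o g) -> measurable_fun setT eta ->
  (forall x, `|eta x| <= C) -> 0 <= C ->
  \int[mu]_x (average g x * eta x) = \int[mu]_x (g x * average eta x).
Proof.
move=> ig meta etaC C0.
have E1 x : average g x * eta x = (v^-1 * eta x) * \int[mu]_(y in U x) g y.
  by rewrite /average; ring.
have E2 x : g x * average eta x = g x * \int[mu]_(y in U x) (v^-1 * eta y).
  rewrite /average RintegralZl//; first exact: measurable_kernel.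
  exact: (integrable_kernel_bounded mU muU meta etaC).
under eq_Rintegral do rewrite E1; under [RHS]eq_Rintegral do rewrite E2.
congr fine; apply: (fubini_kernel mU symU muU v0 ig (C := v^-1 * C)).
- exact: measurable_funM.
- by rewrite mulr_ge0// invr_ge0 ltW.
- by move=> x; rewrite normrM gtr0_norm ?invr_gt0// ler_wpM2l// invr_ge0 ltW.
Qed.

Lemma average_near (h : T -> R) (x : T) (c : R) :
  mu.-integrable (U x) (EFin \o h) -> (forall y, U x y -> `|h y - h x| <= c) ->
  `|average h x - h x| <= c.
Proof.
move=> ih hc; have mUx := measurable_kernel mU x.
have muUx : fine (mu (U x)) = v by rewrite (_ : _ (U x) = v%:E)//; exact: muU.
have Uoo : (mu (U x) < +oo)%E.
  by rewrite [X in (X < _)%E](_ : _ = v%:E) ?ltry//; exact: muU.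
have icst (k : R) : mu.-integrable (U x) (EFin \o cst k).
  apply: measurable_bounded_integrable => //; exists `|k|; split; first exact: num_real.
  by move=> M kM y _ /=; exact: ltW.
have -> : average h x - h x = v^-1 * \int[mu]_(y in U x) (h y - h x).
  rewrite RintegralB//; last exact: icst.
  by rewrite Rintegral_cst// muUx mulrBr /average mulrCA mulVf ?mulr1// gt_eqF.
rewrite normrM gtr0_norm ?invr_gt0// -ler_pdivlMl ?invr_gt0// invrK.
have ihc : mu.-integrable (U x) (EFin \o (fun y => h y - h x)).
  by have := integrableB mUx ih (icst (h x)).
apply: le_trans (le_normr_Rintegral mUx ihc) _.
rewrite -muUx mulrC -Rintegral_cst//; apply: le_Rintegral => //.
  exact: integrable_norm.
exact: icst.
Qed.

(** The error of [g] splits into the average of g - h, the difference h - g, and the error of [h].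
    The first two each cost the L^1 distance, by contraction; the last is uniformly small. *)
Lemma integral_averageB_le (g h : T -> R) (B : set T) (c : R) :
  mu.-integrable setT (EFin \o g) -> mu.-integrable setT (EFin \o h) ->
  measurable B -> 0 <= c -> (forall x, B x -> `|average h x - h x| <= c) ->
  (\int[mu]_(x in B) (`|average g x - g x|)%:E <=
    2%:E * (\int[mu]_x (`|g x - h x|)%:E) + c%:E * mu B)%E.
Proof.
move=> ig ih mB c0 hc.
have mg : measurable_fun setT g by apply/measurable_EFinP; exact: measurable_int ig.
have mh : measurable_fun setT h by apply/measurable_EFinP; exact: measurable_int ih.
have igh : mu.-integrable setT (EFin \o (fun y => g y - h y)).
  by have := integrableB measurableT ig ih.
have mgh : measurable_fun setT (fun x => `|g x - h x|).
  by apply: measurableT_comp => //; exact: measurable_funB.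
have magh := measurable_average igh.
apply: (@le_trans _ _ (\int[mu]_(x in B)
    ((`|average (fun y => (g y - h y)%R) x|)%:E + ((`|g x - h x|)%:E + c%:E)))%E).
  apply: le_integral_nonneg => x Bx; first by rewrite lee_fin.
  rewrite averageB// -!EFinD lee_fin.
  have -> : average g x - g x =
     (average g x - average h x) + (h x - g x) + (average h x - h x) by ring.
  apply: le_trans (ler_normD _ _) _; rewrite [leRHS]addrA lerD ?hc//.
  by apply: le_trans (ler_normD _ _) _; rewrite (distrC (h x)).
rewrite ge0_integralD//; last 3 first.
- by apply/measurable_EFinP; apply: measurable_funTS; apply: measurableT_comp.
- by move=> x _; rewrite adde_ge0.
- apply: emeasurable_funD => //; apply/measurable_EFinP; exact: measurable_funTS.
rewrite ge0_integralD//; last by apply/measurable_EFinP; exact: measurable_funTS.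
rewrite integral_cst// addeA leeD2r// mule_natl mule2n; apply: leeD.
  by apply: le_trans (integral_average_le igh); exact: subset_integral_nonneg.
exact: subset_integral_nonneg.
Qed.

End average_operator.

(** * Density of bounded Lipschitz functions in L^1 *)

Section lipschitz_density.
Context {R : realType} {n : nat}.
Local Notation cV := 'cV[R]_n.
Local Notation T := (measurableTypeR R).
Variables (mu : {measure set cV -> \bar R}) (Q : set cV).
Hypothesis mQ : measurable Q.
Hypothesis Qoo : (mu Q < +oo)%E.
Implicit Types (g h k : cV -> R).

Definition L1dist g h := (\int[mu]_(x in Q) (`|g x - h x|)%:E)%E.

Let mdist g h : measurable_fun setT g -> measurable_fun setT h ->
  measurable_fun Q (fun x => (`|g x - h x|)%:E).
Proof.
move=> mg mh; apply/measurable_EFinP.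
have mgh := measurable_funB (measurable_funTS mg (D := Q)) (measurable_funTS mh).
by apply: measurableT_comp mgh.
Qed.

Let dist_ge0 g h x : (0 <= (`|g x - h x|)%:E)%E.
Proof. by rewrite lee_fin. Qed.

Let L1dist_trans g k h : measurable_fun setT g -> measurable_fun setT k ->
  measurable_fun setT h -> (L1dist g h <= L1dist g k + L1dist k h)%E.
Proof.
move=> mg mk mh; rewrite -(ge0_integralD mu mQ (fun x _ => dist_ge0 g k x) (mdist mg mk)
  (fun x _ => dist_ge0 k h x) (mdist mk mh)).
apply: le_integral_nonneg => x _; rewrite ?lee_fin//.
exact: ler_distD.
Qed.

Definition lipschitz_approximable g := measurable_fun setT g /\
  forall e, 0 < e -> exists2 h, bounded_lipschitz h & (L1dist g h <= e%:E)%E.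

Lemma lipschitz_approximable_lim g : measurable_fun setT g ->
  (forall e, 0 < e -> exists2 k, lipschitz_approximable k & (L1dist g k <= e%:E)%E) ->
  lipschitz_approximable g.
Proof.
move=> mg H; split => // e e0.
have e20 : 0 < e / 2 by rewrite divr_gt0.
have [k [mk kP] gk] := H _ e20.
have [h hl kh] := kP _ e20; exists h => //.
apply: le_trans (L1dist_trans mg mk (bounded_lipschitz_measurable hl)) _.
by rewrite (splitr e) EFinD leeD.
Qed.

(** Dominated convergence with the constant 1, which is integrable on [Q] of finite measure. *)
Let approx_cvg (g_ : nat -> cV -> R) g : (forall i, lipschitz_approximable (g_ i)) ->
  (forall i x, `|g_ i x| <= 1) -> (forall x, g_ i x @[i --> \oo] --> g x) ->
  lipschitz_approximable g.
Proof.
move=> ag g1 gg.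
have mg : measurable_fun setT g.
  apply: (measurable_fun_cvg (h := g_)); last by move=> x _; exact: gg.
  by move=> i; exact: (ag i).1.
apply: lipschitz_approximable_lim => // e e0.
have [] := @dominated_convergence _ _ _ mu Q mQ (fun i x => (g_ i x)%:E)
    (EFin \o g) (cst 1%E).
- by move=> i; apply/measurable_EFinP; apply: measurable_funTS; exact: (ag i).1.
- by apply/measurable_EFinP; exact: measurable_funTS.
- by apply: aeW => x _; apply: cvg_EFin; [exact: nearW|exact: gg].
- apply: measurable_bounded_integrable => //; exists 1; split => //.
  by move=> M M1 x _ /=; rewrite normr1 ltW.
- by apply: aeW => x i _; rewrite abse_EFin lee_fin.
move=> _ /fine_cvgP[fin /cvgr0Pnorm_lt /(_ e e0) lt] _.
near \oo => i.
exists (g_ i); first exact: ag.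
have : ((\int[mu]_(x in Q) `|(g_ i x)%:E - (g x)%:E|) \is a fin_num)%E by near: i.
move=> /fineK fk.
rewrite /L1dist; under eq_integral do rewrite distrC.
rewrite -[leLHS]fk lee_fin; apply: le_trans (ler_norm _) _.
by apply: ltW; near: i.
Unshelve. all: by end_near. Qed.

Lemma lipschitz_approximableD g h : lipschitz_approximable g -> lipschitz_approximable h ->
  lipschitz_approximable (fun x => g x + h x).
Proof.
move=> [mg ag] [mh ah]; split; first exact: measurable_funD.
move=> e e0; have e20 : 0 < e / 2 by rewrite divr_gt0.
have [k kl gk] := ag _ e20; have [l ll hl] := ah _ e20.
exists (fun x => k x + l x); first exact: bounded_lipschitzD.
rewrite (splitr e) EFinD; apply: le_trans (leeD gk hl).
have mk := bounded_lipschitz_measurable kl.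
have ml := bounded_lipschitz_measurable ll.
rewrite -(ge0_integralD mu mQ (fun x _ => dist_ge0 g k x) (mdist mg mk)
  (fun x _ => dist_ge0 h l x) (mdist mh ml)).
apply: le_integral_nonneg => x _; rewrite ?lee_fin//.
rewrite (_ : g x + h x - _ = (g x - k x) + (h x - l x)); last by ring.
exact: ler_normD.
Qed.

Lemma lipschitz_approximableM g h : lipschitz_approximable g -> lipschitz_approximable h ->
  (exists C, forall x, `|g x| <= C) ->
  lipschitz_approximable (fun x => g x * h x).
Proof.
move=> [mg ag] [mh ah] [C gC]; split; first exact: measurable_funM.
have C0 : 0 <= C by apply: le_trans (gC 0).
(* The approximant [l] of [h] comes first, since its bound [D] fixes the precision required of the
   approximant of [g]. Adding 1 to the bounds avoids division by zero. *)
move=> e e0; have e20 : 0 < e / 2 / (C + 1) by rewrite !divr_gt0// ltr_wpDl.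
have [l ll hl] := ah _ e20.
have [D [D0 lD _]] := bounded_lipschitz_ge0 ll.
have e30 : 0 < e / 2 / (D + 1) by rewrite !divr_gt0// ltr_wpDl.
have [k kl gk] := ag _ e30.
exists (fun x => k x * l x); first exact: bounded_lipschitzM.
have mk := bounded_lipschitz_measurable kl.
have ml := bounded_lipschitz_measurable ll.
apply: (@le_trans _ _ (D%:E * L1dist g k + C%:E * L1dist h l)%E).
  have E1 (c : R) u w : 0 <= c -> measurable_fun setT u -> measurable_fun setT w ->
      (c%:E * L1dist u w = \int[mu]_(x in Q) (c%:E * (`|u x - w x|)%:E))%E.
    by move=> c0 mu' mw; rewrite (ge0_integralZl mu mQ (mdist mu' mw)).
  rewrite !E1// -(ge0_integralD mu mQ _ (measurable_funeM _ (mdist mg mk)) _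
    (measurable_funeM _ (mdist mh ml))); last 2 first.
  - by move=> x _; rewrite mule_ge0.
  - by move=> x _; rewrite mule_ge0.
  apply: le_integral_nonneg => x _; first by rewrite lee_fin.
  rewrite (_ : g x * h x - _ = (g x - k x) * l x + g x * (h x - l x)); last by ring.
  rewrite -!EFinM -EFinD lee_fin; apply: le_trans (ler_normD _ _) _; rewrite !normrM.
  by apply: lerD; [rewrite mulrC ler_wpM2r|rewrite ler_wpM2r].
apply: (@le_trans _ _ (D%:E * (e / 2 / (D + 1))%:E + C%:E * (e / 2 / (C + 1))%:E)%E).
  by apply: leeD; apply: lee_wpmul2l.
have key (c : R) : 0 <= c -> c * (e / 2 / (c + 1)) <= e / 2.
  move=> c0; rewrite mulrA ler_pdivrMr ?ltr_wpDl//.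
  by rewrite mulrDr mulr1 mulrC lerDl divr_ge0// ltW.
by rewrite -!EFinM -EFinD lee_fin [leRHS](splitr e); apply: lerD; exact: key.
Qed.

Lemma lipschitz_approximable_cst (c : R) : lipschitz_approximable (fun=> c).
Proof.
split => // e e0; exists (fun=> c); first exact: bounded_lipschitz_cst.
by rewrite /L1dist integral0_eq ?lee_fin ?ltW// => x _; rewrite subrr normr0.
Qed.

Let approx_lipschitz h : bounded_lipschitz h -> lipschitz_approximable h.
Proof.
move=> hl; split; first exact: bounded_lipschitz_measurable.
move=> e e0; exists h => //.
by rewrite /L1dist integral0_eq ?lee_fin ?ltW// => x _; rewrite subrr normr0.
Qed.

(* The sets with approximable indicator form a sigma-algebra containing the
   half-spaces [x_i > c]. *)
Let good (A : set cV) := measurable A /\ lipschitz_approximable (\1_A : cV -> R).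

Let goodC (A : set cV) : good A -> good (~` A).
Proof.
move=> [mA aA]; split; first exact: measurableC.
have -> : \1_(~` A) = (fun x => 1 + (-1) * \1_A x) :> (cV -> R).
  apply/funext => x; rewrite !indicE in_setC.
  by case: (x \in A); rewrite /= ?mulr1 ?mulr0 ?subrr ?addr0.
apply: lipschitz_approximableD; first exact: lipschitz_approximable_cst.
apply: lipschitz_approximableM; [exact: lipschitz_approximable_cst|exact: aA|exists 1 => x].
by rewrite normrN1.
Qed.

Let goodI (A B : set cV) : good A -> good B -> good (A `&` B).
Proof.
move=> [mA aA] [mB aB]; split; first exact: measurableI.
rewrite indicI; apply: lipschitz_approximableM; [exact: aA|exact: aB|exists 1 => x].
by rewrite indicE ger0_norm// lern1 leq_b1.
Qed.

Let goodU (A B : set cV) : good A -> good B -> good (A `|` B).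
Proof. by move=> gA gB; rewrite -[A `|` B]setCK setCU; apply: goodC; apply: goodI; exact: goodC. Qed.

Let good_bigcup (F : nat -> set cV) : (forall i, good (F i)) -> good (\bigcup_i F i).
Proof.
move=> gF; split; first by apply: bigcupT_measurable => i; exact: (gF i).1.
pose B (N : nat) := \big[setU/set0]_(i < N) F i.
have gB N : good (B N).
  rewrite /B; elim/big_ind : _ => [||i _]; [|exact: goodU|exact: gF].
  by split; [exact: measurable0|rewrite indic0; exact: lipschitz_approximable_cst].
apply: (@approx_cvg (fun N => \1_(B N))); first by move=> N; exact: (gB N).2.
  by move=> N x; rewrite indicE ger0_norm// lern1 leq_b1.
move=> x; have [[k _ Fkx]|nFx] := pselect ((\bigcup_i F i) x).
  apply: cvg_near_cst; near=> N.
  rewrite !indicE !mem_set//; first by exists k.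
  rewrite /B -bigcup_mkord; exists k => //=.
  by near: N; exists k.+1.
apply: cvg_near_cst; near=> N; rewrite !indicE !memNset//.
by rewrite /B -bigcup_mkord => -[k _ Fkx]; apply: nFx; exists k.
Unshelve. all: by end_near. Qed.

Let clamp_lip (a b : R) :
  `|Num.min 1 (Num.max 0 a) - Num.min 1 (Num.max 0 b)| <= `|a - b|.
Proof.
wlog ab : a b / a <= b.
  move=> H; have [ab|/ltW ba] := leP a b; first exact: H.
  by rewrite distrC [leRHS]distrC; exact: H.
rewrite (distrC a) (ger0_norm (_ : 0 <= b - a)) ?subr_ge0// ler_norml.
rewrite /Num.min /Num.max /Order.min /Order.max.
by repeat case: ifPn; rewrite -?leNgt; lra.
Qed.

(** The indicator of a half-space is the pointwise limit of ramps of slope [j] clamped to [0, 1]. *)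
Let good_ray (i : 'I_n) (c : R) : good [set x | c < x i 0].
Proof.
split.
  rewrite -[X in measurable X]setTI.
  exact: (measurable_fun_ltr (measurable_cst c) (measurable_coord i)).
apply: (@approx_cvg (fun j x => Num.min 1 (Num.max 0 (j%:R * (x i 0 - c))))).
- move=> j; apply: approx_lipschitz; exists (Num.max 1 j%:R); split => [x|x y].
    rewrite ger0_norm; last by rewrite le_min ler01 le_max lexx.
    by rewrite ge_min le_max lexx.
  apply: le_trans (clamp_lip _ _) _.
  rewrite -mulrBr normrM normr_nat; apply: (@le_trans _ _ (j%:R * enorm (x - y))).
    rewrite ler_wpM2l// (_ : _ - _ - _ = (x - y) i 0) ?coord_le_enorm// !mxE.
    by ring.
  by rewrite ler_wpM2r ?enorm_ge0// le_max lexx orbT.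
- move=> j x; rewrite ger0_norm; last by rewrite le_min ler01 le_max lexx.
  by rewrite ge_min lexx.
move=> x; have [cx|xc] := ltP c (x i 0).
  apply: cvg_near_cst; near=> j.
  rewrite indicE mem_set//.
  have j1 : 1 <= j%:R * (x i 0 - c).
    rewrite -ler_pdivrMr ?subr_gt0//; near: j; exact: nbhs_infty_ger.
  by rewrite max_r ?(le_trans ler01 j1)// min_l.
apply: cvg_near_cst; near=> j.
rewrite indicE memNset/=; last by apply/negP; rewrite -leNgt.
rewrite max_l ?min_r// mulr_ge0_le0// subr_le0//.
Unshelve. all: by end_near. Qed.

Let good_sigma_algebra : sigma_algebra setT good.
Proof.
split.
- by split; [exact: measurable0|rewrite indic0; exact: lipschitz_approximable_cst].
- by move=> A gA; rewrite setTD; exact: goodC.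
- by move=> F gF; exact: good_bigcup.
Qed.

Let good_coord (i : 'I_n) (Y : set T) : measurable Y ->
  good [set x | Y (x i 0)].
Proof.
pose C := [set Y : set R | good [set x | Y (x i 0)]].
suff : (@measurable _ T) `<=` C by apply.
rewrite (_ : @measurable _ T = <<s @RGenOInfty.G R >>); last first.
  exact: RGenOInfty.measurableE.
apply: smallest_sub; last first.
  move=> _ [c ->]; rewrite /C/=.
  by have := good_ray i c; congr good; apply/seteqP; split=> x /=; rewrite in_itv/= andbT.
have [s0 sC sU] := good_sigma_algebra.
split.
- exact: s0.
- by move=> A CA; exact: (sC _ CA).
- by move=> F CF; exact: (sU _ CF).
Qed.

Let v2t (x : cV) : n.-tuple T := [tuple (x i 0 : T) | i < n].

Lemma lipschitz_approximable_tuple (A : set cV) :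
  measurable (@cV_of_tuple R n @^-1` A : set (n.-tuple T)) ->
  lipschitz_approximable (\1_A : cV -> R).
Proof.
move=> mA.
pose C := [set X : set (n.-tuple T) | good (v2t @^-1` X)].
suff H : (@measurable _ (n.-tuple T)) `<=` C.
  have := (H _ mA).2; congr (lipschitz_approximable \1_ _).
  apply/funext => x /=; congr A; apply/colP => i.
  by rewrite mxE tnth_mktuple.
have [s0 sC sU] := good_sigma_algebra.
apply: smallest_sub.
  split.
  - exact: s0.
  - by move=> X CX; exact: (sC _ CX).
  - by move=> F CF; exact: (sU _ CF).
rewrite -bigcup_seq/=; apply: bigcup_sub => i _ _ [Y mY <-]; rewrite setTI /C/=.
have := good_coord i mY; congr good.
by apply/funext => x /=; rewrite /v2t tnth_mktuple.
Qed.

End lipschitz_density.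

Section lebesgue_density.
Import HBSimple.
Context {R : realType} {n : nat}.
Local Notation cV := 'cV[R]_n.
Local Notation leb := (@lebesgue_cV R n).
Variable Q : set cV.
Hypothesis mQ : measurable Q.
Hypothesis Qoo : (leb Q < +oo)%E.
Implicit Types (g h k : cV -> R).

(** [A] need only be measurable for the completion: [leb_approx] gives a set of the product
    sigma-algebra that differs from it little in measure inside [Q]. *)
Lemma lipschitz_approximable_indic (A : set cV) : measurable A ->
  lipschitz_approximable leb Q (\1_A).
Proof.
move=> mA; apply: (lipschitz_approximable_lim mQ); first exact: measurable_indic.
move=> e e0.
have mAQ : measurable (A `&` Q) by exact: measurableI.
have AQoo : (leb (A `&` Q) < +oo)%E by apply: le_lt_trans Qoo; apply: measureIr.
have [A' [mA' AA' A'e]] := leb_approx mAQ AQoo e0.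
have mA'' := (tuple_measurable_cV mA').1.
exists (\1_A'); first exact: lipschitz_approximable_tuple.
apply: le_trans A'e.
have -> : leb (A' `\` (A `&` Q)) = (\int[leb]_x (\1_(A' `\` (A `&` Q)) x)%:E)%E.
  by rewrite integral_indic ?setIT//; exact: measurableD.
rewrite /L1dist integral_mkcond; apply: le_integral_nonneg => x _.
  by apply: erestrict_ge0 => y _.
rewrite patchE; case: ifPn => [|_]; last by rewrite lee_fin.
rewrite inE lee_fin => Qx; rewrite !indicE in_setD in_setI (mem_set Qx) andbT.
have [Ax|nAx] := boolP (x \in A).
  rewrite mem_set ?subrr ?normr0//; apply: AA'; split => //.
  by move: Ax; rewrite inE.
by rewrite sub0r normrN normr_nat andbT.
Qed.

Lemma lipschitz_approximable_integrable g : measurable_fun setT g ->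
  leb.-integrable Q (EFin \o g) -> lipschitz_approximable leb Q g.
Proof.
move=> mg ig; apply: (lipschitz_approximable_lim mQ mg) => e e0.
have [g_ [_ _ /fine_cvgP[fin /cvgr0Pnorm_lt /(_ e e0) lt]]] :=
  approximation_sfun_integrable mQ ig.
have [i [ifin ilt]] : exists i,
    (\int[leb]_(z in Q) `|(g z)%:E - (g_ i z)%:E|)%E \is a fin_num /\
    `|fine (\int[leb]_(z in Q) `|(g z)%:E - (g_ i z)%:E|)%E| < e.
  near \oo => i; exists i; split; near: i => //.
exists (g_ i); last first.
  rewrite /L1dist -[leLHS](fineK ifin) lee_fin; apply: le_trans (ler_norm _) _.
  exact: ltW.
have mgi : measurable_fun setT (g_ i) by [].
have [N [S E]] : exists N (S : seq R), forall x, g_ i x =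
    \sum_(j < N) (S`_j * \1_(g_ i @^-1` [set S`_j]) x).
  by eexists; eexists; exact: fimfunEord.
have -> : (g_ i : cV -> R) = (fun x => \sum_(j < N) (S`_j * \1_(g_ i @^-1` [set S`_j]) x)).
  by apply/funext => x; exact: E.
elim: N {E} => [|N IH].
  have -> : (fun x : cV => \sum_(j < 0) (S`_j * \1_(g_ i @^-1` [set S`_j]) x)) = (fun=> 0).
    by apply/funext => x; rewrite big_ord0.
  exact: lipschitz_approximable_cst.
have -> : (fun x : cV => \sum_(j < N.+1) (S`_j * \1_(g_ i @^-1` [set S`_j]) x)) =
    (fun x => \sum_(j < N) (S`_j * \1_(g_ i @^-1` [set S`_j]) x) +
      S`_N * \1_(g_ i @^-1` [set S`_N]) x).
  by apply/funext => x; rewrite big_ord_recr.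
apply: (lipschitz_approximableD mQ IH).
apply: (lipschitz_approximableM mQ).
- exact: lipschitz_approximable_cst.
- apply: lipschitz_approximable_indic.
  by rewrite -[X in measurable X]setTI; exact: mgi.
- by exists `|S`_N|.
Unshelve. all: by end_near. Qed.

End lebesgue_density.

(** * Ball averages and their convergence in L^1 *)

Section ball_averages.
Context {R : realType} {n : nat}.
Local Notation cV := 'cV[R]_n.
Local Notation leb := (@lebesgue_cV R n).
Implicit Types (x y z : cV) (e : R) (g h : cV -> R) (B Q : set cV).

Lemma measurable_eball_rel e : measurable [set z : cV * cV | eball z.1 e z.2].
Proof.
rewrite -[X in measurable X]setTI.
apply: (measurable_fun_ltr (f := fun z : cV * cV => enorm (z.2 - z.1))
  _ (measurable_cst e)) => //.
apply: measurable_enormB => i.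
- by apply: (measurableT_comp (measurable_coord i)); exact: measurable_snd.
- by apply: (measurableT_comp (measurable_coord i)); exact: measurable_fst.
Qed.

Lemma eball_sym e x y : eball x e y -> eball y e x.
Proof. by rewrite /eball/= enormBC. Qed.

Definition ball_average e g : cV -> R :=
  average leb (fun x => eball x e) (vol n e) g.

Lemma restrict_integrable Q g : measurable Q -> leb.-integrable Q (EFin \o g) ->
  leb.-integrable setT (EFin \o (g \_ Q)).
Proof.
move=> mQ /(integrable_mkcond _ mQ).
by apply: eq_integrable => // x _; rewrite /= !patchE; case: ifP.
Qed.

Lemma lipschitz_integrable Q h : measurable Q -> (leb Q < +oo)%E ->
  bounded_lipschitz h -> leb.-integrable Q (EFin \o h).
Proof.
move=> mQ Qoo hl; apply: (measurable_bounded_integrable mQ Qoo).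
  by apply: measurable_funTS; exact: bounded_lipschitz_measurable.
have [C [hC _]] := hl; exists C; split; first exact: num_real.
by move=> M CM x _ /=; exact: le_trans (hC x) (ltW CM).
Qed.

Lemma ball_average_L1_cvg B Q (e0 : R) g : measurable B -> measurable Q ->
  (leb Q < +oo)%E -> 0 < e0 -> (forall x, B x -> eball x e0 `<=` Q) ->
  leb.-integrable setT (EFin \o g) -> (forall x, ~ Q x -> g x = 0) ->
  forall d, 0 < d -> exists2 e1, 0 < e1 & forall e, 0 < e -> e < e1 ->
    (\int[leb]_(x in B) (`|ball_average e g x - g x|)%:E <= d%:E)%E.
Proof.
move=> mB mQ Qoo e00 BQ ig gQ d d0.
have mg : measurable_fun setT g by apply/measurable_EFinP; exact: measurable_int ig.
have igQ : leb.-integrable Q (EFin \o g).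
  exact: (integrableS measurableT mQ (@subsetT _ _) ig).
have [_ /(_ (d / 4))] := lipschitz_approximable_integrable mQ Qoo mg igQ.
rewrite divr_gt0// => /(_ isT)[h hl hd].
have [C [C0 hC hL]] := bounded_lipschitz_ge0 hl.
have ihQ := restrict_integrable mQ (lipschitz_integrable mQ Qoo hl).
have subBQ : B `<=` Q.
  by move=> x Bx; apply: (BQ _ Bx); rewrite /eball/= subrr enorm0.
have Bfin : leb B \is a fin_num.
  rewrite ge0_fin_numE//; apply: le_lt_trans Qoo.
  by apply: le_measure; rewrite ?inE.
have K0 : 0 < C * fine (leb B) + 1.
  by rewrite ltr_wpDl// mulr_ge0// fine_ge0.
(* Below [e0] the balls around points of [B] stay in [Q], where [h] is Lipschitz; the second bound
   makes C e |B| at most d/2. The other half is twice the distance d/4 from [g] to [h]. *)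
exists (Num.min e0 (d / 2 / (C * fine (leb B) + 1))).
  by rewrite lt_min e00/= !divr_gt0.
move=> e ep; rewrite lt_min => /andP[ee0 ed].
have := @integral_averageB_le _ _ R leb (fun x => eball x e) (vol n e)
  (measurable_eball_rel e) (@eball_sym e) (fun x => leb_eball x e) (vol_gt0 ep)
  g (h \_ Q) B (C * e) ig ihQ mB _ _.
have hCe x : B x -> `|ball_average e (h \_ Q) x - (h \_ Q) x| <= C * e.
  move=> Bx; apply: (average_near (measurable_eball_rel e) (fun x => leb_eball x e) (vol_gt0 ep)).
    exact: (integrableS measurableT (measurable_eball x e) (@subsetT _ _) ihQ).
  move=> y xy; have Qy : Q y.
    exact: (BQ _ Bx _ (lt_trans xy ee0)).
  rewrite !patchE !mem_set//; last exact: subBQ.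
  apply: le_trans (hL _ _) _; rewrite ler_wpM2l// ltW//.
move=> /(_ (mulr_ge0 C0 (ltW ep)) hCe); move=> H; apply: (le_trans H); clear H.
have -> : (\int[leb]_x (`|g x - (h \_ Q) x|)%:E =
    \int[leb]_(x in Q) (`|g x - h x|)%:E)%E.
  rewrite [RHS]integral_mkcond; apply: eq_integral => x _; rewrite !patchE.
  case: ifPn => // /negP nQx; rewrite gQ ?subrr ?normr0// => Qx.
  by apply: nQx; rewrite inE.
apply: (@le_trans _ _ (2%:E * (d / 4)%:E + (d / 2)%:E)%E); last first.
  by rewrite -EFinM -EFinD lee_fin; lra.
apply: leeD; first by rewrite lee_wpmul2l.
rewrite [X in (_ * X)%E](_ : _ = (fine (leb B))%:E); last by rewrite fineK.
rewrite -EFinM lee_fin.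
have := ed; rewrite ltr_pdivlMr// => /ltW; apply: le_trans.
by rewrite mulrDr mulr1 mulrCA mulrA lerDl ltW.
Qed.

End ball_averages.

(** * Local bounds for weighted power integrals *)

Section hoelder_bounds.
Context d (T : measurableType d) {R : realType}.
Variable mu : {measure set T -> \bar R}.
Implicit Types (V U : set T) (f g ge w : T -> R).

Lemma hoelder_set V f g (p p' a b : R) : measurable V ->
  measurable_fun V f -> measurable_fun V g ->
  (forall x, V x -> 0 <= f x) -> (forall x, V x -> 0 <= g x) ->
  0 < p -> 0 < p' -> p^-1 + p'^-1 = 1 -> 0 <= a -> 0 <= b ->
  (\int[mu]_(x in V) (f x `^ p)%:E <= a%:E)%E ->
  (\int[mu]_(x in V) (g x `^ p')%:E <= b%:E)%E ->
  (\int[mu]_(x in V) (f x * g x)%:E <= (a `^ p^-1 * b `^ p'^-1)%:E)%E.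
Proof.
move=> mV mf mg f0 g0 p0 p'0 pp' a0 b0 fa gb.
have norm_le (r c : R) h : 0 < r -> 0 <= c -> (forall x, V x -> 0 <= h x) ->
    (\int[mu]_(x in V) (h x `^ r)%:E <= c%:E)%E ->
    ('N[mu]_r%:E[EFin \o (h \_ V)] <= (c `^ r^-1)%:E)%E.
  move=> r0 c0 h0 hc; rewrite unlock -poweR_EFin.
  apply: gt0_ler_poweR; first by rewrite invr_ge0 ltW.
  - by rewrite in_itv/= leey andbT integral_ge0// => x _; exact: poweR_ge0.
  - by rewrite in_itv/= leey andbT lee_fin.
  apply: le_trans hc; rewrite [leRHS]integral_mkcond.
  apply: le_integral_nonneg => x _; first exact: poweR_ge0.
  rewrite /= !patchE; case: ifPn => Vx.
    by rewrite ger0_norm// h0//; move: Vx; rewrite inE.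
  by rewrite normr0 powR0// gt_eqF.
have := hoelder mu ((measurable_restrictT f mV).1 mf)
  ((measurable_restrictT g mV).1 mg) p0 p'0 pp'.
rewrite Lnorm1 EFinM => H.
apply: le_trans (le_trans H _).
  rewrite integral_mkcond; apply: le_integral_nonneg => x _.
    by apply: erestrict_ge0 => y Vy; rewrite lee_fin mulr_ge0 ?f0 ?g0.
  rewrite /= !patchE; case: ifPn => Vx /=; last by rewrite lee_fin.
  by rewrite lee_fin ler_norm.
by apply: lee_pmul; rewrite ?Lnorm_ge0//; exact: norm_le.
Qed.

(** Hoelder's inequality for the factorisation of |g| as w |g| times 1/w. *)
Lemma integral_le_dual_weight V g w (p p' W v J : R) : measurable V ->
  measurable_fun V g -> measurable_fun V w -> (forall x, V x -> 0 < w x) ->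
  0 < p -> 0 < p' -> p^-1 + p'^-1 = 1 -> 0 < W -> 0 < v -> 0 <= J ->
  (\int[mu]_(x in V) ((w x * `|g x|) `^ p)%:E <= J%:E)%E ->
  (\int[mu]_(x in V) ((w x)^-1 `^ p')%:E <= ((2 / W) `^ p' * v)%:E)%E ->
  (\int[mu]_(x in V) (`|g x|)%:E <= (J `^ p^-1 * (2 / W * v `^ p'^-1))%:E)%E.
Proof.
move=> mV mg mw w0 p0 p'0 pp' W0 v0 J0 HJ Hw.
have E x : V x -> `|g x| = (w x * `|g x|) * (w x)^-1.
  by move=> Vx; rewrite mulrAC divff ?mul1r// gt_eqF// w0.
have Wv : ((2 / W) `^ p' * v) `^ p'^-1 = 2 / W * v `^ p'^-1.
  rewrite powRM ?powR_ge0//; last exact: ltW.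
  by rewrite -powRrM divff ?powRr1 ?gt_eqF// divr_ge0// ltW.
rewrite -Wv.
have -> : (\int[mu]_(x in V) (`|g x|)%:E = \int[mu]_(x in V) ((w x * `|g x|) * (w x)^-1)%:E)%E.
  by apply: eq_integral => x /[!inE] Vx; rewrite -E.
apply: (@hoelder_set V (fun x => w x * `|g x|) (fun x => (w x)^-1)) => //.
- by apply: measurable_funM => //; exact: measurableT_comp.
- apply: (@eq_measurable_fun _ _ _ _ V (fun x => w x `^ (-1))).
    by move=> x /[!inE] Vx; rewrite powR_inv1// ltW// w0.
  exact: (measurableT_comp (measurable_powR (-1)) mw).
- by move=> x Vx; rewrite mulr_ge0// ltW// w0.
- by move=> x Vx; rewrite invr_ge0 ltW// w0.
- by rewrite mulr_ge0 ?powR_ge0// ltW.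
Qed.

(** The dual bound on 1/w estimates the mean of |g| on [V] by (2/W) J^(1/p) v^(-1/p), so [ge] is
    bounded on [U] by a constant [c]. The q-energy of [c] against w brings in 2 W: the size of the
    weight cancels and 4 D remains. The power v^(1 - q/p) is the scaling loss from L^p to L^q; it
    disappears for q = p. *)
Lemma weighted_power_bound U V g ge w (p p' q W v D J : R) :
  measurable U -> measurable V -> U `<=` V ->
  measurable_fun V g -> measurable_fun V w -> (forall x, V x -> 0 < w x) ->
  0 < p -> 0 < p' -> p^-1 + p'^-1 = 1 -> 0 < q ->
  0 < W -> 0 < v -> 0 < D -> 0 <= J ->
  (\int[mu]_(x in V) ((w x * `|g x|) `^ p)%:E <= J%:E)%E ->
  (\int[mu]_(x in V) ((w x)^-1 `^ p')%:E <= ((2 / W) `^ p' * v)%:E)%E ->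
  (\int[mu]_(x in V) (w x `^ q)%:E <= ((2 * W) `^ q * v)%:E)%E ->
  (forall x, U x -> ((`|ge x|)%:E <= (D / v)%:E * \int[mu]_(y in V) (`|g y|)%:E)%E) ->
  (\int[mu]_(x in U) ((w x * `|ge x|) `^ q)%:E <=
     ((4 * D) `^ q * (v `^ (1 - q / p) * J `^ (q / p)))%:E)%E.
Proof.
move=> mU mV UV mg mw w0 p0 p'0 pp' q0 W0 v0 D0 J0 HJ Hw Hwq Hge.
have HI := integral_le_dual_weight mV mg mw w0 p0 p'0 pp' W0 v0 J0 HJ Hw.
set c := D / v * (J `^ p^-1 * (2 / W * v `^ p'^-1)).
have c0 : 0 <= c.
  rewrite /c mulr_ge0//; first by rewrite divr_ge0// ltW.
  by rewrite mulr_ge0 ?powR_ge0// mulr_ge0 ?powR_ge0// divr_ge0// ltW.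
have gec x : U x -> `|ge x| <= c.
  move=> Ux; rewrite -lee_fin; apply: le_trans (Hge _ Ux) _.
  by rewrite /c [leRHS]EFinM; apply: lee_wpmul2l; rewrite ?lee_fin// divr_ge0// ltW.
have -> : (4 * D) `^ q * (v `^ (1 - q / p) * J `^ (q / p)) =
    c `^ q * ((2 * W) `^ q * v).
  have -> : v `^ (1 - q / p) * J `^ (q / p) =
      (v^-1 * (J `^ p^-1 * v `^ p'^-1)) `^ q * v.
    have -> : v^-1 * (J `^ p^-1 * v `^ p'^-1) = J `^ p^-1 * v `^ (p'^-1 - 1).
      rewrite powRD; last by apply/implyP => _; rewrite gt_eqF.
      by rewrite powR_inv1 ?ltW//; ring.
    have -> : v `^ (1 - q / p) = v `^ ((p'^-1 - 1) * q) * v.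
      rewrite -[X in _ = _ * X](powRr1 (ltW v0)) -powRD; last by apply/implyP => _; rewrite gt_eqF.
      congr (_ `^ _); have -> : p'^-1 = 1 - p^-1 by rewrite -pp' addrC addKr.
      ring.
    by rewrite powRM ?powR_ge0// -!powRrM (mulrC q); ring.
  rewrite mulrA -powRM; last 2 first.
  - by rewrite mulr_ge0// ltW.
  - by rewrite !mulr_ge0 ?powR_ge0 ?invr_ge0 ?ltW.
  rewrite mulrA -powRM//; last by rewrite mulr_ge0// ltW.
  congr (_ `^ _ * _); rewrite /c; field.
  by rewrite !gt_eqF.
apply: (@le_trans _ _ (\int[mu]_(x in V) ((c `^ q)%:E * (w x `^ q)%:E))%E); last first.
  rewrite ge0_integralZl//=.
  - by rewrite [leRHS]EFinM; apply: lee_wpmul2l; rewrite ?lee_fin ?powR_ge0.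
  - apply/measurable_EFinP.
    exact: (measurableT_comp (measurable_powR q) mw).
  - by move=> x _; rewrite lee_fin powR_ge0.
  - by rewrite lee_fin powR_ge0.
apply: le_trans (subset_integral_nonneg _ UV _).
  apply: le_integral_nonneg => x Ux; first by rewrite lee_fin powR_ge0.
  have wx := ltW (w0 _ (UV _ Ux)).
  rewrite -EFinM lee_fin powRM// mulrC ler_wpM2r ?powR_ge0//.
  by rewrite ge0_ler_powR ?nnegrE ?(ltW q0)// gec.
by move=> x _; rewrite mule_ge0// lee_fin powR_ge0.
Qed.

End hoelder_bounds.

(** * The modular and its bound on a single ball *)

Definition modular {T : Type} {R : realType} (p q : R) (a w g : T -> R) (x : T) : R :=
  (w x * `|g x|) `^ p + a x * (w x * `|g x|) `^ q.

Section local_modular.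
Context d (T : measurableType d) {R : realType}.
Variable mu : {measure set T -> \bar R}.
Implicit Types (V U : set T) (f g ge w a : T -> R).

Lemma measurable_weighted_power V g w (p : R) : measurable_fun V g -> measurable_fun V w ->
  measurable_fun V (fun x => (w x * `|g x|) `^ p).
Proof.
move=> mg mw; apply: (measurableT_comp (measurable_powR p)).
by apply: measurable_funM => //; exact: measurableT_comp.
Qed.

Lemma measurable_modular V (p q : R) a w g : measurable_fun V g -> measurable_fun V w ->
  measurable_fun V a -> measurable_fun V (modular p q a w g).
Proof.
move=> mg mw ma; apply: measurable_funD; first exact: measurable_weighted_power.
by apply: measurable_funM => //; exact: measurable_weighted_power.
Qed.

(** The coefficient lies between [a0] and a0 + h. The part [a0] is estimated with exponent q on both
    sides, without scaling loss. The part [h] is estimated by the p-energy [J]; its loss v^(1 - q/p)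
    is absorbed in [C1], and the excess power J^(q/p - 1) is bounded through [K], which restores a
    bound linear in the modular. *)
Lemma local_modular_bound U V g ge w a (p p' q q' W v D J L a0 h K C1 : R) :
  measurable U -> measurable V -> U `<=` V ->
  measurable_fun V g -> measurable_fun V ge -> measurable_fun V w ->
  measurable_fun V a ->
  (forall x, V x -> 0 < w x) ->
  0 < p -> 0 < p' -> p^-1 + p'^-1 = 1 ->
  0 < q -> 0 < q' -> q^-1 + q'^-1 = 1 -> p <= q ->
  0 < W -> 0 < v -> 0 < D -> 0 <= J -> 0 <= L -> 0 <= a0 -> 0 <= h ->
  (forall x, V x -> a0 <= a x <= a0 + h) ->
  h * v `^ (1 - q / p) <= C1 -> J <= K ->
  (\int[mu]_(x in V) ((w x * `|g x|) `^ p)%:E = J%:E)%E ->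
  (\int[mu]_(x in V) (a x * (w x * `|g x|) `^ q)%:E = L%:E)%E ->
  (\int[mu]_(x in V) ((w x)^-1 `^ p')%:E <= ((2 / W) `^ p' * v)%:E)%E ->
  (\int[mu]_(x in V) ((w x)^-1 `^ q')%:E <= ((2 / W) `^ q' * v)%:E)%E ->
  (\int[mu]_(x in V) (w x `^ p)%:E <= ((2 * W) `^ p * v)%:E)%E ->
  (\int[mu]_(x in V) (w x `^ q)%:E <= ((2 * W) `^ q * v)%:E)%E ->
  (forall x, U x -> ((`|ge x|)%:E <= (D / v)%:E * \int[mu]_(y in V) (`|g y|)%:E)%E) ->
  (\int[mu]_(x in U) (modular p q a w ge x)%:E <=
     ((4 * D) `^ p + (4 * D) `^ q * (1 + C1 * K `^ (q / p - 1)))%:E *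
     \int[mu]_(x in V) (modular p q a w g x)%:E)%E.
Proof.
move=> mU mV UV mg mge mw ma w0 p0 p'0 pp' q0 q'0 qq' pq W0 v0 D0 J0 L0 a00 h0.
move=> ah hC1 JK HJ HL Hwp' Hwq' Hwp Hwq Hge.
have ax0 x : V x -> 0 <= a x by move=> Vx; have /andP[+ _] := ah _ Vx; exact: le_trans.
have D40 r : 0 <= (4 * D) `^ r by rewrite powR_ge0.
have C10 : 0 <= C1 by apply: le_trans hC1; rewrite mulr_ge0// powR_ge0.
have mwg := measurable_weighted_power p mg mw.
have mwgq := measurable_weighted_power q mg mw.
have mwge := measurable_weighted_power p mge mw.
have mwgeq := measurable_weighted_power q mge mw.
have integral_modular (S : set T) k : measurable S -> S `<=` V -> measurable_fun V k ->
    (\int[mu]_(x in S) (modular p q a w k x)%:E =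
     \int[mu]_(x in S) ((w x * `|k x|) `^ p)%:E +
     \int[mu]_(x in S) (a x * (w x * `|k x|) `^ q)%:E)%E.
  move=> mS SV mk; rewrite -ge0_integralD//.
  - by move=> x _; rewrite lee_fin powR_ge0.
  - apply/measurable_EFinP/(measurable_funS mV SV).
    exact: measurable_weighted_power.
  - by move=> x Sx; rewrite lee_fin mulr_ge0 ?powR_ge0 ?ax0//; exact: SV.
  - apply/measurable_EFinP/(measurable_funS mV SV); apply: measurable_funM => //.
    exact: measurable_weighted_power.
rewrite (integral_modular U)//.
rewrite (integral_modular V)// HJ HL -EFinD -EFinM.
have HJ' : (\int[mu]_(x in V) ((w x * `|g x|) `^ p)%:E <= J%:E)%E by rewrite HJ.
have Hp : (\int[mu]_(x in U) ((w x * `|ge x|) `^ p)%:E <= ((4 * D) `^ p * J)%:E)%E.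
  have := weighted_power_bound mU mV UV mg mw w0 p0 p'0 pp' p0 W0 v0 D0 J0 HJ' Hwp' Hwp Hge.
  by rewrite divff ?gt_eqF// subrr powRr0 powRr1// mul1r.
set X := (\int[mu]_(x in U) ((w x * `|ge x|) `^ q)%:E)%E.
have X0 : (0 <= X)%E by apply: integral_ge0 => x _; rewrite lee_fin powR_ge0.
have hX : (h%:E * X <= ((4 * D) `^ q * (C1 * K `^ (q / p - 1) * J))%:E)%E.
  have Xle := weighted_power_bound mU mV UV mg mw w0 p0 p'0 pp' q0 W0 v0 D0 J0 HJ' Hwp' Hwq Hge.
  apply: le_trans (lee_wpmul2l _ Xle) _; rewrite -?EFinM lee_fin//.
  rewrite mulrCA ler_wpM2l// [leLHS]mulrA -[leRHS]mulrA.
  have -> : J `^ (q / p) = J `^ (q / p - 1) * J.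
    have [->|JN0] := eqVneq J 0.
      by rewrite mulr0 powR0// mulf_neq0 ?invr_neq0// gt_eqF.
    rewrite -[X in _ = _ * X](powRr1 J0) -powRD ?subrK//.
    by apply/implyP.
  apply: ler_pM => //; rewrite ?mulr_ge0 ?powR_ge0//.
  rewrite ler_wpM2r//; apply: ge0_ler_powR; rewrite ?nnegrE//; last exact: le_trans JK.
  by rewrite subr_ge0 ler_pdivlMr// mul1r.
have aX : (a0%:E * X <= ((4 * D) `^ q * L)%:E)%E.
  move: a00; rewrite le_eqVlt => /predU1P[<-|a0p].
    by rewrite mul0e lee_fin mulr_ge0.
  (* Where [a0] is positive, dividing by it recovers the q-energy without coefficient. *)
  have Jq : (\int[mu]_(x in V) ((w x * `|g x|) `^ q)%:E <= (L / a0)%:E)%E.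
    rewrite mulrC EFinM -HL lee_pdivlMl// -ge0_integralZl//=.
    - apply: le_integral_nonneg => x Vx; first by rewrite mule_ge0 ?lee_fin ?powR_ge0 ?ltW.
      by rewrite -EFinM lee_fin ler_wpM2r ?powR_ge0//; have /andP[] := ah _ Vx.
    - exact/measurable_EFinP.
    - by move=> x _; rewrite lee_fin powR_ge0.
    - by rewrite lee_fin ltW.
  have La0 : 0 <= L / a0 by rewrite divr_ge0// ltW.
  have := weighted_power_bound mU mV UV mg mw w0 q0 q'0 qq' q0 W0 v0 D0 La0 Jq Hwq' Hwq Hge.
  rewrite divff ?gt_eqF// subrr powRr0 powRr1// mul1r => XL.
  apply: le_trans (lee_wpmul2l _ XL) _; rewrite -?EFinM lee_fin ?(ltW a0p)//.
  by rewrite mulrCA [a0 * _]mulrC divfK// gt_eqF.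
have Hq : (\int[mu]_(x in U) (a x * (w x * `|ge x|) `^ q)%:E <=
    ((4 * D) `^ q * L + (4 * D) `^ q * (C1 * K `^ (q / p - 1) * J))%:E)%E.
  rewrite EFinD; apply: le_trans (leeD aX hX).
  rewrite -ge0_muleDl ?lee_fin// -EFinD /X -ge0_integralZl//=.
  - apply: le_integral_nonneg => x Ux.
      by rewrite lee_fin mulr_ge0 ?powR_ge0 ?ax0//; exact: UV.
    rewrite -EFinM lee_fin ler_wpM2r ?powR_ge0//.
    by have /andP[] := ah _ (UV _ Ux).
  - exact/measurable_EFinP/(measurable_funS mV UV).
  - by move=> x _; rewrite lee_fin powR_ge0.
  - by rewrite lee_fin addr_ge0.
apply: le_trans (leeD Hp Hq) _; rewrite -EFinD lee_fin.
have := D40 p; have := D40 q.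
move: ((4 * D) `^ p) ((4 * D) `^ q) => Dp Dq Dq0 Dp0.
have : 0 <= C1 * K `^ (q / p - 1) by rewrite mulr_ge0// powR_ge0.
move: (C1 * _) => S S0.
rewrite -subr_ge0.
have -> : (Dp + Dq * (1 + S)) * (J + L) - (Dp * J + (Dq * L + Dq * (S * J))) =
   Dp * L + Dq * J + Dq * S * L by ring.
by rewrite !addr_ge0// !mulr_ge0.
Qed.

End local_modular.

(** * Truncation and smallness of the modular *)

Section modular_estimates.
Context d (T : measurableType d) {R : realType}.
Variable mu : {measure set T -> \bar R}.
Implicit Types (B : set T) (f g h u w a : T -> R).

(** Dominated convergence: [f] is real valued, so at each point the indicator of f > N vanishes
    eventually. *)
Lemma integral_tail B h f : measurable B -> measurable_fun B h -> measurable_fun B f ->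
  (forall x, B x -> 0 <= h x) -> (\int[mu]_(x in B) (h x)%:E < +oo)%E ->
  forall e, 0 < e -> exists N : nat,
    (\int[mu]_(x in B) (h x * (N%:R < f x)%R%:R)%:E <= e%:E)%E.
Proof.
move=> mB mh mf h0 hoo e e0.
have mi (N : nat) : measurable_fun B (fun x => (N%:R < f x)%R%:R : R).
  apply: (measurableT_comp (f := fun b : bool => b%:R : R)) => //.
  exact: measurable_fun_ltr.
have ih : mu.-integrable B (EFin \o h).
  apply/integrableP; split; first exact/measurable_EFinP.
  under eq_integral => x /[!inE] Bx do rewrite /= ger0_norm ?h0//.
  exact: hoo.
have [] := @dominated_convergence _ _ _ mu B mB
    (fun N x => (h x * (N%:R < f x)%R%:R)%:E) (cst 0%E) (EFin \o h).
- by move=> N; apply/measurable_EFinP; exact: measurable_funM.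
- exact: measurable_cst.
- apply: aeW => x Bx; apply: cvg_EFin; first exact: nearW.
  apply: cvg_near_cst; near=> N.
  rewrite /= [_ < _](_ : _ = false) ?mulr0//; apply/negbTE; rewrite -leNgt.
  by near: N; exact: nbhs_infty_ger.
- exact: ih.
- apply: aeW => x N Bx; rewrite /= lee_fin normrM ger0_norm ?h0// normr_nat.
  by case: (_ < _); rewrite ?mulr1// mulr0 h0.
move=> _ /fine_cvgP[fin /cvgr0Pnorm_lt /(_ e e0) lt] _.
have [N [Nfin Nlt]] : exists N : nat,
    (\int[mu]_(x in B) `|(h x * (N%:R < f x)%R%:R)%:E - cst 0%E x| \is a fin_num)%E /\
    `|fine (\int[mu]_(x in B) `|(h x * (N%:R < f x)%R%:R)%:E - cst 0%E x|)%E| < e.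
  by near \oo => N; exists N; split; near: N.
exists N; have E : (\int[mu]_(x in B) `|(h x * (N%:R < f x)%R%:R)%:E - cst 0%E x| =
   \int[mu]_(x in B) (h x * (N%:R < f x)%R%:R)%:E)%E.
  apply: eq_integral => x /[!inE] Bx; rewrite sube0 gee0_abs//.
  by rewrite lee_fin mulr_ge0 ?h0.
rewrite -E -[leLHS](fineK Nfin) lee_fin; apply: le_trans (ler_norm _) _.
exact: ltW.
Unshelve. all: by end_near. Qed.

Lemma powR_add3 (r x y z : R) : 0 <= r -> 0 <= x -> 0 <= y -> 0 <= z ->
  (x + y + z) `^ r <= 3 `^ r * (x `^ r + y `^ r + z `^ r).
Proof.
move=> r0 x0 y0 z0.
pose m := Num.max x (Num.max y z).
have xm : x <= m by rewrite le_max lexx.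
have ym : y <= m by rewrite !le_max lexx orbT.
have zm : z <= m by rewrite !le_max lexx !orbT.
have m0 : 0 <= m by exact: le_trans xm.
apply: (@le_trans _ _ ((3 * m) `^ r)).
  apply: ge0_ler_powR; rewrite ?nnegrE ?addr_ge0 ?mulr_ge0//.
  lra.
rewrite powRM// ler_wpM2l ?powR_ge0//.
have px := powR_ge0 x r; have py := powR_ge0 y r; have pz := powR_ge0 z r.
by rewrite /m /Num.max; case: ifP => _; [case: ifP => _|]; lra.
Qed.

Section fixed_weights.
Variables (p q : R) (a w : T -> R).
Hypotheses (p1 : 1 <= p) (pq : p <= q).
Local Notation md := (modular p q a w).

Lemma modular_add3 f g h x : 0 <= w x -> 0 <= a x ->
  md (fun x => f x + g x + h x) x <= 3 `^ q * (md f x + md g x + md h x).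
Proof.
move=> w0 a0; rewrite /modular.
have p0 : 0 <= p := le_trans ler01 p1.
have q0 : 0 <= q := le_trans p0 pq.
have H r : 0 <= r -> r <= q -> (w x * `|f x + g x + h x|) `^ r <=
    3 `^ q * ((w x * `|f x|) `^ r + (w x * `|g x|) `^ r + (w x * `|h x|) `^ r).
  move=> r0 rq; apply: (@le_trans _ _ ((w x * `|f x| + w x * `|g x| + w x * `|h x|) `^ r)).
    apply: ge0_ler_powR; rewrite ?nnegrE ?addr_ge0 ?mulr_ge0//.
    rewrite -!mulrDr ler_wpM2l//.
    by apply: le_trans (ler_normD _ _) _; rewrite lerD2r ler_normD.
  apply: le_trans (powR_add3 _ _ _ _) _; rewrite ?mulr_ge0//.
  by rewrite ler_wpM2r ?addr_ge0 ?powR_ge0// ler_powR// ler1n.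
have := H p p0 pq; have := ler_wpM2l a0 (H q q0 (lexx _)).
move: (w x * `|f x|) (w x * `|g x|) (w x * `|h x|) (3 `^ q) => F G K S h1 h2.
apply: le_trans (lerD h2 h1) _.
by rewrite le_eqVlt; apply/orP; left; apply/eqP; ring.
Qed.

Lemma modular_truncate g (N : nat) x :
  md (fun x => g x * (N%:R < `|g x|)%R%:R) x = md g x * (N%:R < `|g x|)%R%:R.
Proof.
rewrite /modular; case: (_ < _); rewrite ?mulr1//= !mulr0 normr0 mulr0.
have p0 : 0 < p := lt_le_trans ltr01 p1.
have q0 : 0 < q := lt_le_trans p0 pq.
by rewrite !powR0 ?mulr0 ?addr0// gt_eqF.
Qed.

(** Where the density w^p + a w^q exceeds [k], the bound [M] on |u| leaves a tail of the density.
    Elsewhere |u|^r <= M^(r - 1) |u| leaves a multiple of |u|, with a constant depending on [k]. *)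
Lemma modular_bounded_le (M k : R) u x : 0 <= w x -> 0 <= a x -> 0 <= k ->
  `|u x| <= M ->
  md u x <= (M `^ p + M `^ q) *
      ((w x `^ p + a x * w x `^ q) * (k < w x `^ p + a x * w x `^ q)%R%:R) +
    k * (M `^ (p - 1) + M `^ (q - 1)) * `|u x|.
Proof.
move=> w0 a0 k0 uM; have M0 : 0 <= M by exact: le_trans uM.
have P r : 0 <= r -> `|u x| `^ r <= M `^ r.
  by move=> r0; apply: ge0_ler_powR; rewrite ?nnegrE.
have P1 r : 1 <= r -> `|u x| `^ r <= M `^ (r - 1) * `|u x|.
  move=> r1; rewrite -(mulr_powRB1 (normr_ge0 (u x)) (lt_le_trans ltr01 r1)).
  by rewrite mulrC ler_wpM2r//; apply: P; rewrite subr_ge0.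
have p0 : 0 <= p := le_trans ler01 p1.
have q1 : 1 <= q := le_trans p1 pq.
have q0 : 0 <= q := le_trans p0 pq.
rewrite /modular !powRM//.
have wp := powR_ge0 (w x) p; have wq := powR_ge0 (w x) q.
have aq : 0 <= a x * w x `^ q by rewrite mulr_ge0.
rewrite mulrA.
set A := w x `^ p in wp *; set C := a x * w x `^ q in aq *.
have [kAC|ACk] := ltP k (A + C).
  rewrite mulr1; apply: ler_wpDr.
    by rewrite !mulr_ge0// addr_ge0 ?powR_ge0.
  have h1 := ler_wpM2l wp (P p p0); have h2 := ler_wpM2l aq (P q q0).
  apply: le_trans (lerD h1 h2) _.
  have := mulr_ge0 wp (powR_ge0 M q); have := mulr_ge0 aq (powR_ge0 M p).
  lra.
rewrite mulr0 mulr0 add0r.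
have Ak : A <= k by lra.
have Ck : C <= k by lra.
rewrite -mulrA mulrDl mulrDr; apply: lerD.
  apply: le_trans (ler_wpM2r (powR_ge0 _ _) Ak) _.
  by rewrite ler_wpM2l// P1.
apply: le_trans (ler_wpM2r (powR_ge0 _ _) Ck) _.
by rewrite ler_wpM2l// P1.
Qed.

(** Upgrades L^1 smallness to smallness of the modular for functions with a common bound. The level
    [N] makes the tail of the weight density small, and only then is [d] chosen against the constant
    produced by [N]. *)
Lemma modular_small B (M : R) : measurable B -> measurable_fun B w -> measurable_fun B a ->
  (forall x, B x -> 0 <= w x) -> (forall x, B x -> 0 <= a x) -> 0 <= M ->
  (\int[mu]_(x in B) (w x `^ p + a x * w x `^ q)%:E < +oo)%E ->
  forall e, 0 < e -> exists2 d, 0 < d & forall u, measurable_fun B u ->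
    (forall x, B x -> `|u x| <= M) ->
    (\int[mu]_(x in B) (`|u x|)%:E <= d%:E)%E ->
    (\int[mu]_(x in B) (md u x)%:E <= e%:E)%E.
Proof.
move=> mB mw ma w0 a0 M0 Woo e e0.
have mW : measurable_fun B (fun x => w x `^ p + a x * w x `^ q).
  apply: measurable_funD; first exact: (measurableT_comp (measurable_powR p)).
  by apply: measurable_funM => //; exact: (measurableT_comp (measurable_powR q)).
have W0 x : B x -> 0 <= w x `^ p + a x * w x `^ q.
  by move=> Bx; rewrite addr_ge0 ?mulr_ge0 ?powR_ge0 ?a0.
pose c1 := M `^ p + M `^ q; pose c2 := M `^ (p - 1) + M `^ (q - 1).
have c10 : 0 <= c1 by rewrite addr_ge0 ?powR_ge0.
have c20 : 0 <= c2 by rewrite addr_ge0 ?powR_ge0.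
have e1 : 0 < e / 2 / (c1 + 1) by rewrite !divr_gt0// ltr_wpDl.
have [N HN] := integral_tail mB mW mW W0 Woo e1.
have e2 : 0 < e / 2 / (N%:R * c2 + 1) by rewrite !divr_gt0// ltr_wpDl// mulr_ge0.
exists (e / 2 / (N%:R * c2 + 1)) => // u mu' uM uint.
have mtail : measurable_fun B (fun x => ((w x `^ p + a x * w x `^ q) *
    (N%:R < w x `^ p + a x * w x `^ q)%R%:R)%:E).
  apply/measurable_EFinP; apply: measurable_funM => //.
  apply: (measurableT_comp (f := fun b : bool => b%:R : R)) => //.
  exact: measurable_fun_ltr.
have mabs : measurable_fun B (fun x => (`|u x|)%:E).
  by apply/measurable_EFinP; exact: measurableT_comp.
apply: (@le_trans _ _ (c1%:E * (e / 2 / (c1 + 1))%:E +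
   (N%:R * c2)%:E * (e / 2 / (N%:R * c2 + 1))%:E)%E); last first.
  have key (c : R) : 0 <= c -> c * (e / 2 / (c + 1)) <= e / 2.
    move=> c0; rewrite mulrA ler_pdivrMr ?ltr_wpDl//.
    by rewrite mulrDr mulr1 mulrC lerDl divr_ge0// ltW.
  rewrite -!EFinM -EFinD lee_fin [leRHS](splitr e); apply: lerD; apply: key => //.
  by rewrite mulr_ge0.
apply: (@le_trans _ _ (c1%:E * \int[mu]_(x in B) ((w x `^ p + a x * w x `^ q) *
    (N%:R < w x `^ p + a x * w x `^ q)%R%:R)%:E +
   (N%:R * c2)%:E * \int[mu]_(x in B) (`|u x|)%:E)%E); last first.
  by apply: leeD; apply: lee_wpmul2l; rewrite ?lee_fin// mulr_ge0.
rewrite -!ge0_integralZl ?lee_fin ?mulr_ge0//; last first.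
  by move=> x Bx; rewrite lee_fin mulr_ge0// W0.
rewrite -ge0_integralD//.
- apply: le_integral_nonneg => x Bx.
    by rewrite lee_fin addr_ge0 ?mulr_ge0 ?powR_ge0 ?a0.
  by rewrite -!EFinM -EFinD lee_fin; apply: modular_bounded_le => //; [exact: w0|exact: a0|exact: uM].
- by move=> x Bx; rewrite mule_ge0 ?lee_fin ?mulr_ge0 ?W0.
- exact: measurable_funeM.
- by move=> x Bx; rewrite mule_ge0 ?lee_fin ?mulr_ge0.
- exact: measurable_funeM.
Qed.

End fixed_weights.
End modular_estimates.

Section power_lemmas.
Context {R : realType}.

Lemma le0_ler_powR (r x y : R) : r <= 0 -> 0 < x -> x <= y -> y `^ r <= x `^ r.
Proof.
move=> r0 x0 xy; have y0 : 0 < y by exact: lt_le_trans xy.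
rewrite -[r]opprK !(powRN _ (- r)) lef_pV2 ?posrE ?powR_gt0//.
by apply: ge0_ler_powR; rewrite ?nnegrE ?oppr_ge0// ltW.
Qed.

Lemma powR_le1 (r x : R) : 0 < x <= 1 -> 0 <= r -> x `^ r <= 1.
Proof.
by move=> /andP[x0 x1] r0; rewrite -(powRr0 x); apply: ger_powR => //; rewrite x0.
Qed.

End power_lemmas.

(** * The modular of ball averages *)

Section ball_modular.
Context {R : realType} {n : nat}.
Local Notation cV := 'cV[R]_n.
Local Notation leb := (@lebesgue_cV R n).
Implicit Types (x y z : cV) (e r : R) (g h a w : cV -> R) (B Q : set cV).

(* By Hoelder's inequality the factors W and W^-1 cancel, and these bounds act
   as Muckenhoupt conditions, also between the exponents p and q. *)
Definition dual_ball_bounds (w : cV -> R) (p p' q q' : R) (x : cV) (r : R) :=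
  exists W : R, [/\ 0 < W,
    (\int[leb]_(y in eball x r) (w y `^ p)%:E <= ((2 * W) `^ p * vol n r)%:E)%E,
    (\int[leb]_(y in eball x r) (w y `^ q)%:E <= ((2 * W) `^ q * vol n r)%:E)%E,
    (\int[leb]_(y in eball x r) ((w y)^-1 `^ p')%:E <= ((2 / W) `^ p' * vol n r)%:E)%E &
    (\int[leb]_(y in eball x r) ((w y)^-1 `^ q')%:E <= ((2 / W) `^ q' * vol n r)%:E)%E].

(* The Hoelder oscillation e^al of the coefficient compensates the loss
   |ball|^(1 - q/p) of the embedding from L^p to L^q: here q/p <= 1 + al/n enters. *)
Lemma vol_power_bound (p q al Ca : R) : (0 < n)%N -> 0 < p -> p <= q -> 0 <= Ca ->
  q / p <= 1 + al / n%:R ->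
  exists2 C1, 0 <= C1 & forall e, 0 < e -> e <= 1 ->
    2 * (Ca * (2 * e) `^ al) * vol n (2 * e) `^ (1 - q / p) <= C1.
Proof.
move=> n0 p0 pq Ca0 hqp.
have n0R : 0 < n%:R :> R by rewrite ltr0n.
set t := 1 - q / p.
have t0 : t <= 0 by rewrite subr_le0 ler_pdivlMr// mul1r.
(* With this [c], [vol_ge] at radius 2 e reads (c e)^n. *)
pose c : R := 4 / n.+1%:R.
have c0 : 0 < c by rewrite divr_gt0.
exists (2 * (Ca * 2 `^ al) * (c ^+ n) `^ t).
  by rewrite !mulr_ge0 ?powR_ge0.
move=> e e0 e1.
have volge : (c * e) ^+ n <= vol n (2 * e).
  have := @vol_ge R n (2 * e) _; rewrite mulr_gt0// => /(_ isT); apply: le_trans.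
  by rewrite le_eqVlt; apply/orP; left; apply/eqP; congr (_ ^+ n); rewrite /c; ring.
apply: (@le_trans _ _ (2 * (Ca * (2 * e) `^ al) * ((c * e) ^+ n) `^ t)).
  rewrite ler_wpM2l ?mulr_ge0 ?powR_ge0//.
  by apply: le0_ler_powR => //; rewrite exprn_gt0// mulr_gt0.
have cn0 : 0 <= c ^+ n by rewrite exprn_ge0// ltW.
have en0 : 0 <= e ^+ n by rewrite exprn_ge0// ltW.
rewrite exprMn (powRM _ cn0 en0) powRM ?(ltW e0)//.
have -> : 2 * (Ca * (2 `^ al * e `^ al)) * ((c ^+ n) `^ t * (e ^+ n) `^ t) =
    2 * (Ca * 2 `^ al) * (c ^+ n) `^ t * (e `^ al * (e ^+ n) `^ t) by ring.
rewrite -[leRHS]mulr1 ler_wpM2l ?mulr_ge0 ?powR_ge0//.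
rewrite -powR_mulrn ?(ltW e0)// -powRrM -powRD; last first.
  by apply/implyP => _; rewrite gt_eqF.
(* The total exponent of e is al + n (1 - q/p), and its nonnegativity is exactly the hypothesis on
   q/p. *)
apply: powR_le1; first by rewrite e0.
have : n%:R * (q / p) <= n%:R * (1 + al / n%:R) by rewrite ler_wpM2l// ltW.
have -> : n%:R * (1 + al / n%:R) = n%:R + al by field; rewrite gt_eqF.
by move=> H; rewrite /t mulrBr mulr1 addrA subr_ge0 addrC.
Qed.

Variables (B Bt : set cV) (e0 : R) (w a : cV -> R) (p p' q q' al Ca : R).
Hypothesis n0 : (0 < n)%N.
Hypotheses (mB : measurable B) (mBt : measurable Bt).
Hypothesis e00 : 0 < e0.
Hypothesis BBt : forall x, B x -> eball x e0 `<=` Bt.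
Hypothesis mw : measurable_fun setT w.
Hypothesis w0 : forall x, 0 < w x.
Hypothesis ma : measurable_fun setT a.
Hypothesis a0 : forall x, 0 <= a x.
Hypotheses (p0 : 0 < p) (p'0 : 0 < p') (pp' : p^-1 + p'^-1 = 1).
Hypotheses (q0 : 0 < q) (q'0 : 0 < q') (qq' : q^-1 + q'^-1 = 1).
Hypotheses (pq : p <= q) (Ca0 : 0 <= Ca) (al0 : 0 < al).
Hypothesis hqp : q / p <= 1 + al / n%:R.
Hypothesis a_holder : forall x y, Bt x -> Bt y -> `|a x - a y| <= Ca * enorm (x - y) `^ al.
Hypothesis wA : forall x r, 0 < r -> eball x r `<=` Bt -> dual_ball_bounds w p p' q q' x r.

Local Notation md := (modular p q a w).
Let D : R := (2 * n.+1%:R) ^+ n.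

Lemma modular_ge0 g x : 0 <= md g x.
Proof. by rewrite /modular addr_ge0 ?mulr_ge0 ?powR_ge0. Qed.

Lemma local_ball_modular_bound (C1 K e : R) z g :
  0 < e -> 2 * (Ca * (2 * e) `^ al) * vol n (2 * e) `^ (1 - q / p) <= C1 ->
  eball z (2 * e) `<=` Bt ->
  leb.-integrable setT (EFin \o g) ->
  (\int[leb]_(x in Bt) (md g x)%:E < +oo)%E ->
  (\int[leb]_(x in Bt) ((w x * `|g x|) `^ p)%:E <= K%:E)%E ->
  (\int[leb]_(x in eball z e) (md (ball_average e g) x)%:E <=
    ((4 * D) `^ p + (4 * D) `^ q * (1 + C1 * K `^ (q / p - 1)))%:E *
    \int[leb]_(x in eball z (2 * e)) (md g x)%:E)%E.
Proof.
move=> e_gt0 hC1 VBt ig goo gK.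
have e20 : 0 < 2 * e by rewrite mulr_gt0.
have UV : eball z e `<=` eball z (2 * e).
  by move=> y /= zy; apply: lt_trans zy _; rewrite ltr_pMl// ltr1n.
have zV : eball z (2 * e) z by rewrite /eball/= subrr enorm0.
have D0 : 0 < D by rewrite exprn_gt0// mulr_gt0.
pose eta := Ca * (2 * e) `^ al.
have eta0 : 0 <= eta by rewrite mulr_ge0// powR_ge0.
have mg : measurable_fun setT g by apply/measurable_EFinP; exact: measurable_int ig.
have mU := @measurable_eball R n z e.
have mV := @measurable_eball R n z (2 * e).
have mge := measurable_average (measurable_eball_rel e) (@eball_sym _ _ e)
  (fun x => leb_eball x e) (vol_gt0 e_gt0) ig.
have [W [W0 Wp Wq Wp' Wq']] := wA e20 VBt.
pose Jp := (\int[leb]_(x in eball z (2 * e)) ((w x * `|g x|) `^ p)%:E)%E.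
pose Lq := (\int[leb]_(x in eball z (2 * e)) (a x * (w x * `|g x|) `^ q)%:E)%E.
have Jp0 : (0 <= Jp)%E by apply: integral_ge0 => x _; rewrite lee_fin powR_ge0.
have Lq0 : (0 <= Lq)%E by apply: integral_ge0 => x _; rewrite lee_fin mulr_ge0 ?powR_ge0.
have JpK : (Jp <= K%:E)%E.
  apply: le_trans gK; apply: subset_integral_nonneg => // x _.
  by rewrite lee_fin powR_ge0.
have Jpfin : Jp \is a fin_num.
  by rewrite ge0_fin_numE//; exact: le_lt_trans JpK (ltry _).
have Lqfin : Lq \is a fin_num.
  rewrite ge0_fin_numE//; apply: le_lt_trans goo.
  apply: (@le_trans _ _ (\int[leb]_(x in eball z (2 * e)) (md g x)%:E)%E).
    apply: le_integral_nonneg => x _; first by rewrite lee_fin mulr_ge0 ?powR_ge0.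
    by rewrite lee_fin /modular lerDr powR_ge0.
  by apply: subset_integral_nonneg => // x _; rewrite lee_fin modular_ge0.
(* On the ball [a] differs from its value at the centre by at most [eta], and it is nonnegative.
   Hence it lies between the maximum of 0 and a z - eta, taken as frozen value, and that value plus
   2 eta. *)
apply: (@local_modular_bound _ _ _ leb (eball z e) (eball z (2 * e)) g
  (ball_average e g) w a p p' q q' W (vol n (2 * e)) D (fine Jp) (fine Lq)
  (Num.max 0 (a z - eta)) (2 * eta) K C1 mU mV UV
  (measurable_funTS mg) (measurable_funTS mge) (measurable_funTS mw)
  (measurable_funTS ma) (fun x _ => w0 x) p0 p'0 pp' q0 q'0 qq' pq W0 (vol_gt0 e20) D0
  _ _ _ _ _ hC1 _ _ _ Wp' Wq' Wp Wq) => //.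
- by rewrite fine_ge0.
- by rewrite fine_ge0.
- by rewrite le_max lexx.
- by rewrite mulr_ge0.
- move=> x Vx.
  have : `|a x - a z| <= eta.
    apply: le_trans (a_holder (VBt _ Vx) (VBt _ zV)) _.
    rewrite ler_wpM2l//; apply: ge0_ler_powR; rewrite ?nnegrE ?enorm_ge0 ?(ltW al0) ?(ltW e20)//.
    exact: ltW Vx.
  rewrite ler_distl => /andP[h1 h2].
  rewrite ge_max a0 h1/=.
  have : a z - eta <= Num.max 0 (a z - eta) by rewrite le_max lexx orbT.
  by lra.
- by rewrite -lee_fin fineK.
- by rewrite fineK.
- by rewrite fineK.
move=> x Ux.
have := @le_average _ _ _ leb (fun x => eball x e) (vol n e)
  (measurable_eball_rel e) (vol_gt0 e_gt0) g ig x.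
move=> H; apply: le_trans H _.
apply: (@le_trans _ _ (((vol n e)^-1)%:E * \int[leb]_(y in eball z (2 * e)) (`|g y|)%:E)%E).
  apply: lee_wpmul2l; first by rewrite lee_fin invr_ge0 ltW// vol_gt0.
  apply: subset_integral_nonneg => [y xy|y _]; last by rewrite lee_fin.
  rewrite /eball/=; apply: le_lt_trans (enorm_dist _ x _) _.
  by rewrite mulrDl mul1r ltrD.
apply: lee_wpmul2r; first by apply: integral_ge0 => y _; rewrite lee_fin.
rewrite lee_fin ler_pdivlMr ?vol_gt0// mulrC ler_pdivrMr ?vol_gt0//.
exact: vol_double.
Qed.

Lemma measurable_md g : measurable_fun setT g -> measurable_fun setT (md g).
Proof. by move=> mg; exact: measurable_modular. Qed.

(** The local bounds are integrated over all centres, the ratio of the two volumes contributing the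
    doubling constant [D]. The resulting [C] depends on [g] only through the bound [K] of its
    p-energy. *)
Lemma ball_modular_bound (K : R) : 0 <= K -> exists2 C, 0 <= C &
  forall e g, 0 < e -> e <= 1 -> 3 * e <= e0 ->
  leb.-integrable setT (EFin \o g) ->
  (\int[leb]_(x in Bt) (md g x)%:E < +oo)%E ->
  (\int[leb]_(x in Bt) ((w x * `|g x|) `^ p)%:E <= K%:E)%E ->
  (\int[leb]_(x in B) (md (ball_average e g) x)%:E <=
    C%:E * \int[leb]_(x in Bt) (md g x)%:E)%E.
Proof.
move=> K0; have [C1 C10 HC1] := vol_power_bound n0 p0 pq Ca0 hqp.
pose c := (4 * D) `^ p + (4 * D) `^ q * (1 + C1 * K `^ (q / p - 1)).
have c0 : 0 <= c by rewrite addr_ge0 ?mulr_ge0 ?addr_ge0 ?mulr_ge0 ?powR_ge0.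
have D0 : 0 < D by rewrite exprn_gt0// mulr_gt0.
exists (D * c) => [|e g e_gt0 e1 e3 ig goo gK]; first by rewrite mulr_ge0// ltW.
have e20 : 0 < 2 * e by rewrite mulr_gt0.
have mg : measurable_fun setT g by apply/measurable_EFinP; exact: measurable_int ig.
have mge := measurable_average (measurable_eball_rel e) (@eball_sym _ _ e)
  (fun x => leb_eball x e) (vol_gt0 e_gt0) ig.
have mdge := measurable_md mge.
have mdg := measurable_md mg.
pose f := (EFin \o md (ball_average e g)) \_ B.
pose h := (fun x => c%:E * ((EFin \o md g) \_ Bt) x)%E.
have mf : measurable_fun setT f.
  by apply/(measurable_restrictT _ mB).1/measurable_EFinP/measurable_funTS.
have mh0 : measurable_fun setT ((EFin \o md g) \_ Bt).
  by apply/(measurable_restrictT _ mBt).1/measurable_EFinP/measurable_funTS.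
have g0 x : (0 <= ((EFin \o md g) \_ Bt) x)%E.
  by apply: erestrict_ge0 => y _; rewrite lee_fin modular_ge0.
have f0 x : (0 <= f x)%E.
  by apply: erestrict_ge0 => y _; rewrite lee_fin modular_ge0.
have h0 x : (0 <= h x)%E by rewrite mule_ge0 ?lee_fin.
have key z : (\int[leb]_(x in eball z e) f x <= \int[leb]_(x in eball z (2 * e)) h x)%E.
  (* A centre whose ball misses [B] contributes nothing. Otherwise its double ball lies within 2 e +
     e of a point of [B], hence in [Bt]. *)
  have [[x [Bx zx]]|nBz] := pselect (exists x, B x /\ eball z e x); last first.
    rewrite integral0_eq ?integral_ge0// => x zx.
    rewrite /f patchE memNset// => Bx; apply: nBz; by exists x.
  have VBt : eball z (2 * e) `<=` Bt.
    move=> y zy; apply: (BBt Bx); rewrite /eball/=.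
    apply: le_lt_trans (enorm_dist _ z _) _; apply: lt_le_trans e3.
    rewrite (_ : 3 * e = 2 * e + e); last by ring.
    by rewrite ltrD// enormBC.
  have H := local_ball_modular_bound e_gt0 (HC1 _ e_gt0 e1) VBt ig goo gK.
  apply: (@le_trans _ _ (\int[leb]_(x in eball z e) (md (ball_average e g) x)%:E)%E).
    apply: le_integral_nonneg => y _; first exact: f0.
    by rewrite /f patchE; case: ifP => // _; rewrite lee_fin modular_ge0.
  apply: (le_trans H); rewrite /h.
  rewrite (ge0_integralZl leb (measurable_eball z (2 * e)) (measurable_funTS mh0))//.
  apply: lee_wpmul2l; first by rewrite lee_fin.
  apply: le_integral_nonneg => y Vy; first by rewrite lee_fin modular_ge0.
  by rewrite patchE mem_set//; exact: VBt.
have mh : measurable_fun setT h by exact: measurable_funeM.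
have := @le_integral_of_le_kernel _ _ _ leb (fun x => eball x e) (fun x => eball x (2 * e))
  (vol n e) (vol n (2 * e)) f h (measurable_eball_rel e) (@eball_sym _ _ e)
  (fun x => leb_eball x e) (vol_gt0 e_gt0) (measurable_eball_rel (2 * e)) (@eball_sym _ _ (2 * e))
  (fun x => leb_eball x (2 * e)) (vol_gt0 e20) mf f0 mh h0 key.
rewrite -integral_mkcond => H; apply: (le_trans H).
rewrite (ge0_integralZl leb measurableT mh0)// -integral_mkcond muleA.
apply: lee_wpmul2r.
  by apply: integral_ge0 => x _; rewrite lee_fin modular_ge0.
rewrite -EFinM lee_fin ler_wpM2r// ler_pdivrMr ?vol_gt0//.
exact: vol_double.
Qed.

Hypothesis p1 : 1 <= p.
Hypothesis Btoo : (leb Bt < +oo)%E.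
Hypothesis Woo : (\int[leb]_(x in Bt) (w x `^ p + a x * w x `^ q)%:E < +oo)%E.

(* Split g = g1 + g2 with g1 bounded and the modular of g2 small; averaging keeps
   the modular of g2 small, and for g1 convergence in L^1 suffices. *)
Lemma ball_modular_cvg g : leb.-integrable setT (EFin \o g) ->
  (forall x, ~ Bt x -> g x = 0) -> (\int[leb]_(x in Bt) (md g x)%:E < +oo)%E ->
  forall t, 0 < t -> exists2 e1, 0 < e1 & forall e, 0 < e -> e < e1 ->
    (\int[leb]_(x in B) (md (fun x => ball_average e g x - g x)%R x)%:E <= t%:E)%E.
Proof.
move=> ig gBt goo t t_gt0.
have mg : measurable_fun setT g by apply/measurable_EFinP; exact: measurable_int ig.
have subB : B `<=` Bt by move=> x Bx; apply: (BBt Bx); rewrite /eball/= subrr enorm0.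
have w0' x : 0 <= w x by exact: ltW.
pose Kp := (\int[leb]_(x in Bt) ((w x * `|g x|) `^ p)%:E)%E.
have Kp0 : (0 <= Kp)%E by apply: integral_ge0 => x _; rewrite lee_fin powR_ge0.
have Kpfin : Kp \is a fin_num.
  rewrite ge0_fin_numE//; apply: le_lt_trans goo.
  apply: le_integral_nonneg => x _; first by rewrite lee_fin powR_ge0.
  by rewrite lee_fin /modular lerDl mulr_ge0 ?powR_ge0.
have K0 : 0 <= fine Kp by rewrite fine_ge0.
(* [C] is fixed before the truncation level: the tail [g2] satisfies |g2| <= |g|, so the p-energy
   bound of [g] serves it too. *)
have [C C0 HC] := ball_modular_bound K0.
have q30 : 0 < 3 `^ q :> R by rewrite powR_gt0.
(* Three terms of size [s], multiplied by the constant 3^q of [modular_add3], make [t]. The smaller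
   [s2] leaves room for the factor [C] lost in averaging the tail. *)
pose s := t / 3 / 3 `^ q.
have s0 : 0 < s by rewrite !divr_gt0.
pose s2 := s / (C + 1).
have s20 : 0 < s2 by rewrite divr_gt0// ltr_wpDl.
have mng : measurable_fun setT (fun x => `|g x|) by exact: measurableT_comp.
have [N HN] := integral_tail mBt (measurable_funTS (measurable_md mg))
  (measurable_funTS mng) (fun x _ => modular_ge0 g x) goo s20.
pose g2 x := g x * (N%:R < `|g x|)%R%:R.
pose g1 x := g x - g2 x.
have mg2 : measurable_fun setT g2.
  apply: measurable_funM mg _.
  apply: (measurableT_comp (f := fun b : bool => b%:R : R)); first by [].
  exact: (measurable_fun_ltr (measurable_cst _) mng).
have ig2 : leb.-integrable setT (EFin \o g2).
  apply: (le_integrable measurableT _ _ ig); first exact/measurable_EFinP.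
  move=> x _; rewrite /= lee_fin /g2 normrM normr_nat.
  by case: (_ < _); rewrite ?mulr1// mulr0.
have ig1 : leb.-integrable setT (EFin \o g1) by exact: (integrableB measurableT ig ig2).
have mg1 : measurable_fun setT g1 by apply/measurable_EFinP; exact: measurable_int ig1.
have g1N x : `|g1 x| <= N%:R.
  rewrite /g1 /g2; case: ltP => gN; first by rewrite mulr1 subrr normr0.
  by rewrite mulr0 subr0.
have Hg2 : (\int[leb]_(x in Bt) (md g2 x)%:E <= s2%:E)%E.
  apply: le_trans HN; apply: le_integral_nonneg => x _; first by rewrite lee_fin modular_ge0.
  by rewrite lee_fin /g2 modular_truncate.
have s2s : s2 <= s.
  by rewrite ler_pdivrMr ?ltr_wpDl// ler_peMr ?(ltW s0)// lerDr.
have WooB : (\int[leb]_(x in B) (w x `^ p + a x * w x `^ q)%:E < +oo)%E.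
  apply: le_lt_trans Woo; apply: subset_integral_nonneg => // x _.
  by rewrite lee_fin addr_ge0 ?mulr_ge0 ?powR_ge0.
(* Values of [g1] differ by at most 2 N, and so does the average of [g1] from [g1]. *)
have N20 : 0 <= 2 * N%:R :> R by rewrite mulr_ge0.
have [d d0 Hd] := @modular_small _ _ R leb p q a w p1 pq B (2 * N%:R) mB
  (measurable_funTS mw) (measurable_funTS ma) (fun x _ => w0' x) (fun x _ => a0 x) N20 WooB s s0.
have g1Bt x : ~ Bt x -> g1 x = 0.
  by move=> nBt; rewrite /g1 /g2 gBt// mul0r subrr.
have [e1 e10 He1] := ball_average_L1_cvg mB mBt Btoo e00 BBt ig1 g1Bt d0.
exists (Num.min e1 (Num.min 1 (e0 / 3))).
  by rewrite !lt_min e10 ltr01 divr_gt0.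
move=> e e_gt0; rewrite !lt_min => /and3P[ee1 el1 ee0].
have e3 : 3 * e <= e0 by move/ltW: ee0; rewrite ler_pdivlMr// mulrC.
have mav h : leb.-integrable setT (EFin \o h) -> measurable_fun setT (ball_average e h).
  exact: (measurable_average (measurable_eball_rel e) (@eball_sym _ _ e)
    (fun x => leb_eball x e) (vol_gt0 e_gt0)).
pose u x := ball_average e g1 x - g1 x.
have mu1 : measurable_fun setT u by exact: (measurable_funB (mav _ ig1) mg1).
have Hu : (\int[leb]_(x in B) (md u x)%:E <= s%:E)%E.
  apply: Hd; first exact: measurable_funTS.
    move=> x Bx; apply: (average_near (measurable_eball_rel e) (fun x => leb_eball x e) (vol_gt0 e_gt0)).
      exact: (integrableS measurableT (measurable_eball x e) (@subsetT _ _) ig1).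
    move=> y _; apply: le_trans (ler_normB _ _) _.
    by rewrite mulr_natl mulr2n lerD.
  exact: He1.
have Hag2 : (\int[leb]_(x in B) (md (ball_average e g2) x)%:E <= s%:E)%E.
  apply: (@le_trans _ _ (C%:E * s2%:E)%E); last first.
    rewrite -EFinM lee_fin mulrA ler_pdivrMr ?ltr_wpDl// mulrDr mulr1 mulrC lerDl.
    exact: ltW.
  apply: le_trans (HC e g2 e_gt0 (ltW el1) e3 ig2 _ _) _.
  - exact: le_lt_trans Hg2 (ltry _).
  - rewrite fineK//; apply: le_integral_nonneg => x _; first by rewrite lee_fin powR_ge0.
    rewrite lee_fin; apply: ge0_ler_powR; rewrite ?nnegrE ?mulr_ge0 ?(ltW p0)//.
    rewrite ler_wpM2l// /g2 normrM normr_nat.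
    by case: (_ < _); rewrite ?mulr1// mulr0.
  by apply: lee_wpmul2l.
have HNg2 : (\int[leb]_(x in B) (md (fun x => - g2 x)%R x)%:E <= s%:E)%E.
  apply: le_trans (_ : _ <= s2%:E)%E _; last by rewrite lee_fin.
  apply: le_trans Hg2; apply: (@le_trans _ _ (\int[leb]_(x in B) (md g2 x)%:E)%E).
    apply: le_integral_nonneg => x _; first by rewrite lee_fin modular_ge0.
    by rewrite lee_fin /modular normrN.
  by apply: subset_integral_nonneg => // x _; rewrite lee_fin modular_ge0.
(* The error for [g] is the error for [g1], plus the average of [g2], minus [g2]. *)
apply: (@le_trans _ _ (\int[leb]_(x in B) ((3 `^ q)%:E * ((md u x)%:E +
    ((md (ball_average e g2) x)%:E + (md (fun x => - g2 x)%R x)%:E)))%E)%E).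
  apply: le_integral_nonneg => x _; first by rewrite lee_fin modular_ge0.
  rewrite -!EFinD -EFinM lee_fin addrA; apply: le_trans (modular_add3 p1 pq _ _ _ _ _) => //.
  rewrite le_eqVlt; apply/orP; left; apply/eqP; congr (md _ x).
  apply/funext => y; rewrite /u /g1.
  have -> : ball_average e (fun x => g x - g2 x) y = ball_average e g y - ball_average e g2 y.
    exact: (@averageB _ _ R leb (fun x => eball x e) (vol n e) (measurable_eball_rel e) g g2 y ig ig2).
  by ring.
have mE h : measurable_fun setT h -> measurable_fun B (fun x => (md h x)%:E).
  by move=> mh; apply/measurable_EFinP; apply: measurable_funTS; exact: measurable_md.
have mEu := mE _ mu1; have mEa := mE _ (mav _ ig2).
have mEn : measurable_fun B (fun x => (md (fun x => - g2 x)%R x)%:E).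
  by apply: mE; exact: measurable_funN.
have p_ge0 h x : B x -> (0 <= (md h x)%:E)%E by move=> _; rewrite lee_fin modular_ge0.
rewrite (ge0_integralZl leb mB (emeasurable_funD mEu (emeasurable_funD mEa mEn))); last 2 first.
- by move=> x Bx; rewrite !adde_ge0 ?p_ge0.
- by rewrite lee_fin ltW.
rewrite (ge0_integralD leb mB (fun x Bx => p_ge0 _ x Bx) mEu _ (emeasurable_funD mEa mEn)); last first.
  by move=> x Bx; rewrite adde_ge0 ?p_ge0.
rewrite (ge0_integralD leb mB (fun x Bx => p_ge0 _ x Bx) mEa (fun x Bx => p_ge0 _ x Bx) mEn).
apply: (@le_trans _ _ ((3 `^ q)%:E * (s%:E + (s%:E + s%:E)))%E).
  apply: lee_wpmul2l; first by rewrite lee_fin ltW.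
  exact: leeD Hu (leeD Hag2 HNg2).
rewrite -!EFinD -EFinM lee_fin /s.
move: q30; move: (3 `^ q) => Z Z0.
by rewrite le_eqVlt; apply/orP; left; apply/eqP; field; rewrite gt_eqF.
Qed.

End ball_modular.

(** * Functional calculus for symmetric matrices *)

Section log_series.
Context {R : realType}.

Let lpoly (N : nat) : {poly R} := \sum_(k < N) (k.+1%:R)^-1 *: 'X^(k.+1).

Let lpolyE N y : (lpoly N).[y] = \sum_(k < N) (k.+1%:R)^-1 * y ^+ k.+1.
Proof. by rewrite /lpoly horner_sum; apply: eq_bigr => k _; rewrite hornerZ hornerXn. Qed.

Let dlpolyE N y : (lpoly N)^`().[y] = \sum_(k < N) y ^+ k.
Proof.
rewrite /lpoly linear_sum/= horner_sum; apply: eq_bigr => k _.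
by rewrite derivZ derivXn/= hornerZ hornerMn hornerXn mulrnAr -mulrnAl -[X in X * _]mulr_natr mulVf ?mul1r.
Qed.

Let geom N (y : R) : y < 1 -> \sum_(k < N) y ^+ k = (1 - y ^+ N) / (1 - y).
Proof.
move=> y1; apply: (canRL (mulfK _)); first by rewrite gt_eqF// subr_gt0.
by rewrite mulrC -opprB mulNr -subrX1 opprB.
Qed.

(** The derivative of ln (1 - t) plus the partial sum is, by the geometric sum, -t^N / (1 - t); the
    bound is the mean value theorem on [0, y]. *)
Lemma log_series_bound N (y : R) : 0 <= y -> y < 1 ->
  `|ln (1 - y) + \sum_(k < N) (k.+1%:R)^-1 * y ^+ k.+1| <= y ^+ N / (1 - y).
Proof.
move=> y0 y1; rewrite -lpolyE.
pose f (t : R) : R := ln (1 - t) + (lpoly N).[t].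
have df (t : R) : t < 1 -> is_derive t (1 : R) f (- (t ^+ N / (1 - t))).
  move=> t1; have t10 : 0 < 1 - t by rewrite subr_gt0.
  have d1 : is_derive t (1 : R) (fun s : R => 1 - s) (-1).
    have := is_deriveB (is_derive_cst (1 : R) t (1 : R)) (is_derive_id t (1 : R)).
    by rewrite sub0r.
  have d2 : is_derive t (1 : R) (fun s => ln (1 - s)) ((1 - t)^-1 * -1).
    have := is_derive1_comp (f := @ln R) (g := fun s : R => 1 - s) (is_derive1_ln t10) d1.
    exact.
  have -> : - (t ^+ N / (1 - t)) = (1 - t)^-1 * -1 + (lpoly N)^`().[t].
    by rewrite dlpolyE geom//; field; rewrite gt_eqF.
  exact: (is_deriveD d2 (is_derive_poly (lpoly N) t)).
have [c /[!in_itv]/= /andP[c0 cy] fc] : exists2 c, c \in `[0, y] & f y - f 0 = - (c ^+ N / (1 - c)) * (y - 0).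
  apply: MVT_segment => // [t /[!in_itv]/= /andP[_ ty]|].
    by apply: df; exact: lt_trans y1.
  apply: derivable_within_continuous => t /[!in_itv]/= /andP[_ ty].
  by have [] := df t (le_lt_trans ty y1).
have f0 : f 0 = 0.
  rewrite /f subr0 ln1 lpolyE add0r big1// => k _.
  by rewrite expr0n/= mulr0.
have -> : ln (1 - y) + (lpoly N).[y] = - (c ^+ N / (1 - c)) * y.
  by rewrite -[LHS]/(f y) -[f y]subr0 -[X in _ - X]f0 fc subr0.
have c1 : 0 < 1 - c by rewrite subr_gt0 (le_lt_trans cy).
have y10 : 0 < 1 - y by rewrite subr_gt0.
have cN : 0 <= c ^+ N / (1 - c) by rewrite divr_ge0 ?exprn_ge0// ltW.
rewrite mulNr normrN ger0_norm; last by rewrite mulr_ge0.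
rewrite -[leRHS]mulr1; apply: ler_pM => //; last exact: ltW.
apply: ler_pM; rewrite ?exprn_ge0 ?invr_ge0 ?(ltW c1)//.
  by apply: lerXn2r; rewrite ?nnegrE.
by rewrite lef_pV2 ?posrE// lerD2l lerN2.
Qed.

Lemma log_series_cvg (y : R) : 0 <= y -> y < 1 ->
  \sum_(k < N) (k.+1%:R)^-1 * y ^+ k.+1 @[N --> \oo] --> - ln (1 - y).
Proof.
move=> y0 y1; apply/cvgrPdist_le => e e0.
have /cvgr0Pnorm_lt /(_ (e * (1 - y))) : (y ^+ N : R) @[N --> \oo] --> 0.
  by apply: cvg_expr; rewrite ger0_norm.
have y10 : 0 < 1 - y by rewrite subr_gt0.
rewrite mulr_gt0// => /(_ isT); apply: filterS => N yN.
rewrite -opprD normrN; apply: le_trans (log_series_bound N y0 y1) _.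
rewrite ler_pdivrMr//; apply: le_trans (ltW yN); exact: ler_norm.
Qed.

End log_series.

Lemma cvg_sum {R : realType} {S I : Type} {F : set_system S} {FF : Filter F} (r : seq I)
    (f : I -> S -> R) (l : I -> R) :
  (forall i, f i x @[x --> F] --> l i) ->
  \sum_(i <- r) f i x @[x --> F] --> \sum_(i <- r) l i.
Proof.
move=> fl; elim: r => [|i r IH].
  by under eq_fun do rewrite big_nil; rewrite big_nil; exact: cvg_cst.
under eq_fun do rewrite big_cons.
by rewrite big_cons; exact: cvgD.
Qed.

Section symmetric_matrices.
Context {R : realType}.

Local Definition dot n (u v : 'rV[R]_n) : R := (u *m v^T) 0 0.

Let dotE n (u v : 'rV[R]_n) : dot u v = \sum_i u 0 i * v 0 i.
Proof. by rewrite /dot mxE; apply: eq_bigr => i _; rewrite mxE. Qed.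

Let dotC n (u v : 'rV[R]_n) : dot u v = dot v u.
Proof. by rewrite !dotE; apply: eq_bigr => i _; rewrite mulrC. Qed.

Let dotDl n (u v z : 'rV[R]_n) : dot (u + v) z = dot u z + dot v z.
Proof. by rewrite /dot mulmxDl mxE. Qed.

Let dotZl n (k : R) (u z : 'rV[R]_n) : dot (k *: u) z = k * dot u z.
Proof. by rewrite /dot -scalemxAl mxE. Qed.

Let dotDr n (u v z : 'rV[R]_n) : dot z (u + v) = dot z u + dot z v.
Proof. by rewrite !(dotC z) dotDl. Qed.

Let dotZr n (k : R) (u z : 'rV[R]_n) : dot z (k *: u) = k * dot z u.
Proof. by rewrite !(dotC z) dotZl. Qed.

Let dot_ge0 n (u : 'rV[R]_n) : 0 <= dot u u.
Proof. by rewrite dotE sumr_ge0// => i _; rewrite -expr2 sqr_ge0. Qed.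

Let dot_eq0 n (u : 'rV[R]_n) : dot u u = 0 -> u = 0.
Proof.
rewrite dotE => /eqP; rewrite psumr_eq0; last by move=> i _; rewrite -expr2 sqr_ge0.
move=> /allP H; apply/rowP => i; rewrite mxE; have := H i (mem_index_enum _).
by rewrite mulf_eq0 orbb => /eqP.
Qed.

Let dot_sym n (A : 'M[R]_n) u v : A^T = A -> dot (u *m A) v = dot u (v *m A).
Proof. by move=> sA; rewrite /dot trmx_mul sA mulmxA. Qed.

Let dot_continuous n (A : 'M[R]_n) : continuous (fun z : 'rV[R]_n => dot (z *m A) z).
Proof.
have -> : (fun z : 'rV[R]_n => dot (z *m A) z) =
    (fun z => \sum_i (\sum_j z 0 j * A j i) * z 0 i).
  by apply/funext => z; rewrite dotE; apply: eq_bigr => i _; rewrite mxE.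
move=> z; apply: (@cvg_sum _ _ _ _ (nbhs_filter z)) => i.
apply: (cvgM (FF := nbhs_filter z)); last exact: coord_continuous.
by apply: (@cvg_sum _ _ _ _ (nbhs_filter z)) => j; apply: (cvgM (FF := nbhs_filter z)); [exact: coord_continuous|exact: cvg_cst].
Qed.

(** A nonnegative quadratic vanishing at 0 has no linear term. The test value t = -b / (c + 1) also
    covers c = 0. *)
Let linear_coef_eq0 (b c : R) : (forall t, 0 <= 2 * t * b + t ^+ 2 * c) -> 0 <= c -> b = 0.
Proof.
move=> H c0; apply/eqP; rewrite -sqrf_eq0 eq_le sqr_ge0 andbT.
have c1 : 0 < c + 1 by rewrite ltr_wpDl.
have := H (- b / (c + 1)).
have -> : 2 * (- b / (c + 1)) * b + (- b / (c + 1)) ^+ 2 * c =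
   - (b ^+ 2 * (c + 2) / (c + 1) ^+ 2) by field; rewrite gt_eqF.
rewrite oppr_ge0 pmulr_lle0 ?invr_gt0 ?exprn_gt0// pmulr_lle0//.
by rewrite ltr_wpDl.
Qed.

(** A maximiser v of the quadratic form on the unit sphere exists by compactness. With l the
    maximum, B = l - A is positive semidefinite and its form vanishes at v; perturbing v in the
    direction v B forces v B = 0. *)
Lemma symmetric_unit_eigenvector n (A : 'M[R]_n.+1) : A^T = A ->
  exists (l : R) (v : 'rV[R]_n.+1), (v *m v^T) 0 0 = 1 /\ v *m A = l *: v.
Proof.
move=> sA; pose S := [set z : 'rV[R]_n.+1 | dot z z = 1].
have cS : compact S.
  apply: bounded_closed_compact.
    exists 1; split=> // M M1 z; rewrite /S/= dotE => z1.
    apply: le_trans (ltW M1); rewrite [leLHS]mx_normrE; apply/bigmax_leP; split=> //= -[i j] _ /=.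
    rewrite (ord1 i) -(@ler_pXn2r _ 2)// ?nnegrE// expr1n -z1 -normrX ger0_norm ?sqr_ge0//.
    by rewrite (bigD1 j)//= -expr2 lerDl sumr_ge0// => k _; rewrite -expr2 sqr_ge0.
  have -> : S = (fun z : 'rV[R]_n.+1 => dot (z *m 1%:M) z) @^-1` [set 1].
    by apply/seteqP; split=> z; rewrite /S/= mulmx1.
  by apply: preimage_closed => [z _|]; [exact: dot_continuous|exact: closed_eq].
have S0 : S !=set0.
  exists (delta_mx 0 0); rewrite /S/= dotE (bigD1 0)//= big1 ?addr0.
    by rewrite !mxE !eqxx mulr1.
  by move=> j j0; rewrite !mxE (negbTE j0) andbF mulr0.
have [v /[!inE] v1 vmax] := EVT_max_rV S0 cS
  (continuous_subspaceT (@dot_continuous _ A)).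
exists (dot (v *m A) v), v; split => //.
set l := dot (v *m A) v.
pose B := l%:M - A.
have sB : B^T = B by rewrite /B linearB/= tr_scalar_mx sA.
have qB z : dot (z *m B) z = l * dot z z - dot (z *m A) z.
  by rewrite /B mulmxBr mul_mx_scalar -[in LHS]scaleN1r dotDl !dotZl mulN1r.
have B0 z : 0 <= dot (z *m B) z.
  rewrite qB; have [->|z0] := eqVneq z 0.
    by rewrite mul0mx /dot mul0mx mxE mulr0 subrr.
  have zz : 0 < dot z z.
    by rewrite lt_neqAle dot_ge0 andbT eq_sym; apply: contra z0 => /eqP/dot_eq0->.
  pose k := (Num.sqrt (dot z z))^-1.
  have k2 : k ^+ 2 = (dot z z)^-1 by rewrite /k exprVn sqr_sqrtr ?dot_ge0.
  have := vmax (k *: z); rewrite inE /S/= dotZl dotZr mulrA -expr2 k2 mulVf ?gt_eqF//.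
  move=> /(_ erefl); rewrite -scalemxAl dotZl dotZr mulrA -expr2 k2 -/l.
  by rewrite ler_pdivrMl// subr_ge0 mulrC.
have vB : v *m B = 0.
  apply: dot_eq0; set u := v *m B.
  have := @linear_coef_eq0 (dot u u) (dot (u *m B) u); apply; last exact: B0.
  move=> t; have := B0 (v + t *: u).
  rewrite mulmxDl -scalemxAl !dotDl !dotDr !dotZl !dotZr -/u.
  have -> : dot u v = 0 by rewrite qB v1 mulr1 subrr.
  rewrite -(dot_sym _ _ sB) -/u; congr (_ <= _); ring.
move: vB; rewrite /B mulmxBr mul_mx_scalar => /eqP; rewrite subr_eq0 => /eqP <-.
by [].
Qed.

(** The reflection that exchanges the first basis vector e and v, along u = e - v; for e = v the
    identity serves. *)
Let householder n (v : 'rV[R]_n.+1) : dot v v = 1 -> exists H : 'M[R]_n.+1,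
  [/\ H^T = H, H *m H = 1%:M & (delta_mx 0 0 : 'rV_n.+1) *m H = v].
Proof.
move=> v1; pose e : 'rV[R]_n.+1 := delta_mx 0 0.
have [<-|ev] := eqVneq e v; first by exists 1%:M; rewrite trmx1 !mulmx1.
have [u uE] : exists u, u = e - v by exists (e - v).
pose c := dot u u.
have ee : dot e e = 1.
  rewrite dotE (bigD1 0)//= big1 ?addr0; first by rewrite !mxE !eqxx mulr1.
  by move=> j j0; rewrite !mxE (negbTE j0) andbF mulr0.
have c0 : c != 0 by apply: contra ev => /eqP/dot_eq0/eqP; rewrite uE subr_eq0.
have eu : dot e u = c / 2.
  rewrite /c uE -scaleN1r !dotDl !dotDr !dotZl !dotZr ee v1 (dotC v e).
  by field.
have uu : u *m u^T = c%:M.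
  by apply/matrixP => i j; rewrite (ord1 i) (ord1 j) [RHS]mxE eqxx mulr1n.
exists (1%:M - (2 / c) *: (u^T *m u)); split.
- by rewrite linearB/= linearZ/= trmx1 trmx_mul trmxK.
- rewrite mulmxBl mul1mx mulmxBr mulmx1.
  rewrite -scalemxAl -scalemxAr mulmxA -(mulmxA u^T u) uu mul_mx_scalar -scalemxAl.
  rewrite !scalerA (_ : 2 / c * (2 / c * c) = 2 / c + 2 / c); last by field.
  by rewrite scalerDl opprB addrK subrK.
rewrite mulmxBr mulmx1 -scalemxAr mulmxA -/e.
have -> : e *m u^T = (c / 2)%:M.
  by apply/matrixP => i j; rewrite (ord1 i) (ord1 j) [RHS]mxE eqxx mulr1n -eu.
rewrite mul_scalar_mx scalerA (_ : 2 / c * (c / 2) = 1) ?scale1r; last by field.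
by rewrite uE opprB addrCA subrr addr0.
Qed.

(** Deflation: conjugating by the reflection that sends e to a unit eigenvector makes the first row
    a multiple of e, so by symmetry the matrix is block diagonal, and the induction hypothesis
    diagonalises the lower block. *)
Theorem real_spectral n (A : 'M[R]_n) : A^T = A ->
  exists (P : 'M[R]_n) (d : 'rV[R]_n),
    P *m P^T = 1%:M /\ A = P^T *m diag_mx d *m P.
Proof.
elim: n A => [|n IH] A sA.
  by exists 1%:M, 0; split; apply/matrixP => -[].
have [l [v [v1 vA]]] := symmetric_unit_eigenvector sA.
have [H [sH HH eH]] := householder v1.
pose e : 'rV[R]_n.+1 := delta_mx 0 0.
have [A' A'def] : exists A' : 'M[R]_(1 + n), A' = H *m A *m H by eexists.
have sA' : A'^T = A' by rewrite A'def !trmx_mul sH sA mulmxA.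
have eA' : e *m A' = l *: e.
  by rewrite A'def !mulmxA eH vA -scalemxAl -eH -mulmxA HH mulmx1.
have row0 j : A' 0 j = l * (0 == j)%:R.
  have /rowP/(_ j) := eA'; rewrite -rowE !mxE => ->.
  by rewrite eqxx eq_sym.
have z0 : lshift n (0 : 'I_1) = 0 :> 'I_n.+1 by apply: val_inj.
have A'E : A' = block_mx l%:M 0 0 (drsubmx A').
  rewrite -[LHS]submxK; congr block_mx.
  - apply/matrixP => i j; rewrite (ord1 i) (ord1 j) !mxE eqxx mulr1n.
    by rewrite z0 row0 eqxx mulr1.
  - apply/matrixP => i j; rewrite (ord1 i) !mxE.
    by rewrite z0 row0 mulr0.
  - rewrite -sA' -trmx_ursub; apply/matrixP => i j; rewrite (ord1 j) !mxE.
    by rewrite z0 row0 mulr0.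
have sD : (drsubmx A')^T = drsubmx A' by rewrite trmx_drsub sA'.
have [Q [d [QQ DE]]] := IH _ sD.
have [K KE] : exists K : 'M[R]_(1 + n), K = block_mx 1%:M 0 0 Q by eexists.
have KT : K^T = block_mx 1%:M 0 0 Q^T by rewrite KE tr_block_mx !trmx0 trmx1.
have [r rE] : exists r : 'rV[R]_(1 + n), r = row_mx l%:M d by eexists.
have KK : K *m K^T = 1%:M.
  rewrite KT KE mulmx_block !mulmx0 !mul0mx !mulmx1 !addr0 add0r QQ.
  by rewrite -scalar_mx_block.
have KA : K^T *m diag_mx r *m K = A'.
  have l1 : diag_mx (l%:M : 'rV[R]_1) = l%:M.
    by apply/matrixP => i j; rewrite !mxE (ord1 i) (ord1 j) !eqxx.
  rewrite KT KE rE diag_mx_row l1 !mulmx_block.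
  by rewrite !mulmx0 !mul0mx !mulmx1 !mul1mx !addr0 !add0r ?mulmx0 ?mul0mx -DE -A'E.
exists (K *m H), r; split.
  by rewrite trmx_mul sH mulmxA -(mulmxA K) HH mulmx1.
rewrite trmx_mul sH !mulmxA -(mulmxA H) -(mulmxA H) KA A'def.
by rewrite !mulmxA HH mul1mx -mulmxA HH mulmx1.
Qed.

End symmetric_matrices.

Section matrix_limits.
Context {R : realType} {n : nat}.

Lemma cvg_mxP (F : nat -> 'M[R]_n) (L : 'M[R]_n) :
  (forall i j, F k i j @[k --> \oo] --> L i j) -> F k @[k --> \oo] --> L.
Proof.
move=> H; apply/cvg_ballP => e e0.
have H1 : \forall k \near \oo, forall i j, ball (L i j) e (F k i j).
  have H2 i : \forall k \near \oo, forall j, ball (L i j) e (F k i j).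
    apply: filter_forall => j; have /cvg_ballP := H i j; exact.
  exact: filter_forall.
by apply: filterS H1 => k Hk; split.
Qed.

End matrix_limits.

(** * Exponential and logarithm of diagonalised matrices *)

Section functional_calculus.
Context {R : realType} {n : nat}.
Implicit Types (P A L : 'M[R]_n) (d : 'rV[R]_n).

Definition conj_diag P d : 'M[R]_n := P^T *m diag_mx d *m P.

Lemma conj_diagE P d i j : conj_diag P d i j = \sum_l d 0 l * (P l i * P l j).
Proof.
rewrite /conj_diag -mulmxA mxE; apply: eq_bigr => l _.
rewrite mxE mxE (bigD1 l)//= mxE eqxx mulr1n big1 ?addr0.
  by ring.
by move=> k kl; rewrite mxE eq_sym (negbTE kl) mulr0n mul0r.
Qed.

Lemma tr_conj_diag P d : (conj_diag P d)^T = conj_diag P d.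
Proof. by rewrite /conj_diag !trmx_mul trmxK tr_diag_mx mulmxA. Qed.

Section orthogonal.
Variable P : 'M[R]_n.
Hypothesis PP : P *m P^T = 1%:M.

Let PP' : P^T *m P = 1%:M. Proof. exact: mulmx1C. Qed.

Lemma conj_diag1 : conj_diag P (\row_i 1) = 1%:M.
Proof.
rewrite /conj_diag (_ : diag_mx _ = 1%:M) ?mulmx1//.
by apply/matrixP => i j; rewrite !mxE.
Qed.

Lemma conj_diagM d1 d2 :
  conj_diag P d1 *m conj_diag P d2 = conj_diag P (\row_i (d1 0 i * d2 0 i)).
Proof.
rewrite /conj_diag !mulmxA -(mulmxA _ P P^T) PP mulmx1 -(mulmxA P^T).
congr (_ *m _ *m _); apply/matrixP => i j; rewrite mxE (bigD1 i)//= big1 ?addr0.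
  by rewrite !mxE eqxx mulr1n; case: eqVneq => [->|_]; rewrite ?mulr1n// !mulr0n mulr0.
by move=> k ki; rewrite !mxE eq_sym (negbTE ki) mulr0n mul0r.
Qed.

Lemma conj_diagX d k : conj_diag P d ^+ k = conj_diag P (\row_i (d 0 i ^+ k)).
Proof.
elim: k => [|k IH].
  have -> : \row_i (d 0 i ^+ 0) = \row_i 1 :> 'rV[R]_n by apply/rowP => i; rewrite !mxE.
  by rewrite conj_diag1.
rewrite exprS IH -[LHS]/(conj_diag P d *m _) conj_diagM; congr conj_diag.
by apply/rowP => i; rewrite !mxE exprS.
Qed.

Lemma det_conj_diag d : \det (conj_diag P d) = \prod_i d 0 i.
Proof.
rewrite /conj_diag !det_mulmx det_diag mulrAC -det_mulmx PP' det1 mul1r.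
by [].
Qed.

Lemma trace_conj_diag d : \tr (conj_diag P d) = \sum_i d 0 i.
Proof.
by rewrite /conj_diag mxtrace_mulC mulmxA PP mul1mx mxtrace_diag.
Qed.

Lemma conj_diag_cvg (d_ : nat -> 'rV[R]_n) d :
  (forall i, d_ k 0 i @[k --> \oo] --> d 0 i) ->
  forall i j, conj_diag P (d_ k) i j @[k --> \oo] --> conj_diag P d i j.
Proof.
move=> H i j; under eq_fun do rewrite conj_diagE; rewrite conj_diagE.
by apply: cvg_sum => l; apply: cvgM => //; exact: cvg_cst.
Qed.

(** Conjugation commutes with polynomials, so the partial sums act on the eigenvalues, and the limit
    is taken entry by entry. *)
Lemma expmx_conj_diag d : expmx (conj_diag P d) = conj_diag P (\row_i expR (d 0 i)).
Proof.
apply: cvg_lim => //; apply: cvg_mxP => i j.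
have -> : (fun k => (\sum_(l < k) (l`!%:R)^-1 *: conj_diag P d ^+ l) i j) =
    (fun k => conj_diag P (\row_m \sum_(l < k) (l`!%:R)^-1 * d 0 m ^+ l) i j).
  apply/funext => k; rewrite summxE conj_diagE.
  under eq_bigr do rewrite conj_diagX mxE conj_diagE mulr_sumr.
  rewrite exchange_big/=; apply: eq_bigr => m _; rewrite mxE mulr_suml.
  apply: eq_bigr => l _; rewrite mxE; ring.
apply: conj_diag_cvg => m; rewrite mxE.
under eq_fun do rewrite mxE.
have -> : (fun k => \sum_(l < k) (l`!%:R)^-1 * d 0 m ^+ l) = series (exp_coeff (d 0 m)).
  by apply/funext => k; rewrite /series/= big_mkord; apply: eq_bigr => l _; rewrite mulrC.
exact: is_cvg_series_exp_coeff.
Qed.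

End orthogonal.

Lemma spectral_conj A : A^T = A -> exists P d, P *m P^T = 1%:M /\ A = conj_diag P d.
Proof. exact: real_spectral. Qed.

Lemma eigen_conj_diag P d i : P *m P^T = 1%:M ->
  exists z : 'cV[R]_n, enorm z = 1 /\ conj_diag P d *m z = d 0 i *: z.
Proof.
move=> PP; exists (col i P^T); split.
  rewrite /enorm (_ : \sum_j _ = 1) ?sqrtr1//.
  have /matrixP/(_ i i) := PP; rewrite !mxE eqxx mulr1n => <-.
  by apply: eq_bigr => j _; rewrite !mxE expr2.
have -> : col i P^T = P^T *m delta_mx i 0 by rewrite colE.
rewrite /conj_diag -!mulmxA [P *m _]mulmxA PP mul1mx scalemxAr; congr (_ *m _).
apply/colP => k; rewrite mxE (bigD1 k)//= big1 ?addr0.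
  by rewrite !mxE !eqxx mulr1n; case: eqVneq => [->|_]; rewrite ?mulr1// !mulr0.
by move=> l lk; rewrite !mxE eq_sym (negbTE lk) mulr0n mul0r.
Qed.

Lemma posdef_diag_gt0 P d i : P *m P^T = 1%:M -> posdef (conj_diag P d) -> 0 < d 0 i.
Proof.
move=> PP pd; have [z [z1 zE]] := eigen_conj_diag d i PP.
have z0 : z != 0.
  by apply/eqP => z0; move: z1; rewrite z0 enorm0 => /eqP; rewrite eq_sym oner_eq0.
have := pd z z0; rewrite -mulmxA zE -scalemxAr mxE.
rewrite (_ : (z^T *m z) 0 0 = 1) ?mulr1//.
rewrite -[RHS](expr1n _ 2) -z1 sqr_enorm mxE; apply: eq_bigr => j _.
by rewrite mxE expr2.
Qed.

(** [get] returns a symmetric logarithm as soon as one exists; the logarithms of the eigenvalues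
    provide one. *)
Lemma logmxP A : A^T = A -> posdef A ->
  (logmx A)^T = logmx A /\ expmx (logmx A) = A.
Proof.
move=> sA pA; apply: (@getPex _ [set L | L^T = L /\ expmx L = A]).
have [P [d [PP AE]]] := spectral_conj sA.
exists (conj_diag P (\row_i ln (d 0 i))); split; first exact: tr_conj_diag.
rewrite expmx_conj_diag// AE; congr conj_diag; apply/rowP => i; rewrite !mxE.
by rewrite lnK// posrE; apply: (posdef_diag_gt0 (P := P)) => //; rewrite -AE.
Qed.

(** It is the logarithm that is diagonalised, not [A]: the determinant of its exponential is then
    the exponential of its trace, whichever logarithm [get] has chosen. *)
Lemma ln_det_posdef A : A^T = A -> posdef A -> 0 < \det A /\ ln (\det A) = \tr (logmx A).
Proof.
move=> sA pA; have [sL LE] := logmxP sA pA.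
have [P [d [PP LP]]] := spectral_conj sL.
have -> : \det A = expR (\tr (logmx A)).
  rewrite -{1}LE LP expmx_conj_diag// det_conj_diag// trace_conj_diag//.
  by rewrite expR_sum; apply: eq_bigr => i _; rewrite mxE.
by rewrite expR_gt0 expRK.
Qed.

Let subE (X Y : 'M[R]_n) i j : (X - Y) i j = X i j - Y i j.
Proof. by rewrite !mxE. Qed.

Let scaleE (c : R) (X : 'M[R]_n) i j : (c *: X) i j = c * X i j.
Proof. by rewrite !mxE. Qed.

(* Dividing by the trace puts the spectrum in (0, 1], where the logarithm is given
   by its power series; hence logmx is a limit of polynomials in the entries. *)
Lemma logmx_series A : A^T = A -> posdef A -> forall i j,
  (ln (\tr A) *: 1%:M - \sum_(k < N) (k.+1%:R)^-1 *:
     (1%:M - (\tr A)^-1 *: A) ^+ k.+1) i j @[N --> \oo] --> logmx A i j.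
Proof.
move=> sA pA i j; have [sL LE] := logmxP sA pA.
have [P [d [PP LP]]] := spectral_conj sL.
have AE : A = conj_diag P (\row_l expR (d 0 l)) by rewrite -LE LP expmx_conj_diag.
pose c := \tr A.
have cE : c = \sum_l expR (d 0 l).
  by rewrite /c AE trace_conj_diag//; apply: eq_bigr => l _; rewrite mxE.
have dc l : expR (d 0 l) <= c.
  by rewrite cE (bigD1 l)//= lerDl sumr_ge0// => m _; exact: expR_ge0.
have c0 : 0 < c by apply: lt_le_trans (dc i); exact: expR_gt0.
have E1 : 1%:M - c^-1 *: A = conj_diag P (\row_l (1 - expR (d 0 l) / c)).
  rewrite -(conj_diag1 PP) AE; apply/matrixP => k m.
  rewrite subE scaleE !conj_diagE mulr_sumr -sumrB; apply: eq_bigr => l _.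
  by rewrite !mxE; ring.
have -> : (fun N => (ln c *: 1%:M - \sum_(k < N) (k.+1%:R)^-1 *:
     (1%:M - c^-1 *: A) ^+ k.+1) i j) =
    (fun N => conj_diag P (\row_l (ln c - \sum_(k < N) (k.+1%:R)^-1 *
       (1 - expR (d 0 l) / c) ^+ k.+1)) i j).
  apply/funext => N; rewrite E1 -{1}(conj_diag1 PP) subE scaleE summxE !conj_diagE mulr_sumr.
  under [X in _ - X]eq_bigr do rewrite conj_diagX// scaleE conj_diagE mulr_sumr.
  rewrite exchange_big/= -sumrB; apply: eq_bigr => l _.
  rewrite !mxE mulrBl mul1r; congr (_ - _); rewrite mulr_suml; apply: eq_bigr => k _.
  by rewrite !mxE mulrA.
rewrite LP; apply: conj_diag_cvg => l; under eq_fun do rewrite mxE.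
have dc0 : 0 < expR (d 0 l) / c by rewrite divr_gt0// expR_gt0.
have E : ln c - - ln (1 - (1 - expR (d 0 l) / c)) = d 0 l.
  by rewrite subKr opprK ln_div ?posrE ?expR_gt0// expRK addrC subrK.
have y0 : 0 <= 1 - expR (d 0 l) / c by rewrite subr_ge0 ler_pdivrMr// mul1r.
have y1 : 1 - expR (d 0 l) / c < 1 by rewrite ltrBlDr ltrDl.
have H : ln c - \sum_(k < N) (k.+1%:R)^-1 * (1 - expR (d 0 l) / c) ^+ k.+1
    @[N --> \oo] --> ln c - - ln (1 - (1 - expR (d 0 l) / c)).
  by apply: cvgB; [exact: cvg_cst|exact: log_series_cvg].
by rewrite E in H.
Qed.

End functional_calculus.

(** * The spectral norm and the geometric mean of the eigenvalues *)

Section operator_norm.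
Context {R : realType} {n : nat}.
Implicit Types (A : 'M[R]_n) (z : 'cV[R]_n).

Let opset A := [set enorm (A *m z) | z in [set z | enorm z <= 1]].

(** Ensures that the [sup] in [opnorm] is a genuine supremum and not a default value. *)
Let opset_has_sup A : has_sup (opset A).
Proof.
split; first by exists (enorm (A *m 0)); exists 0 => //=; rewrite enorm0.
exists (\sum_i \sum_j `|A i j|) => _ [z /= z1 <-].
apply: le_trans (enorm_le_sum _) _; apply: ler_sum => i _.
rewrite mxE; apply: le_trans (ler_norm_sum _ _ _) _; apply: ler_sum => j _.
by rewrite normrM ler_piMr// (le_trans (coord_le_enorm _ _)).
Qed.

Lemma opnorm_ge0 A : 0 <= opnorm A.
Proof.
have [_ uA] := opset_has_sup A.
apply: le_trans (enorm_ge0 (A *m 0)) _; apply: ub_le_sup => //.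
by exists 0 => //=; rewrite enorm0.
Qed.

Lemma enorm_mulmx_le A z : enorm (A *m z) <= opnorm A * enorm z.
Proof.
have [z0|z0] := eqVneq (enorm z) 0.
  have -> : z = 0.
    apply/colP => i; have := coord_le_enorm z i; rewrite z0 normr_le0 => /eqP->.
    by rewrite mxE.
  by rewrite mulmx0 enorm0 mulr0.
have zp : 0 < enorm z by rewrite lt_neqAle enorm_ge0 eq_sym z0.
rewrite -ler_pdivrMr//.
have [_ uA] := opset_has_sup A.
apply: ub_le_sup => //; exists ((enorm z)^-1 *: z) => /=.
  by rewrite enormZ ger0_norm ?invr_ge0 ?enorm_ge0// mulVf.
by rewrite -scalemxAr enormZ ger0_norm ?invr_ge0 ?enorm_ge0// mulrC.
Qed.

Lemma diag_le_opnorm A i : `|A i i| <= opnorm A.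
Proof.
pose z : 'cV[R]_n := delta_mx i 0.
have z1 : enorm z = 1.
  rewrite /enorm (bigD1 i)//= mxE !eqxx big1 ?addr0 ?expr1n ?sqrtr1//.
  by move=> j ji; rewrite mxE (negbTE ji) expr0n.
have := enorm_mulmx_le A z; rewrite z1 mulr1; apply: le_trans.
apply: le_trans (coord_le_enorm _ i).
by rewrite -colE mxE.
Qed.

Lemma trace_le_opnorm A : `|\tr A| <= n%:R * opnorm A.
Proof.
apply: le_trans (ler_norm_sum _ _ _) _.
apply: le_trans (ler_sum _ (fun i _ => diag_le_opnorm A i)) _.
by rewrite sumr_const card_ord mulr_natl.
Qed.

Lemma entry_le_opnorm A i j : `|A i j| <= opnorm A.
Proof.
pose z : 'cV[R]_n := delta_mx j 0.
have z1 : enorm z = 1.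
  rewrite /enorm (bigD1 j)//= mxE !eqxx big1 ?addr0 ?expr1n ?sqrtr1//.
  by move=> k kj; rewrite mxE (negbTE kj) expr0n.
have := enorm_mulmx_le A z; rewrite z1 mulr1; apply: le_trans.
apply: le_trans (coord_le_enorm _ i).
by rewrite -colE mxE.
Qed.

(* The geometric mean of the eigenvalues. Unlike the norm, it satisfies the
   exact identity ln (det_mean A) = \tr (logmx A) / n, so its oscillation is
   controlled by that of the matrix logarithm without loss of constants. *)
Definition det_mean A : R := expR (ln (\det A) / n%:R).

Section posdef.
Variable A : 'M[R]_n.
Hypotheses (n0 : (0 < n)%N) (sA : A^T = A) (pA : posdef A).

Lemma posdef_unitmx : A \in unitmx.
Proof. by rewrite unitmxE unitfE gt_eqF//; have [] := ln_det_posdef sA pA. Qed.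

Lemma enorm_le_invmx z : enorm z <= opnorm (invmx A) * enorm (A *m z).
Proof. by rewrite -{1}(mulKmx posdef_unitmx z); exact: enorm_mulmx_le. Qed.

Let spectrum : exists (d : 'I_n -> R), [/\ forall i, 0 < d i,
  forall i, exists z, enorm z = 1 /\ A *m z = d i *: z & \det A = \prod_i d i].
Proof.
have [P [d [PP AE]]] := spectral_conj sA.
exists (d 0); split.
- by move=> i; apply: (posdef_diag_gt0 (P := P)) => //; rewrite -AE.
- by move=> i; rewrite AE; exact: eigen_conj_diag.
- by rewrite AE det_conj_diag.
Qed.

Let n0R : 0 < n%:R :> R. Proof. by rewrite ltr0n. Qed.

Let ln_prod (d : 'I_n -> R) : (forall i, 0 < d i) -> ln (\prod_i d i) = \sum_i ln (d i).
Proof.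
move=> d0; apply: expR_inj; rewrite expR_sum lnK.
  by apply: eq_bigr => i _; rewrite lnK// posrE.
by rewrite posrE prodr_gt0.
Qed.

(** Every eigenvalue is at most |A| and, for the next lemma, at least 1/|A^-1|; the geometric mean
    inherits both bounds. *)
Lemma det_mean_le_opnorm : det_mean A <= opnorm A.
Proof.
have [d [d0 dz dA]] := spectrum.
have dle i : d i <= opnorm A.
  have [z [z1 zE]] := dz i; have := enorm_mulmx_le A z.
  by rewrite zE enormZ z1 !mulr1; apply: le_trans; exact: ler_norm.
have A0 : 0 < opnorm A by apply: lt_le_trans (d0 (Ordinal n0)) (dle _).
rewrite /det_mean dA ln_prod// -[leRHS]lnK ?posrE// ler_expR ler_pdivrMr//.
apply: (@le_trans _ _ (\sum_(i < n) ln (opnorm A))).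
  by apply: ler_sum => i _; rewrite ler_ln ?posrE.
by rewrite sumr_const card_ord mulr_natr.
Qed.

Lemma det_mean_ge_opnorm_inv : 1 <= det_mean A * opnorm (invmx A).
Proof.
have [d [d0 dz dA]] := spectrum.
have dge i : 1 <= opnorm (invmx A) * d i.
  have [z [z1 zE]] := dz i; have := enorm_le_invmx z.
  by rewrite zE enormZ z1 mulr1 gtr0_norm.
have A0 : 0 < opnorm (invmx A).
  by have := lt_le_trans ltr01 (dge (Ordinal n0)); rewrite pmulr_lgt0.
rewrite -ler_pdivrMr// mul1r /det_mean dA ln_prod//.
rewrite -[leLHS]lnK ?posrE ?invr_gt0// ler_expR ler_pdivlMr//.
apply: (@le_trans _ _ (\sum_(i < n) ln (opnorm (invmx A))^-1)).
  by rewrite sumr_const card_ord mulr_natr.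
apply: ler_sum => i _; rewrite ler_ln ?posrE ?invr_gt0//.
by rewrite -div1r ler_pdivrMr// mulrC.
Qed.

Variable Lambda : R.
Hypothesis condA : opnorm A * opnorm (invmx A) <= Lambda.

Lemma opnorm_le_det_mean : opnorm A <= Lambda * det_mean A.
Proof.
apply: (@le_trans _ _ (opnorm A * (det_mean A * opnorm (invmx A)))).
  by rewrite ler_peMr ?opnorm_ge0// det_mean_ge_opnorm_inv.
by rewrite mulrCA mulrC ler_wpM2r// expR_ge0.
Qed.

Lemma enorm_mulmx_det_mean_le z : enorm (A *m z) <= Lambda * (det_mean A * enorm z).
Proof.
apply: le_trans (enorm_mulmx_le _ _) _; rewrite mulrA ler_wpM2r ?enorm_ge0//.
exact: opnorm_le_det_mean.
Qed.

Lemma det_mean_enorm_le z : det_mean A * enorm z <= Lambda * enorm (A *m z).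
Proof.
apply: (@le_trans _ _ (opnorm A * (opnorm (invmx A) * enorm (A *m z)))).
  by apply: ler_pM; rewrite ?expR_ge0 ?enorm_ge0 ?det_mean_le_opnorm ?enorm_le_invmx.
by rewrite mulrA ler_wpM2r ?enorm_ge0.
Qed.

End posdef.
End operator_norm.

(** * Oscillation of the logarithm of the weight *)

(** Convexity of the power, applied to x + y = t (x/t) + (1 - t) (y/(1 - t)). The choice t = 1/2
    serves the weight bounds, t near 1 the convergence of energies. *)
Lemma powR_convex {R : realType} (r t x y : R) : 1 <= r -> 0 < t -> t < 1 ->
  0 <= x -> 0 <= y ->
  (x + y) `^ r <= t `^ (1 - r) * x `^ r + (1 - t) `^ (1 - r) * y `^ r.
Proof.
move=> r1 t0 t1 x0 y0; have t10 : 0 < 1 - t by rewrite subr_gt0.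
have H u v : 0 <= u -> 0 <= v ->
    (t * u + (1 - t) * v) `^ r <= t * u `^ r + (1 - t) * v `^ r.
  move=> u0 v0.
  by apply: (convex_powR r1 (Itv01 (ltW t0) (ltW t1))) => //=;
    rewrite ?inE/= ?in_itv/= ?u0 ?v0.
have E (c z : R) : 0 < c -> 0 <= z -> c * (z / c) `^ r = c `^ (1 - r) * z `^ r.
  move=> c0 z0; rewrite powRM ?invr_ge0 ?(ltW c0)// -powR_inv1 ?(ltW c0)// -powRrM mulN1r.
  rewrite powRD; last by apply/implyP => _; rewrite gt_eqF.
  by rewrite powRr1 ?(ltW c0)//; ring.
have := H (x / t) (y / (1 - t)); rewrite !divr_ge0 ?(ltW t0) ?(ltW t10)//.
move=> /(_ isT isT); rewrite !E//.
by rewrite mulrC divfK ?gt_eqF// mulrC divfK ?gt_eqF.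
Qed.

Lemma powR_le_deviation {R : realType} (r w W : R) : 1 <= r -> 0 <= w -> 0 < W ->
  w `^ r <= (2 `^ (r - 1) * W `^ r) * (1 + (`|w - W| / W) `^ r).
Proof.
move=> r1 w0 W0; set u := `|w - W| / W.
have u0 : 0 <= u by rewrite divr_ge0// ltW.
have r0 : 0 <= r by exact: le_trans r1.
apply: (@le_trans _ _ ((W * (1 + u)) `^ r)).
  apply: ge0_ler_powR; rewrite ?nnegrE// ?mulr_ge0 ?addr_ge0 ?(ltW W0)//.
  rewrite mulrDr mulr1 /u mulrC divfK ?gt_eqF//.
  by rewrite -lerBlDl; exact: ler_norm.
rewrite powRM ?addr_ge0 ?(ltW W0)// [X in _ <= X * _]mulrC -mulrA ler_wpM2l ?powR_ge0//.
have h0 : 0 < 2^-1 :> R by [].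
have h1 : 2^-1 < 1 :> R by rewrite invf_lt1// ltr1n.
have := powR_convex r1 h0 h1 ler01 u0.
rewrite (_ : 1 - 2^-1 = 2^-1); last by field.
rewrite (_ : 2^-1 `^ (1 - r) = 2 `^ (r - 1)); last first.
  by rewrite -powR_inv1// -powRrM mulN1r opprB.
by rewrite powR1 mulrDr.
Qed.

Section deviation.
Context d (T : measurableType d) {R : realType}.
Variable mu : {measure set T -> \bar R}.

(** If the relative deviation has r-mean at most 1, convexity gives 2^(r - 1) W^r (1 + 1), which is
    the origin of the factor 2 in front of [W]. *)
Lemma integral_powR_le_deviation (V : set T) (w : T -> R) (r W v : R) :
  measurable V -> measurable_fun V w -> (forall x, V x -> 0 <= w x) ->
  1 <= r -> 0 < W -> mu V = v%:E ->
  (\int[mu]_(x in V) ((`|w x - W| / W) `^ r)%:E <= v%:E)%E ->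
  (\int[mu]_(x in V) (w x `^ r)%:E <= ((2 * W) `^ r * v)%:E)%E.
Proof.
move=> mV mw w0 r1 W0 muV Hv.
have mu' : measurable_fun V (fun x => ((`|w x - W| / W) `^ r)%:E).
  apply/measurable_EFinP; apply: (measurableT_comp (measurable_powR r)).
  apply: measurable_funM => //; apply: measurableT_comp => //.
  exact: measurable_funB.
apply: (@le_trans _ _ (\int[mu]_(x in V) ((2 `^ (r - 1) * W `^ r)%:E *
    (1%:E + ((`|w x - W| / W) `^ r)%:E)))%E).
  apply: le_integral_nonneg => x Vx; first by rewrite lee_fin powR_ge0.
  by rewrite -EFinD -EFinM lee_fin; apply: powR_le_deviation => //; exact: w0.
rewrite ge0_integralZl//; last 3 first.
- exact: emeasurable_funD.
- by move=> x _; rewrite adde_ge0// lee_fin powR_ge0.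
- by rewrite lee_fin mulr_ge0 ?powR_ge0.
rewrite ge0_integralD//; last by move=> x _; rewrite lee_fin powR_ge0.
rewrite integral_cst// muV mul1e.
apply: (@le_trans _ _ ((2 `^ (r - 1) * W `^ r)%:E * (v%:E + v%:E))%E).
  by apply: lee_wpmul2l; rewrite ?lee_fin ?mulr_ge0 ?powR_ge0//; exact: leeD.
rewrite -EFinD -EFinM lee_fin powRM ?(ltW W0)//.
rewrite (_ : 2 `^ r = 2 `^ (r - 1) * 2); last first.
  rewrite -[X in _ = _ * X]powRr1// -powRD ?subrK//.
  by apply/implyP => _; rewrite pnatr_eq0.
by rewrite le_eqVlt; apply/orP; left; apply/eqP; ring.
Qed.

End deviation.

(** * Measurability of functions of matrices *)

Section measurable_matrices.
Context d (T : measurableType d) {R : realType} (n : nat).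
Implicit Types (D : set T) (M N : T -> 'M[R]_n).

Definition measurable_entries D M :=
  forall i j, measurable_fun D (fun x => M x i j).

Lemma measurable_mulmx D M N : measurable_entries D M -> measurable_entries D N ->
  measurable_entries D (fun x => M x *m N x).
Proof.
move=> mM mN i j; rewrite (_ : (fun x => _) = fun x => \sum_k M x i k * N x k j); last first.
  by apply/funext => x; rewrite mxE.
by apply: measurable_sum => k; exact: measurable_funM.
Qed.

Lemma measurable_expmx D M (k : nat) : measurable_entries D M ->
  measurable_entries D (fun x => M x ^+ k).
Proof.
move=> mM; elim: k => [|k IH] i j.
  by rewrite (_ : (fun x => _) = fun=> (1%:M : 'M[R]_n) i j) //.
rewrite (_ : (fun x => _) = fun x => (M x *m M x ^+ k) i j); last first.
  by apply/funext => x; rewrite exprS.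
exact: measurable_mulmx.
Qed.

Lemma measurable_mxtrace D M : measurable_entries D M ->
  measurable_fun D (fun x => \tr (M x)).
Proof. by move=> mM; apply: measurable_sum => i; exact: mM. Qed.

Lemma measurable_det D M : measurable_entries D M ->
  measurable_fun D (fun x => \det (M x)).
Proof.
move=> mM; apply: measurable_sum => s; apply: measurable_funM => //.
by apply: measurable_prod => i _; exact: mM.
Qed.

Lemma measurable_det_mean D M : measurable_entries D M ->
  measurable_fun D (fun x => det_mean (M x)).
Proof.
move=> mM; apply: (measurableT_comp (@measurable_expR R)).
apply: measurable_funM => //; apply: (measurableT_comp (@measurable_ln R)).
exact: measurable_det.
Qed.

Lemma measurable_logmx D M : (0 < n)%N -> measurable D ->
  (forall x, D x -> (M x)^T = M x) -> (forall x, D x -> posdef (M x)) ->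
  measurable_entries D M -> measurable_entries D (fun x => logmx (M x)).
Proof.
move=> n0 mD sM pM mM i j.
have mtr := measurable_mxtrace mM.
(* The inverse of the trace is written as the power -1, a measurable function; the two agree because
   the trace is nonnegative. *)
pose S x k : 'M[R]_n := (1%:M - (\tr (M x)) `^ (-1) *: M x) ^+ k.+1.
pose h (K : nat) x := ln (\tr (M x)) * (1%:M : 'M[R]_n) i j -
  \sum_(k < K) (k.+1%:R)^-1 * S x k i j.
apply: (measurable_fun_cvg (h := h)).
- move=> K; apply: measurable_funB.
    by apply: measurable_funM => //; exact: (measurableT_comp (@measurable_ln R)).
  apply: measurable_sum => k; apply: measurable_funM => //.
  apply: measurable_expmx => i' j'.
  rewrite (_ : (fun x => _) = fun x => (1%:M : 'M[R]_n) i' j' - \tr (M x) `^ (-1) * M x i' j').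
    apply: measurable_funB => //; apply: measurable_funM => //.
    exact: (measurableT_comp (measurable_powR _)).
  by apply/funext => x; rewrite !mxE.
- move=> x Dx; have tr0 : 0 <= \tr (M x).
    apply: sumr_ge0 => l _; pose z : 'cV[R]_n := delta_mx l 0.
    have z0 : z != 0 by apply/eqP => /matrixP/(_ l 0); rewrite !mxE !eqxx => /eqP; rewrite oner_eq0.
    have := pM x Dx z z0; rewrite -colE /z trmx_delta -rowE !mxE.
    exact: ltW.
  apply: cvg_trans (logmx_series (sM _ Dx) (pM _ Dx) (i := i) (j := j)).
  apply: near_eq_cvg; apply: nearW => K.
  rewrite /h /S -powR_inv1// mxE [in LHS]mxE [X in _ + X]mxE summxE; congr (_ - _).
  by apply: eq_bigr => k _; rewrite mxE.
Qed.

End measurable_matrices.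

(** * From the oscillation of the matrix logarithm to dual bounds for the scalar weight *)

Section weight.
Context {R : realType} {n : nat}.
Local Notation cV := 'cV[R]_n.
Local Notation leb := (@lebesgue_cV R n).
Implicit Types (x y : cV) (r : R) (B D : set cV) (g w : cV -> R) (M L : cV -> 'M[R]_n).

(** Uses completeness of the measure. Positive definiteness holds only almost everywhere, and
    [logmx] is arbitrary on the exceptional set. *)
Lemma measurable_fun_off_null D g : measurable D -> leb (~` D) = 0%E ->
  measurable_fun D g -> measurable_fun setT g.
Proof.
move=> mD D0 mg _ A mA; rewrite setTI -(setTI (g @^-1` A)) -(setUv D) setIUl.
apply: measurableU; first exact: mg.
have mDC := measurableC mD.
by apply: leb_complete; exists (~` D); split; [exact: mDC|exact: D0|move=> y []].
Qed.

Lemma measurable_logmx_weight M : (0 < n)%N -> matrix_weight M ->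
  measurable_entries setT (fun x => logmx (M x)).
Proof.
move=> n0 [mM sM [N [mN N0 pM]]] i j.
apply: (@measurable_fun_off_null (~` N)); first exact: measurableC.
  by rewrite setCK.
apply: (measurable_logmx n0 (measurableC mN) (fun x _ => sM x)).
- by move=> x; apply: contra_notP => /pM.
- by move=> i' j'; exact: measurable_funTS (mM i' j').
Qed.

(** [C] is built from integrals that could be default values. Finite deviation bounds every entry of
    L - C in L^1, and [C] is constant, so the entries of [L] are integrable after all; only then
    does the trace commute with the mean. *)
Lemma mean_le_opnorm L B v : (0 < n)%N -> measurable B -> leb B = v%:E -> 0 < v ->
  measurable_entries setT L ->
  (emean B (fun x => (opnorm (L x - mxmean B L))%:E) < +oo)%E ->
  leb.-integrable B (fun x => (\tr (L x) / n%:R)%:E) /\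
  mean B (fun x => \tr (L x) / n%:R) = \tr (mxmean B L) / n%:R.
Proof.
move=> n0 mB muB v0 mL; set C := mxmean B L => fin.
have fin' : (\int[leb]_(x in B) (opnorm (L x - C))%:E < +oo)%E.
  move: fin; rewrite /emean muB /=; apply: contraPP => /negP; rewrite -leNgt leye_eq => /eqP->.
  by rewrite gt0_muley ?lte_fin ?invr_gt0// ltxx.
have mL' i j : measurable_fun B (fun x => L x i j) by exact: measurable_funTS.
have intC (c : R) : leb.-integrable B (cst c%:E).
  apply/integrableP; split; first exact: measurable_cst.
  by rewrite integral_cst//= muB -EFinM ltry.
have iL i j : leb.-integrable B (fun x => (L x i j)%:E).
  have iLC : leb.-integrable B (fun x => (L x i j - C i j)%:E).
    apply/integrableP; split.
      by apply/measurable_EFinP; apply: measurable_funB.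
    apply: le_lt_trans fin'; apply: le_integral_nonneg => x _ //.
    rewrite lee_fin; have := entry_le_opnorm (L x - C) i j.
    by rewrite !mxE.
  have := integrableD mB iLC (intC (C i j)).
  by apply: eq_integrable => // x _; rewrite /= -EFinD subrK.
have itr : leb.-integrable B (fun x => (\sum_i L x i i)%:E).
  rewrite (_ : (fun x => _) = fun x => (\sum_i (L x i i)%:E)%E); last first.
    by apply/funext => x; rewrite sumEFin.
  by apply: integrable_sum => // i _; exact: iL.
split.
  have := integrableZl mB (n%:R^-1) itr.
  by apply: eq_integrable => // x _; rewrite /= -EFinM mulrC.
rewrite /mean muB/=.
have -> : \int[leb]_(x in B) (\tr (L x) / n%:R) = n%:R^-1 * \int[leb]_(x in B) (\sum_i L x i i).
  rewrite -RintegralZl//.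
  by apply: eq_Rintegral => x _; rewrite mulrC.
rewrite mulrCA [RHS]mulrC; congr (_ * _).
rewrite /mxtrace; under [in RHS]eq_bigr do rewrite mxE /mean muB/=.
rewrite -mulr_sumr; congr (_ * _).
rewrite /Rintegral; under eq_integral do rewrite -sumEFin.
rewrite (integral_sum mB) => [|i]; last exact: iL.
apply: EFin_inj; rewrite fineK; last first.
  by apply/sum_fin_numP => i _ _; exact: integrable_fin_num.
rewrite -sumEFin; apply: eq_bigr => i _; rewrite fineK//.
exact: integrable_fin_num.
Qed.

(** Once trace and mean commute, |tr X| / n <= |X| gives the comparison with constant 1. *)
Lemma mean_deviation_le_opnorm L B v : (0 < n)%N -> measurable B -> leb B = v%:E ->
  0 < v -> measurable_entries setT L ->
  (emean B (fun x => (opnorm (L x - mxmean B L))%:E) < +oo)%E ->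
  (emean B (fun x => `|\tr (L x) / n%:R - mean B (fun x => \tr (L x) / n%:R)|%:E)
    <= emean B (fun x => (opnorm (L x - mxmean B L))%:E))%E.
Proof.
move=> n0 mB muB v0 mL fin; have [_ ->] := mean_le_opnorm n0 mB muB v0 mL fin.
rewrite /emean muB/= lee_wpmul2l//; first by rewrite lee_fin invr_ge0 ltW.
apply: le_integral_nonneg => x _; first by rewrite lee_fin.
rewrite lee_fin -mulrBl -raddfB normrM normfV (ger0_norm (ler0n _ n)).
rewrite ler_pdivrMr ?ltr0n// mulrC; exact: trace_le_opnorm.
Qed.

Lemma eq_ae_integrable B (g h : cV -> R) : measurable B ->
  measurable_fun setT g -> measurable_fun setT h -> {ae leb, forall x, g x = h x} ->
  leb.-integrable B (EFin \o g) -> leb.-integrable B (EFin \o h).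
Proof.
move=> mB mg mh gh /integrableP[_ goo].
have mg' := measurable_funTS mg (D := B); have mh' := measurable_funTS mh (D := B).
apply/integrableP; split; first exact/measurable_EFinP.
rewrite (ae_eq_integral (fun x => `|(g x)%:E|%E)) => [//|//| | |].
- by apply/measurable_EFinP; apply: measurableT_comp mh'.
- by apply/measurable_EFinP; apply: measurableT_comp mg'.
- by apply: filterS gh => x -> _.
Qed.

Lemma eq_ae_emean_deviation B (g h : cV -> R) : measurable B ->
  measurable_fun setT g -> measurable_fun setT h -> {ae leb, forall x, g x = h x} ->
  emean B (fun x => `|g x - mean B g|%:E) = emean B (fun x => `|h x - mean B h|%:E).
Proof.
move=> mB mg mh gh.
have -> : mean B g = mean B h.
  rewrite /mean; congr (_ * fine _); apply: ae_eq_integral; [exact: mB|..].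
  - by apply/measurable_EFinP; exact: measurable_funTS mg.
  - by apply/measurable_EFinP; exact: measurable_funTS mh.
  - by apply: filterS gh => x -> _.
have meas (k : cV -> R) : measurable_fun setT k ->
    measurable_fun B (fun x => `|k x - mean B h|%:E).
  move=> mk; apply/measurable_EFinP.
  have mkh := measurable_funB (measurable_funTS mk (D := B)) (measurable_cst (mean B h)).
  by apply: measurableT_comp mkh.
rewrite /emean; congr (_ * _)%E; apply: ae_eq_integral; [exact: mB|..].
- exact: meas mg.
- exact: meas mh.
- by apply: filterS gh => x -> _.
Qed.

(** ln (det_mean (M x)) is tr (logmx (M x)) / n almost everywhere. Passing to the inverse weight
    changes the sign of its logarithm, so the oscillation is the same and the logarithmic mean is
    inverted: a single number will normalise both the weight and its inverse. *)
Lemma bmo_ln_det_mean M D B : (0 < n)%N -> matrix_weight M -> B `<=` D ->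
  (mxbmo D (fun x => logmx (M x)) < +oo)%E ->
  [/\ (bmo B (fun x => ln (det_mean (M x))) <= mxbmo D (fun x => logmx (M x)))%E,
      (bmo B (fun x => ln (det_mean (M x))^-1%R) <= mxbmo D (fun x => logmx (M x)))%E &
      is_eball B -> logmean B (fun x => (det_mean (M x))^-1) =
        (logmean B (fun x => det_mean (M x)))^-1].
Proof.
move=> n0 hM BD fin; set L := fun x => logmx (M x).
have mL := measurable_logmx_weight n0 hM; have [mM sM pM] := hM.
pose g x := \tr (L x) / n%:R.
pose h x := ln (det_mean (M x)).
have mg : measurable_fun setT g.
  exact: (measurable_funM (measurable_mxtrace mL) (measurable_cst _)).
have mh : measurable_fun setT h.
  apply: (measurableT_comp (@measurable_ln R)).
  exact: measurable_det_mean.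
have gh : {ae leb, forall x, g x = h x}.
  apply: filterS pM => x px; rewrite /g /h /det_mean expRK.
  by have [_ ->] := ln_det_posdef (sM x) px.
have E (B' : set cV) : is_eball B' -> B' `<=` B ->
    [/\ (emean B' (fun x => `|h x - mean B' h|%:E) <= mxbmo D L)%E &
    mean B' (fun x => ln (det_mean (M x))^-1) = - mean B' h].
  move=> [x [r [r0 ->]]] B'B; set B1 := eball x r.
  have mB1 : measurable B1 by exact: measurable_eball.
  have muB1 : leb B1 = (vol n r)%:E by exact: leb_eball.
  have v0 := @vol_gt0 R n r r0.
  have le1 : (emean B1 (fun x => (opnorm (L x - mxmean B1 L))%:E) <= mxbmo D L)%E.
    apply: ereal_sup_ubound; exists B1 => //; split; first by exists x, r.
    exact: subset_trans BD.
  have fin1 := le_lt_trans le1 fin.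
  have [ig _] := mean_le_opnorm n0 mB1 muB1 v0 mL fin1.
  split.
    rewrite -(eq_ae_emean_deviation mB1 mg mh gh).
    exact: le_trans (mean_deviation_le_opnorm n0 mB1 muB1 v0 mL fin1) le1.
  have ih : leb.-integrable B1 (EFin \o h).
    exact: (eq_ae_integrable mB1 mg mh gh ig).
  rewrite /mean -mulrN; congr (_ * _).
  rewrite -mulN1r -RintegralZl//.
  by apply: eq_Rintegral => y _; rewrite lnV ?posrE ?expR_gt0// mulN1r.
split.
- by apply: ge_ereal_sup => _ [B' [bB' B'B] <-]; have [le1 _] := E _ bB' B'B.
- apply: ge_ereal_sup => _ [B' [bB' B'B] <-]; have [le1 E1] := E _ bB' B'B.
  rewrite E1;  apply: le_trans le1; rewrite le_eqVlt; apply/orP; left; apply/eqP.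
  rewrite /emean; congr (_ * _)%E; apply: eq_integral => y _.
  by rewrite lnV ?posrE ?expR_gt0// -opprD normrN.
- by move=> bB; have [_ E1] := E _ bB (@subset_refl _ B); rewrite /logmean E1 expRN.
Qed.

(** The bound by [kappa] admits the John-Nirenberg estimate at exponent [sg]; the bound by 1/cb
    makes its right-hand side at most 1, as [integral_powR_le_deviation] requires. *)
Lemma weight_power_integral (kappa cb : R) w (sg : R) x r : 0 < cb ->
  log_bmo_constants n kappa cb -> measurable_fun setT w -> (forall x, 0 < w x) ->
  1 <= sg -> 0 < r ->
  (bmo (eball x r) (fun x => ln (w x)) <= (Num.min kappa cb^-1 / sg)%:E)%E ->
  (\int[leb]_(y in eball x r) (w y `^ sg)%:E <=
    ((2 * logmean (eball x r) w) `^ sg * vol n r)%:E)%E.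
Proof.
move=> cb0 [_ H] mw w0 sg1 r0 hb.
have sg0 : 0 < sg by exact: lt_le_trans sg1.
have ww : weight w by split => //; exact: aeW.
have bx : is_eball (eball x r) by exists x, r.
have := H w ww sg _ sg1 bx.
set b := bmo _ _ in hb *; set W := logmean _ _ => {}H.
have bk : (b <= (kappa / sg)%:E)%E.
  by apply: le_trans hb _; rewrite lee_fin ler_wpM2r ?invr_ge0 ?(ltW sg0)// ge_min lexx.
have W0 : 0 < W by exact: expR_gt0.
apply: integral_powR_le_deviation => //.
- exact: measurable_eball.
- exact: measurable_funTS mw.
- by move=> y _; exact: ltW.
- exact: leb_eball.
have le1 : ((cb * sg)%:E * b <= 1)%E.
  apply: (@le_trans _ _ ((cb * sg)%:E * (cb^-1 / sg)%:E)%E).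
    apply: lee_wpmul2l; first by rewrite lee_fin mulr_ge0 ?(ltW cb0) ?(ltW sg0).
    apply: le_trans hb _.
    by rewrite lee_fin ler_wpM2r ?invr_ge0 ?(ltW sg0)// ge_min lexx orbT.
  rewrite -EFinM lee_fin le_eqVlt; apply/orP; left; apply/eqP.
  by field; rewrite !gt_eqF.
have := le_trans (H bk) le1.
have -> : (fun y => ((`|w y - W| / `|W|) `^ sg)%:E) = fun y => ((`|w y - W| / W) `^ sg)%:E.
  by apply/funext => y; rewrite (gtr0_norm W0).
rewrite /emean leb_eball/=; set I := (\int[leb]_(y in _) _)%E => le2.
have I0 : (0 <= I)%E by apply: integral_ge0 => y _; rewrite lee_fin powR_ge0.
have v0 := @vol_gt0 R n r r0.
(* An infinite integral would have an infinite root, contrary to the bound by 1. *)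
move: le2; case: I I0 => [c| |]//=; last first.
  move=> _; rewrite gt0_muley ?lte_fin ?invr_gt0//; by rewrite poweRyr// invr_neq0// gt_eqF.
rewrite !lee_fin => c0; set u := (_^-1 * c).
have u0 : 0 <= u by rewrite mulr_ge0 ?invr_ge0 ?(ltW v0).
move=> le2; have : (u `^ sg^-1) `^ sg <= 1 `^ sg.
  by apply: ge0_ler_powR; rewrite ?nnegrE ?powR_ge0 ?(ltW sg0).
rewrite -powRrM mulVf ?gt_eqF// powRr1// powR1 /u mulrC ler_pdivrMr// mul1r.
by [].
Qed.

Lemma det_mean_dual_ball_bounds (kappa cb m p p' q q' : R) M D x r :
  (0 < n)%N -> 0 < kappa -> 0 < cb -> log_bmo_constants n kappa cb -> matrix_weight M ->
  (mxbmo D (fun x => logmx (M x)) <= (Num.min kappa cb^-1 * m)%:E)%E ->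
  1 <= p -> 1 <= p' -> 1 <= q -> 1 <= q' ->
  m <= p^-1 -> m <= p'^-1 -> m <= q^-1 -> m <= q'^-1 ->
  0 < r -> eball x r `<=` D ->
  dual_ball_bounds (fun y => det_mean (M y)) p p' q q' x r.
Proof.
move=> n0 k0 cb0 H hM hb p1 p'1 q1 q'1 mp mp' mq mq' r0 xD.
have [b1 b2 b3] := bmo_ln_det_mean n0 hM xD (le_lt_trans hb (ltry _)).
have [mM sM pM] := hM.
have mw := measurable_det_mean mM.
have w0 y : 0 < det_mean (M y) by exact: expR_gt0.
have mw' : measurable_fun setT (fun y => (det_mean (M y))^-1).
  rewrite (_ : (fun y => _) = fun y => det_mean (M y) `^ (-1)).
    exact: (measurableT_comp (measurable_powR _)).
  by apply/funext => y; rewrite powR_inv1// ltW.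
have w'0 y : 0 < (det_mean (M y))^-1 by rewrite invr_gt0.
have min0 : 0 <= Num.min kappa cb^-1 by rewrite le_min (ltW k0) invr_ge0 ltW.
have hm (sg : R) : m <= sg^-1 ->
    (mxbmo D (fun x => logmx (M x)) <= (Num.min kappa cb^-1 / sg)%:E)%E.
  by move=> ms; apply: le_trans hb _; rewrite lee_fin ler_wpM2l.
pose W := logmean (eball x r) (fun y => det_mean (M y)).
have W0 : 0 < W by exact: expR_gt0.
exists W; split => //.
- exact: (weight_power_integral cb0 H mw w0 p1 r0 (le_trans b1 (hm _ mp))).
- exact: (weight_power_integral cb0 H mw w0 q1 r0 (le_trans b1 (hm _ mq))).
- rewrite -b3; last by exists x, r.
  exact: (weight_power_integral cb0 H mw' w'0 p'1 r0 (le_trans b2 (hm _ mp'))).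
- rewrite -b3; last by exists x, r.
  exact: (weight_power_integral cb0 H mw' w'0 q'1 r0 (le_trans b2 (hm _ mq'))).
Qed.

End weight.

(** * Ball averages of test functions and weak gradients *)

Lemma mean_dist_le d (T : measurableType d) (R : realType)
    (mu : {measure set T -> \bar R}) (V : set T) (v c : R) (h k : T -> R) :
  measurable V -> mu V = v%:E -> 0 < v ->
  mu.-integrable V (EFin \o h) -> mu.-integrable V (EFin \o k) ->
  (forall y, V y -> `|h y - k y| <= c) ->
  `|v^-1 * \int[mu]_(y in V) h y - v^-1 * \int[mu]_(y in V) k y| <= c.
Proof.
move=> mV muV v0 ih ik hk.
have ihk : mu.-integrable V (EFin \o (fun y => h y - k y)) by have := integrableB mV ih ik.
rewrite -mulrBr -RintegralB// normrM gtr0_norm ?invr_gt0//.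
rewrite -ler_pdivlMl ?invr_gt0// invrK.
have muVv : fine (mu V) = v by rewrite muV.
apply: le_trans (le_normr_Rintegral mV ihk) _.
rewrite -muVv mulrC -Rintegral_cst//; apply: le_Rintegral => //.
  exact: integrable_norm.
apply/integrableP; split; first exact: measurable_cst.
by rewrite integral_cst//= muV -EFinM ltry.
Qed.

Section uniform_continuity.
Context {R : realType} {n : nat}.
Local Notation cV := 'cV[R]_n.
Implicit Types (x y z : cV) (K : set cV) (phi : cV -> R).

Lemma vanishing_off_compact_bounded K phi : compact K -> continuous phi ->
  (forall x, ~ K x -> phi x = 0) -> exists2 C, 0 <= C & forall x, `|phi x| <= C.
Proof.
move=> /compact_near_coveringP cK cphi phi0.
have [M [Mr HM]] : \forall M \near +oo, K `<=` [set x | `|phi x| <= M].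
  apply: cK => x Kx.
  have [d d0 H] := (continuous_eballP phi x).1 (cphi x) 1 ltr01.
  exists (eball x d, [set M | `|phi x| + 1 < M]).
    split=> /=; first by apply/nbhs_eballP; exists d.
    by exists (`|phi x| + 1); split => //; exact: num_real.
  move=> [z M] /= [/H zx /ltW xM]; apply: le_trans xM.
  by rewrite -lerBlDl; apply: le_trans (lerB_dist _ _) (ltW zx).
exists (Num.max M 0 + 1); first by rewrite addr_ge0// le_max lexx orbT.
move=> x; have [Kx|/phi0->] := pselect (K x); last first.
  by rewrite normr0 addr_ge0// le_max lexx orbT.
apply: HM Kx; apply: le_lt_trans (_ : _ <= Num.max M 0) _; first by rewrite le_max lexx.
by rewrite ltrDl.
Qed.

(** Compactness gives one [d] for all [x] in [K]. When only [y] lies in [K] the roles are exchanged,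
    and off [K] both values vanish. *)
Lemma vanishing_off_compact_uniform K phi : compact K -> continuous phi ->
  (forall x, ~ K x -> phi x = 0) -> forall c, 0 < c ->
  exists2 d, 0 < d & forall x y, enorm (y - x) < d -> `|phi y - phi x| < c.
Proof.
move=> /compact_near_coveringP cK cphi phi0 c c0.
have : \forall d \near 0^'+, K `<=` [set x | forall y, enorm (y - x) < d -> `|phi y - phi x| < c].
  apply: cK => x Kx.
  have c20 : 0 < c / 2 by rewrite divr_gt0.
  have [d d0 H] := (continuous_eballP phi x).1 (cphi x) _ c20.
  exists (eball x (d / 2), [set e | e < d / 2]).
    split=> /=; first by apply/nbhs_eballP; exists (d / 2) => //; rewrite divr_gt0.
    by apply: nbhs_right_lt; rewrite divr_gt0.
  move=> [z e] /= [zx ed] y yz.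
  have d2 : d / 2 <= d by lra.
  have Hz := H z (lt_le_trans zx d2).
  have yx : enorm (y - x) < d.
    apply: le_lt_trans (enorm_dist _ z _) _; rewrite [ltRHS](splitr d).
    by apply: ltrD => //; exact: lt_trans ed.
  have -> : phi y - phi z = (phi y - phi x) - (phi z - phi x) by ring.
  by apply: le_lt_trans (ler_normB _ _) _; rewrite [ltRHS](splitr c) ltrD// H.
move=> near_d; near (0:R)^'+ => d; exists d => // x y xy.
have Hd : K `<=` [set x | forall y, enorm (y - x) < d -> `|phi y - phi x| < c] by near: d.
have [Kx|/phi0 x0] := pselect (K x); first exact: Hd.
have [Ky|/phi0 y0] := pselect (K y); last by rewrite x0 y0 subrr normr0.
by rewrite distrC; apply: Hd => //; rewrite enormBC.
Unshelve. all: by end_near. Qed.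

End uniform_continuity.

Section translation.
Context {R : realType} {n : nat}.
Local Notation cV := 'cV[R]_n.
Local Notation leb := (@lebesgue_cV R n).
Implicit Types (x y z u v : cV) (f phi : cV -> R) (e : R).

Lemma integral_shift v (f : cV -> \bar R) : measurable_fun setT f ->
  (\int[leb]_x f (x + v)%R = \int[leb]_x f x)%E.
Proof.
move=> mf; rewrite integralE [RHS]integralE; congr (_ - _)%E.
  rewrite -(ge0_integral_shift v (f := (f^\+)%E) (measurable_funepos mf))//.
  by apply: eq_integral => x _; rewrite ?funeposE ?funenegE.
rewrite -(ge0_integral_shift v (f := (f^\-)%E) (measurable_funeneg mf))//.
by apply: eq_integral => x _; rewrite ?funeposE ?funenegE.
Qed.

(** On a fixed domain of integration the dependence on [x] sits in [phi] alone, so limits and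
    difference quotients pass under the integral. *)
Lemma ball_average_shift e phi x : measurable_fun setT phi ->
  ball_average e phi x = (vol n e)^-1 * \int[leb]_(u in eball 0 e) phi (u + x).
Proof.
move=> mphi; rewrite /ball_average /average; congr (_ * _).
rewrite Rintegral_mkcond [RHS]Rintegral_mkcond /Rintegral; congr fine.
rewrite -(integral_shift x).
  apply: eq_integral => u _; congr EFin; rewrite !patchE.
  by congr (if _ then _ else _); apply/idP/idP; rewrite !inE /eball/= subr0 addrK.
apply/measurable_EFinP; apply: (measurable_restrictT _ (measurable_eball x e)).1.
exact: measurable_funTS.
Qed.

Lemma bounded_integrable_eball phi C x e : measurable_fun setT phi ->
  (forall x, `|phi x| <= C) -> leb.-integrable (eball x e) (EFin \o phi).
Proof.
move=> mphi phiC; apply: measurable_bounded_integrable.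
- exact: measurable_eball.
- by rewrite [X in (X < _)%E](_ : _ = (vol n e)%:E); [exact: ltry|exact: leb_eball].
- exact: measurable_funTS mphi.
- by exists C; split; [exact: num_real|move=> M CM y _; exact: le_trans (ltW CM)].
Qed.

Lemma measurable_fun_shift phi x : measurable_fun setT phi ->
  measurable_fun setT (fun u => phi (u + x)).
Proof. by move=> mphi; exact: (measurableT_comp mphi (measurable_shift x)). Qed.

Lemma ball_average_continuous K phi e : 0 < e -> compact K -> continuous phi ->
  (forall x, ~ K x -> phi x = 0) -> continuous (ball_average e phi).
Proof.
move=> e0 cK cphi phi0 x; apply/continuous_eballP => c c0.
have c20 : 0 < c / 2 by rewrite divr_gt0.
have [d d0 H] := vanishing_off_compact_uniform cK cphi phi0 c20.
have [C C0 HC] := vanishing_off_compact_bounded cK cphi phi0.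
have mphi := continuous_measurable_cV cphi.
exists d => // y yx; rewrite !ball_average_shift//.
apply: le_lt_trans (_ : _ <= c / 2) _; last by lra.
apply: (mean_dist_le (@measurable_eball R n 0 e) (leb_eball 0 e) (vol_gt0 e0)).
- exact: (bounded_integrable_eball _ _ (measurable_fun_shift y mphi) (fun u => HC (u + y))).
- exact: (bounded_integrable_eball _ _ (measurable_fun_shift x mphi) (fun u => HC (u + x))).
- move=> u _; apply/ltW/H.
  by rewrite opprD addrACA subrr add0r.
Qed.

End translation.

Section derivatives.
Context {R : realType} {n : nat}.
Local Notation cV := 'cV[R]_n.
Local Notation leb := (@lebesgue_cV R n).
Implicit Types (x y z u v : cV) (f phi : cV -> R) (e : R) (K : set cV).

Lemma is_derive_along phi v y (t : R) : derivable phi (y + t *: v) v ->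
  is_derive t 1 (fun t => phi (y + t *: v)) ('D_v phi (y + t *: v)).
Proof.
move=> dphi.
have E : (fun h : R => h^-1 *: (((fun t => phi (y + t *: v)) \o shift t) (h *: 1) -
      phi (y + t *: v))) =
    (fun h : R => h^-1 *: ((phi \o shift (y + t *: v)) (h *: v) - phi (y + t *: v))).
  apply/funext => h /=; congr (_ *: (phi _ - _)).
  by rewrite [h *: 1]mulr1 scalerDl addrCA.
by split; rewrite /derivable /derive E.
Qed.

Lemma directional_mean_value phi v y (h : R) : (forall x, derivable phi x v) ->
  exists2 c, `|c| <= `|h| & phi (y + h *: v) - phi y = h * 'D_v phi (y + c *: v).
Proof.
move=> dphi; pose g (t : R) := phi (y + t *: v).
have dg (t : R) : is_derive t 1 g ('D_v phi (y + t *: v)).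
  exact: is_derive_along.
have cg (A : set R) : {within A, continuous g}.
  apply: continuous_subspaceT => t.
  by apply/differentiable_continuous/derivable1_diffP; have [] := dg t.
have g0 : g 0 = phi y by rewrite /g scale0r addr0.
have [h0|h0] := leP 0 h.
  have [c] := MVT_segment h0 (fun t _ => dg t) (cg _).
  rewrite in_itv/= => /andP[c0 ch]; rewrite g0 subr0 => gE.
  by exists c; rewrite ?ger0_norm// mulrC.
have [c] := MVT_segment (ltW h0) (fun t _ => dg t) (cg _).
rewrite in_itv/= => /andP[hc c0]; rewrite g0 sub0r => gE.
exists c; first by rewrite !ler0_norm ?lerN2 ?(ltW h0).
by rewrite mulrC -opprB gE mulrN opprK.
Qed.

Lemma partial_vanishing K phi i : closed K -> (forall x, ~ K x -> phi x = 0) ->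
  forall x, ~ K x -> partial i phi x = 0.
Proof.
move=> cK phi0 x Kx.
have oK : open (~` K) by exact: closed_openC.
have Nx : nbhs x (~` K) by apply: open_nbhs_nbhs.
rewrite /partial (@near_eq_derive _ _ _ _ (cst 0))//.
  exact: derive_cst.
by apply: filterS Nx => y /phi0.
Qed.

(** By the mean value theorem the difference quotient of [phi] at u + x is a value of the partial
    derivative at distance at most |h|, uniformly close to its value at u + x; a uniform bound
    survives averaging. *)
Lemma is_derive_ball_average K phi e i x : 0 < e -> compact K ->
  (forall x, ~ K x -> phi x = 0) -> continuous phi ->
  (forall x, derivable phi x (delta_mx i 0)) -> continuous (partial i phi) ->
  is_derive x (delta_mx i 0) (ball_average e phi) (ball_average e (partial i phi) x).
Proof.
move=> e0 cK phi0 cphi dphi cdphi; set v : cV := delta_mx i 0.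
have clK : closed K by apply: compact_closed => //; exact: norm_hausdorff.
have dphi0 := partial_vanishing i clK phi0.
have [C C0 HC] := vanishing_off_compact_bounded cK cphi phi0.
have [C' C'0 HC'] := vanishing_off_compact_bounded cK cdphi dphi0.
have mphi := continuous_measurable_cV cphi.
have mdphi := continuous_measurable_cV cdphi.
have v1 : enorm v = 1.
  rewrite /enorm (bigD1 i)//= mxE !eqxx big1 ?addr0 ?expr1n ?sqrtr1//.
  by move=> k ki; rewrite mxE (negbTE ki) expr0n.
suff H : (fun h : R => h^-1 *: ((ball_average e phi \o shift x) (h *: v) - ball_average e phi x))
    @ 0^' --> ball_average e (partial i phi) x.
  split; first by apply/cvg_ex; exists (ball_average e (partial i phi) x).
  exact: cvg_lim H.
apply/cvgrPdist_le => c c0.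
have [d d0 Hd] := vanishing_off_compact_uniform cK cdphi dphi0 c0.
near=> h.
have h0 : h != 0 by near: h; exact: nbhs_dnbhs_neq.
have hd : `|h| < d by near: h; apply: dnbhs0_lt.
rewrite /= distrC !ball_average_shift//.
have iphi z : leb.-integrable (eball 0 e) (EFin \o (fun u => phi (u + z))).
  exact: (bounded_integrable_eball _ _ (measurable_fun_shift z mphi) (fun u => HC (u + z))).
have -> : h^-1 *: ((vol n e)^-1 * \int[leb]_(u in eball 0 e) phi (u + (h *: v + x)) -
      (vol n e)^-1 * \int[leb]_(u in eball 0 e) phi (u + x)) =
    (vol n e)^-1 * \int[leb]_(u in eball 0 e) (h^-1 * (phi (u + (h *: v + x)) - phi (u + x))).
  rewrite RintegralZl//=; last 2 first.
  - exact: measurable_eball.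
  - by have := integrableB (measurable_eball 0 e) (iphi (h *: v + x)) (iphi x).
  rewrite RintegralB//; last exact: measurable_eball.
  by rewrite -mulrBr mulrCA.
apply: (mean_dist_le (@measurable_eball R n 0 e) (leb_eball 0 e) (vol_gt0 e0)).
- have := integrableZl (measurable_eball 0 e) h^-1
    (integrableB (measurable_eball 0 e) (iphi (h *: v + x)) (iphi x)).
  by [].
- exact: (bounded_integrable_eball _ _ (measurable_fun_shift x mdphi) (fun u => HC' (u + x))).
- move=> u _.
  have [k kh kE] := directional_mean_value (u + x) h dphi.
  rewrite [u + (_ + x)]addrCA addrC kE mulrA mulVf// mul1r.
  apply/ltW/Hd; rewrite addrC addKr enormZ v1 mulr1.
  exact: le_lt_trans hd.
Unshelve. all: by end_near. Qed.

Lemma Ck_continuous k phi : Ck k phi -> continuous phi.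
Proof. by case: k => [|k []]. Qed.

Lemma Ck_ball_average k K phi e : 0 < e -> compact K ->
  (forall x, ~ K x -> phi x = 0) -> Ck k phi -> Ck k (ball_average e phi).
Proof.
move=> e0 cK; elim: k phi => [|k IH] phi phi0 /=.
  by move=> cphi; apply: (ball_average_continuous e0 cK).
move=> [cphi Hphi]; split; first exact: (ball_average_continuous e0 cK).
move=> i; have [dphi ckphi] := Hphi i.
have D x := is_derive_ball_average x e0 cK phi0 cphi dphi (Ck_continuous ckphi).
split=> [x|]; first by have [] := D x.
have -> : partial i (ball_average e phi) = ball_average e (partial i phi).
  by apply/funext => x; rewrite /partial; have [_ ->] := D x.
apply: IH => //; apply: partial_vanishing => //.
by apply: compact_closed => //; exact: norm_hausdorff.
Qed.

End derivatives.

(** * Lebesgue norms as integrals *)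

Section Lebesgue_spaces.
Context {R : realType} {n : nat}.
Local Notation cV := 'cV[R]_n.
Local Notation leb := (@lebesgue_cV R n).
Implicit Types (x y z : cV) (D E : set cV) (f g : cV -> R) (p c : R).

Lemma poweR_Lpnorm D p f : 0 < p ->
  (Lpnorm D p%:E f `^ p = \int[leb]_(x in D) (`|f x| `^ p)%:E)%E.
Proof.
move=> p0; rewrite /Lpnorm poweR_Lnorm ?gt_eqF// [RHS]integral_mkcond.
apply: eq_integral => x _; rewrite !patchE; case: ifP => // _.
by rewrite abse0 poweR0r// gt_eqF.
Qed.

Lemma LpnormE D p f : 0 < p ->
  (Lpnorm D p%:E f = (\int[leb]_(x in D) (`|f x| `^ p)%:E) `^ p^-1)%E.
Proof.
move=> p0; rewrite -poweR_Lpnorm// -poweRrM ?mulfV ?poweRe1 ?gt_eqF//.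
exact: Lnorm_ge0.
Qed.

Lemma Lpnorm1 D f : (Lpnorm D 1 f = \int[leb]_(x in D) `|f x|%:E)%E.
Proof.
rewrite LpnormE// invr1 poweRe1//.
  by apply: eq_integral => x _; rewrite powRr1.
by apply: integral_ge0 => x _; rewrite lee_fin powR_ge0.
Qed.

Lemma Lpnorm_lty D p f : 0 < p ->
  (Lpnorm D p%:E f < +oo)%E <-> (\int[leb]_(x in D) (`|f x| `^ p)%:E < +oo)%E.
Proof.
move=> p0; rewrite LpnormE//; set I := (\int[leb]_(x in D) _)%E.
by split=> [/lty_poweRy|/poweR_lty]; apply; rewrite invr_neq0// gt_eqF.
Qed.

Lemma Lp1_integrable D f : Lp D 1%:E f <-> leb.-integrable D (EFin \o f).
Proof.
rewrite /Lp Lpnorm1; split=> [[mf foo]|/integrableP[/measurable_EFinP mf foo]]//.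
by apply/integrableP; split; first exact/measurable_EFinP.
Qed.

Lemma Lp_subset D E p f : 0 < p -> measurable D -> measurable E -> D `<=` E ->
  Lp E p%:E f -> Lp D p%:E f.
Proof.
move=> p0 mD mE DE [mf foo]; split; first exact: measurable_funS mf.
apply/Lpnorm_lty => //; move/Lpnorm_lty : foo => /(_ p0); apply: le_lt_trans.
by apply: subset_integral_nonneg => // x _; rewrite lee_fin powR_ge0.
Qed.

Lemma bounded_Lp_oo D f c : measurable_fun D f -> (forall x, D x -> `|f x| <= c) -> 0 <= c ->
  Lp D +oo%E f.
Proof.
move=> mf fc c0; split=> //; rewrite /Lpnorm unlock; case: ifP => // _.
apply: le_lt_trans (ltry c).
apply: ereal_inf_lbound => /=; apply: aeW => x /=.
rewrite patchE; case: ifPn => [|_]; last by rewrite abse0 lee_fin.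
by rewrite inE => /fc; rewrite lee_fin.
Qed.

End Lebesgue_spaces.

(** * The weak gradient of a ball average *)

Section weak_gradient.
Context {R : realType} {n : nat}.
Local Notation cV := 'cV[R]_n.
Local Notation leb := (@lebesgue_cV R n).
Implicit Types (x y z : cV) (K : set cV) (f g phi : cV -> R) (G : cV -> cV).

Lemma ball_average_off e B Bt phi x : (forall x, B x -> eball x e `<=` Bt) ->
  (forall y, ~ B y -> phi y = 0) -> ~ Bt x -> ball_average e phi x = 0.
Proof.
move=> BBt phi0 Btx; rewrite /ball_average /average.
rewrite (_ : \int[leb]_(y in eball x e) phi y = \int[leb]_(y in eball x e) 0).
  by rewrite /Rintegral integral0 mulr0.
apply: eq_Rintegral => y; rewrite inE => xy; apply: phi0 => By.
by apply: Btx; apply: (BBt _ By); exact: eball_sym.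
Qed.

Lemma compact_measurable_cV K : compact K -> measurable K.
Proof.
move=> /(compact_closed (@norm_hausdorff _ _)) /closed_openC /open_measurable_cV /measurableC.
by rewrite setCK.
Qed.

Lemma Rintegral_mkcond0 D g : (forall x, ~ D x -> g x = 0) ->
  \int[leb]_(x in D) g x = \int[leb]_x g x.
Proof.
move=> g0; rewrite Rintegral_mkcond; apply: eq_Rintegral => x _.
by rewrite patchE; case: ifPn => //; rewrite notin_setE => /g0.
Qed.

Variables (Omega B Bt : set cV) (e : R) (f : cV -> R) (G : cV -> cV).
Hypothesis mBt : measurable Bt.
Hypothesis e0 : 0 < e.
Hypothesis BBt : forall x, B x -> eball x e `<=` Bt.
Hypothesis BtO : compactly_contained Bt Omega.
Hypothesis fG : weak_gradient Omega f G.

Lemma local_integrable g : Lploc Omega 1%:E g -> leb.-integrable setT (EFin \o (g \_ Bt)).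
Proof.
move=> [_ gL]; have [cBt BtO'] := BtO; apply: restrict_integrable => //.
have /Lp1_integrable ig := gL _ cBt BtO'.
exact: (integrableS (compact_measurable_cV cBt) mBt (@subset_closure _ Bt) ig).
Qed.

Let Lploc_average g : leb.-integrable setT (EFin \o g) -> Lploc B 1%:E (ball_average e g).
Proof.
move=> ig.
have mavg := measurable_average (measurable_eball_rel e) (@eball_sym _ _ e)
  (fun x => leb_eball x e) (vol_gt0 e0) ig.
split; first exact: measurable_funTS mavg.
move=> K cK KB; split; first exact: measurable_funTS mavg.
rewrite Lpnorm1.
have mK := compact_measurable_cV cK.
apply: (@le_lt_trans _ _ (\int[leb]_x `|g x|%:E)%E).
  have := integral_average_le (measurable_eball_rel e) (@eball_sym _ _ e)
    (fun x => leb_eball x e) (vol_gt0 e0) ig.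
  by apply: le_trans; apply: subset_integral_nonneg => // x _; rewrite lee_fin.
by have /integrableP[_] := ig.
Qed.

(** Averaging is self-adjoint, and the average of [phi] vanishes off [Bt], so cutting [g] off
    outside [Bt] is invisible on the right. *)
Lemma integral_by_averaging g phi C : leb.-integrable setT (EFin \o (g \_ Bt)) ->
  measurable_fun setT phi -> 0 <= C -> (forall x, `|phi x| <= C) ->
  (forall x, ~ B x -> phi x = 0) ->
  \int[leb]_(x in B) (ball_average e (g \_ Bt) x * phi x) =
  \int[leb]_(x in Omega) (g x * ball_average e phi x).
Proof.
move=> ig mphi C0 phiC phi0; have [cBt BtO'] := BtO.
have avg0 x := @ball_average_off e B Bt phi x BBt phi0.
rewrite Rintegral_mkcond0; last by move=> x /phi0->; rewrite mulr0.
rewrite [RHS]Rintegral_mkcond.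
apply: (etrans (integral_average_mul (measurable_eball_rel e) (@eball_sym _ _ e)
  (fun x => leb_eball x e) (vol_gt0 e0) ig mphi phiC C0)).
apply: eq_Rintegral => x _; rewrite !patchE.
case: ifPn => [|]; rewrite ?inE ?notin_setE => Btx.
  by case: ifPn => //; rewrite notin_setE => Ox; exfalso; exact/Ox/BtO'/subset_closure.
by rewrite avg0// mul0r mulr0; case: ifP.
Qed.

Lemma weak_gradient_ball_average :
  weak_gradient B (ball_average e (f \_ Bt))
    (fun x => \col_i ball_average e ((fun y => G y i 0) \_ Bt) x).
Proof.
have [fL GL H] := fG; split.
- exact: Lploc_average (local_integrable fL).
- move=> i; rewrite (_ : (fun x => _) = ball_average e ((fun y => G y i 0) \_ Bt)).
    exact: Lploc_average (local_integrable (GL i)).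
  by apply/funext => x; rewrite mxE.
move=> phi i [ckphi [cK KB]]; set K := closure _ in cK KB.
have phi0 x : ~ K x -> phi x = 0.
  by apply: contra_notP => /eqP x0; exact: subset_closure.
have [cphi /(_ i)[dphi cdphi]] := ckphi 1%N.
have clK : closed K by exact: closed_closure.
have dphi0 := partial_vanishing i clK phi0.
have [C C0 HC] := vanishing_off_compact_bounded cK cphi phi0.
have [C' C'0 HC'] := vanishing_off_compact_bounded cK cdphi dphi0.
have mphi := continuous_measurable_cV cphi.
have mdphi := continuous_measurable_cV cdphi.
rewrite (integral_by_averaging (local_integrable fL) mdphi C'0 HC') => [|x Bx]; last first.
  by apply: dphi0 => /KB.
have -> : \int[leb]_(x in B) ((\col_i ball_average e ((fun y => G y i 0) \_ Bt) x) i 0 * phi x) =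
    \int[leb]_(x in B) (ball_average e ((fun y => G y i 0) \_ Bt) x * phi x).
  by apply: eq_Rintegral => x _; rewrite mxE.
rewrite (integral_by_averaging (local_integrable (GL i)) mphi C0 HC) => [|x Bx]; last first.
  by apply: phi0 => /KB.
rewrite -H.
  apply: eq_Rintegral => x _; congr (_ * _); apply: esym.
  by rewrite /partial; have [_ ->] := is_derive_ball_average x e0 cK phi0 cphi dphi cdphi.
(* The averaged test function vanishes off [Bt], whose closure is compact and contained in
   [Omega]. *)
split; first by move=> k; exact: Ck_ball_average e0 cK phi0 (ckphi k).
have [cBt BtO'] := BtO.
have sub : [set x | ball_average e phi x != 0] `<=` Bt.
  move=> x /=; apply: contra_neqP; apply: ball_average_off BBt _ => y By.
  by apply: phi0 => /KB.
have cls := closure_subset sub.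
split; last exact: subset_trans cls BtO'.
by apply: subclosed_compact cls => //; exact: closed_closure.
Qed.

End weak_gradient.

(** * Convergence of the energies *)

Section pointwise.
Context {R : realType}.

Lemma powR_sum_le n (x : 'I_n -> R) r : (0 < n)%N -> 0 <= r -> (forall i, 0 <= x i) ->
  (\sum_i x i) `^ r <= n%:R `^ r * \sum_i x i `^ r.
Proof.
move=> n0 r0 x0; pose i0 := Ordinal n0.
have [j _ jmax] := @arg_maxP _ _ _ i0 xpredT x isT.
apply: (@le_trans _ _ ((n%:R * x j) `^ r)).
  apply: ge0_ler_powR; rewrite ?nnegrE ?mulr_ge0 ?sumr_ge0//.
  apply: le_trans (ler_sum _ (fun i _ => jmax i isT)) _.
  by rewrite sumr_const card_ord mulr_natl.
rewrite powRM// ler_wpM2l ?powR_ge0// (bigD1 j)//= lerDl.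
by apply: sumr_ge0 => i _; exact: powR_ge0.
Qed.

Section power_pair.
Variables (p q a : R).
Hypotheses (p0 : 0 < p) (pq : p <= q) (a0 : 0 <= a).

(** The integrand of H at one point, as a function of length; [modular] is by conversion its value
    at w |g|. *)
Definition power_pair (y : R) : R := y `^ p + a * y `^ q.

Let q0 : 0 < q. Proof. exact: lt_le_trans pq. Qed.

Lemma power_pair_ge0 y : 0 <= power_pair y.
Proof. by rewrite addr_ge0 ?mulr_ge0 ?powR_ge0. Qed.

Lemma power_pair_le x y : 0 <= x -> x <= y -> power_pair x <= power_pair y.
Proof.
move=> x0 xy; have y0 := le_trans x0 xy; apply: lerD; last apply: ler_wpM2l => //;
by apply: ge0_ler_powR; rewrite ?nnegrE// ltW.
Qed.

Lemma power_pairM c y : 1 <= c -> 0 <= y -> power_pair (c * y) <= c `^ q * power_pair y.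
Proof.
move=> c1 y0; have c0 : 0 <= c by exact: le_trans c1.
rewrite /power_pair mulrDr !(powRM _ c0 y0); apply: lerD.
  by rewrite ler_wpM2r ?powR_ge0// ler_powR.
by rewrite mulrCA.
Qed.

Lemma power_pair_sum n (x : 'I_n -> R) : (0 < n)%N -> (forall i, 0 <= x i) ->
  power_pair (\sum_i x i) <= n%:R `^ q * \sum_i power_pair (x i).
Proof.
move=> n0 x0; rewrite /power_pair big_split/= mulrDr -mulr_sumr; apply: lerD.
  apply: le_trans (powR_sum_le n0 (ltW p0) x0) _.
  rewrite ler_wpM2r ?sumr_ge0// => [i _|]; first exact: powR_ge0.
  by rewrite ler_powR// ler1n.
by rewrite mulrCA ler_wpM2l// powR_sum_le// ltW.
Qed.

(* The first factor tends to 1 as t -> 1, which yields convergence of the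
   energies from convergence to 0 of the energies of the differences. *)
Lemma power_pair_convex t x y : 1 < p -> 0 < t -> t < 1 -> 0 <= x -> 0 <= y ->
  power_pair (x + y) <=
    t `^ (1 - q) * power_pair x + (1 - t) `^ (1 - q) * power_pair y.
Proof.
move=> p1 t0 t1 x0 y0; have t10 : 0 < 1 - t by rewrite subr_gt0.
have q1 : 1 < q by exact: lt_le_trans pq.
have le_pow s : 0 < s -> s <= 1 -> s `^ (1 - p) <= s `^ (1 - q).
  by move=> s0 s1; apply: ger_powR; [rewrite s0|rewrite lerB].
have Hp := powR_convex (ltW p1) t0 t1 x0 y0.
have Hq := powR_convex (ltW q1) t0 t1 x0 y0.
apply: (@le_trans _ _ ((t `^ (1 - q) * x `^ p + (1 - t) `^ (1 - q) * y `^ p) +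
    a * (t `^ (1 - q) * x `^ q + (1 - t) `^ (1 - q) * y `^ q))).
  apply: lerD; last exact: ler_wpM2l.
  apply: le_trans Hp _; apply: lerD; apply: ler_wpM2r; rewrite ?powR_ge0//.
    by rewrite le_pow// ltW.
  by rewrite le_pow// gerBl ltW.
by rewrite le_eqVlt; apply/orP; left; apply/eqP; rewrite /power_pair; ring.
Qed.

(** This lemma and the next translate between vector fields and their coordinates, for which the
    estimates on averages are stated. *)
Lemma power_pair_norm_le n (z : 'cV[R]_n) (c w y : R) : (0 < n)%N -> 1 <= c -> 0 <= w ->
  0 <= y -> y <= c * (w * enorm z) ->
  power_pair y <= (c `^ q * n%:R `^ q) * \sum_i power_pair (w * `|z i 0|).
Proof.
move=> n0 c1 w0 y0 yz; have c0 : 0 <= c by exact: le_trans c1.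
have s0 : 0 <= \sum_i w * `|z i 0| by apply: sumr_ge0 => i _; rewrite mulr_ge0.
apply: (@le_trans _ _ (power_pair (c * \sum_i w * `|z i 0|))).
  apply: power_pair_le => //; apply: le_trans yz _.
  by rewrite ler_wpM2l// -mulr_sumr ler_wpM2l// enorm_le_sum.
apply: le_trans (power_pairM c1 s0) _; rewrite -mulrA ler_wpM2l ?powR_ge0//.
by apply: power_pair_sum => // i; rewrite mulr_ge0.
Qed.

Lemma coord_power_pair_le n (z : 'cV[R]_n) (c w y : R) i : 1 <= c -> 0 <= w ->
  0 <= y -> w * enorm z <= c * y ->
  power_pair (w * `|z i 0|) <= c `^ q * power_pair y.
Proof.
move=> c1 w0 y0 yz; apply: le_trans (power_pairM c1 y0); apply: power_pair_le.
  by rewrite mulr_ge0.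
by apply: le_trans yz; rewrite ler_wpM2l// coord_le_enorm.
Qed.

End power_pair.

Lemma energy_squeeze (h r : R) (u d : nat -> R) : 1 < r -> 0 <= h ->
  (forall k, 0 <= u k) -> (forall k, 0 <= d k) ->
  (forall k t, 0 < t -> t < 1 ->
    u k <= t `^ (1 - r) * h + (1 - t) `^ (1 - r) * d k) ->
  (forall k t, 0 < t -> t < 1 ->
    h <= t `^ (1 - r) * u k + (1 - t) `^ (1 - r) * d k) ->
  d k @[k --> \oo] --> (0 : R) -> u k @[k --> \oo] --> h.
Proof.
move=> r1 h0 u0 d0 H1 H2 /cvgrPdist_lt dcvg; apply/cvgrPdist_le => c c0.
(* Then s (h + 2) <= c/2, so the factor 1 + s uses at most half of the tolerance. The number [t]
   below solves t^(1 - r) = 1 + s; it lies in (0, 1) because 1 - r < 0, and it stays fixed while [d]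
   tends to 0. *)
pose s := Num.min 1 (c / 2 / (h + 2)).
have h2 : 0 < h + 2 by rewrite ltr_wpDl.
have s0 : 0 < s by rewrite lt_min ltr01/= !divr_gt0.
pose t := (1 + s) `^ ((1 - r)^-1).
have r10 : 1 - r < 0 by rewrite subr_lt0.
have s1 : 1 < 1 + s by rewrite ltrDl.
have t0 : 0 < t by rewrite powR_gt0// (lt_trans ltr01).
have tE : t `^ (1 - r) = 1 + s.
  by rewrite -powRrM mulVf ?lt_eqF// powRr1// ltW// (lt_trans ltr01).
have t1 : t < 1.
  rewrite ltNge; apply/negP => t1.
  have : t `^ (1 - r) <= t `^ 0 by apply: ler_powR => //; exact: ltW.
  by rewrite tE powRr0 leNgt s1.
have c' : 0 < (1 - t) `^ (1 - r) by rewrite powR_gt0// subr_gt0.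
have e0 : 0 < Num.min 1 (c / 2) / (1 - t) `^ (1 - r).
  by rewrite divr_gt0// lt_min ltr01 divr_gt0.
near=> k.
have : `|0 - d k| < Num.min 1 (c / 2) / (1 - t) `^ (1 - r) by near: k; exact: dcvg.
rewrite sub0r normrN ger0_norm// ltr_pdivlMr// mulrC => dk.
have := H1 k t t0 t1; have := H2 k t t0 t1; rewrite tE.
set v := _ * d k in dk *; move=> h_le u_le.
have : v < 1 by apply: lt_le_trans dk _; rewrite ge_min lexx.
have : v < c / 2 by apply: lt_le_trans dk _; rewrite ge_min lexx orbT.
have sh : s * (h + 2) <= c / 2.
  by rewrite -ler_pdivlMr// /s ge_min lexx orbT.
have s1' : s <= 1 by rewrite /s ge_min lexx.
have sh0 : 0 <= s * h by rewrite mulr_ge0// ltW.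
move=> v1 v2; rewrite ler_distl; apply/andP; split; last first.
  (* If [u k] exceeds h + 2 the claim is immediate; otherwise s u_k <= s (h + 2) <= c/2. *)
  have [uh|/ltW uh] := leP (u k) (h + 2); last by nra.
  have : s * u k <= s * (h + 2) by rewrite ler_wpM2l// ltW.
  by lra.
by lra.
Unshelve. all: by end_near. Qed.

(** The comparison at t = 1/2 shows every [u k] finite, after which the real version applies. *)
Lemma energy_squeezee (h : \bar R) (r : R) (u d : nat -> \bar R) (c : nat -> R) :
  1 < r -> (0 <= h)%E -> (h < +oo)%E ->
  (forall k, 0 <= u k)%E -> (forall k, 0 <= d k)%E ->
  (forall k t, 0 < t -> t < 1 ->
    (u k <= (t `^ (1 - r))%:E * h + ((1 - t) `^ (1 - r))%:E * d k)%E) ->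
  (forall k t, 0 < t -> t < 1 ->
    (h <= (t `^ (1 - r))%:E * u k + ((1 - t) `^ (1 - r))%:E * d k)%E) ->
  (forall k, d k <= (c k)%:E)%E -> c k @[k --> \oo] --> (0 : R) ->
  (u k @[k --> \oo] --> h)%E.
Proof.
move=> r1 h0 hoo u0 d0 H1 H2 dc c0.
have hfin : h \is a fin_num by rewrite ge0_fin_numE.
have dfin k : d k \is a fin_num.
  by rewrite ge0_fin_numE//; exact: le_lt_trans (dc k) (ltry _).
have ufin k : u k \is a fin_num.
  rewrite ge0_fin_numE//.
  have g0 : 0 < 2^-1 :> R by [].
  have g1 : 2^-1 < 1 :> R by rewrite invf_lt1// ltr1n.
  apply: le_lt_trans (H1 k _ g0 g1) _.
  by rewrite -(fineK hfin) -(fineK (dfin k)) -!EFinM -EFinD ltry.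
rewrite (_ : u = fun k => (fine (u k))%:E); last by apply/funext => k; rewrite fineK.
rewrite -(fineK hfin); apply: cvg_EFin; first exact: nearW.
apply: (@energy_squeeze _ r _ (fun k => fine (d k))) => //.
- by rewrite fine_ge0.
- by move=> k /=; rewrite fine_ge0.
- by move=> k; rewrite fine_ge0.
- by move=> k t t0 t1; rewrite -lee_fin EFinD !EFinM /= !fineK//; exact: H1.
- by move=> k t t0 t1; rewrite -lee_fin EFinD !EFinM /= !fineK//; exact: H2.
apply: squeeze_cvgr c0; last exact: cvg_cst.
by apply: nearW => k; rewrite fine_ge0//= -lee_fin fineK.
Qed.

End pointwise.

(** * Energies of vector fields *)

Section power_pair_integrals.
Context d (T : measurableType d) {R : realType} {n : nat}.
Variable mu : {measure set T -> \bar R}.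
Implicit Types (D : set T) (V Z : T -> 'cV[R]_n) (a w y : T -> R).

Definition measurable_coords D V := forall i, measurable_fun D (fun x => V x i 0).

Lemma measurable_coordsB D V Z : measurable_coords D V -> measurable_coords D Z ->
  measurable_coords D (fun x => V x - Z x).
Proof.
move=> mV mZ i; rewrite (_ : (fun x => _) = fun x => V x i 0 - Z x i 0).
  exact: measurable_funB.
by apply/funext => x; rewrite !mxE.
Qed.

Lemma measurable_coords_mulmx D (M : T -> 'M[R]_n) V :
  (forall i j, measurable_fun D (fun x => M x i j)) -> measurable_coords D V ->
  measurable_coords D (fun x => M x *m V x).
Proof.
move=> mM mV i; rewrite (_ : (fun x => _) = fun x => \sum_j M x i j * V x j 0).
  by apply: measurable_sum => j; exact: measurable_funM.
by apply/funext => x; rewrite !mxE.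
Qed.

Lemma measurable_enorm D V : measurable_coords D V -> measurable_fun D (fun x => enorm (V x)).
Proof.
move=> mV; have ms : measurable_fun setT (@Num.sqrt R).
  by apply: continuous_measurable_fun; exact: sqrt_continuous.
by apply: (measurableT_comp ms); apply: measurable_sum => i; exact: measurable_funX.
Qed.

Variables (p q : R) (a : T -> R) (D : set T).
Hypotheses (p1 : 1 < p) (pq : p <= q) (mD : measurable D).
Hypotheses (ma : measurable_fun D a) (a0 : forall x, 0 <= a x).

Let p0 : 0 < p. Proof. exact: lt_trans p1. Qed.

Lemma measurable_power_pair y : measurable_fun D y ->
  measurable_fun D (fun x => power_pair p q (a x) (y x)).
Proof.
move=> my; apply: measurable_funD; last apply: measurable_funM => //;
exact: (measurableT_comp (measurable_powR _)).
Qed.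

Let measurable_power_pair_EFin y : measurable_fun D y ->
  measurable_fun D (fun x => (power_pair p q (a x) (y x))%:E).
Proof. by move=> my; apply/measurable_EFinP; exact: measurable_power_pair. Qed.

Lemma integral_power_pair_le (c : R) V w y : (0 < n)%N -> 1 <= c ->
  measurable_coords D V -> measurable_fun D w -> measurable_fun D y ->
  (forall x, 0 <= w x) -> (forall x, 0 <= y x) ->
  {ae mu, forall x, D x -> y x <= c * (w x * enorm (V x))} ->
  (\int[mu]_(x in D) (power_pair p q (a x) (y x))%:E <=
    (c `^ q * n%:R `^ q)%:E *
    \sum_(i < n) \int[mu]_(x in D) (modular p q a w (fun x => V x i 0) x)%:E)%E.
Proof.
move=> n0 c1 mV mw my w0 y0 H.
have mm i : measurable_fun D (fun x => (modular p q a w (fun x => V x i 0) x)%:E).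
  by apply/measurable_EFinP; exact: measurable_modular.
have m0 i x : (0 <= (modular p q a w (fun x => V x i 0) x)%:E)%E.
  by rewrite lee_fin power_pair_ge0.
rewrite -ge0_integral_sum// -ge0_integralZl//; last 3 first.
- exact: emeasurable_sum.
- by move=> x _; exact: sume_ge0.
- by rewrite lee_fin mulr_ge0 ?powR_ge0.
apply: ae_ge0_le_integral => //.
- by move=> x _; rewrite lee_fin power_pair_ge0.
- exact: measurable_power_pair_EFin.
- by move=> x _; rewrite mule_ge0 ?lee_fin ?mulr_ge0 ?powR_ge0// sume_ge0.
- by apply: emeasurable_funM => //; exact: emeasurable_sum.
apply: filterS H => x Hx Dx; rewrite sumEFin -EFinM lee_fin.
exact: (power_pair_norm_le p0 pq (a0 x) n0 c1 (w0 x) (y0 x) (Hx Dx)).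
Qed.

Lemma integral_coord_power_pair_le (c : R) V w y i : 1 <= c ->
  measurable_coords D V -> measurable_fun D w -> measurable_fun D y ->
  (forall x, 0 <= w x) -> (forall x, 0 <= y x) ->
  {ae mu, forall x, D x -> w x * enorm (V x) <= c * y x} ->
  (\int[mu]_(x in D) (modular p q a w (fun x => V x i 0) x)%:E <=
    (c `^ q)%:E * \int[mu]_(x in D) (power_pair p q (a x) (y x))%:E)%E.
Proof.
move=> c1 mV mw my w0 y0 H.
rewrite -ge0_integralZl//; last 3 first.
- exact: measurable_power_pair_EFin.
- by move=> x _; rewrite lee_fin power_pair_ge0.
- by rewrite lee_fin powR_ge0.
apply: ae_ge0_le_integral => //.
- by move=> x _; rewrite lee_fin power_pair_ge0.
- by apply/measurable_EFinP; exact: measurable_modular.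
- by move=> x _; rewrite mule_ge0 ?lee_fin ?powR_ge0// power_pair_ge0.
- by apply: emeasurable_funM => //; exact: measurable_power_pair_EFin.
apply: filterS H => x Hx Dx; rewrite -EFinM lee_fin.
exact: (coord_power_pair_le p0 pq (a0 x) i c1 (w0 x) (y0 x) (Hx Dx)).
Qed.

Local Notation energy Z := (\int[mu]_(x in D) (power_pair p q (a x) (enorm (Z x)))%:E)%E.

Let energy_ge0 Z : (0 <= energy Z)%E.
Proof. by apply: integral_ge0 => x _; rewrite lee_fin power_pair_ge0. Qed.

Lemma energy_convex Z V t : measurable_coords D Z -> measurable_coords D V ->
  0 < t -> t < 1 ->
  (energy V <= (t `^ (1 - q))%:E * energy Z +
    ((1 - t) `^ (1 - q))%:E * energy (fun x => (V x - Z x)%R))%E.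
Proof.
move=> mZ mV t0 t1.
have mE Y : measurable_coords D Y ->
    measurable_fun D (fun x => (power_pair p q (a x) (enorm (Y x)))%:E).
  by move=> mY; apply: measurable_power_pair_EFin; exact: measurable_enorm.
have mVZ := mE _ (measurable_coordsB mV mZ); have mZ' := mE _ mZ.
have pow0 (s : R) : (0 <= (s `^ (1 - q))%:E)%E by rewrite lee_fin powR_ge0.
have pair0 (Y : T -> 'cV[R]_n) x : (0 <= (power_pair p q (a x) (enorm (Y x)))%:E)%E.
  by rewrite lee_fin power_pair_ge0.
rewrite -(ge0_integralZl mu mD mZ' (fun x _ => pair0 Z x) (pow0 _)).
rewrite -(ge0_integralZl mu mD mVZ (fun x _ => pair0 (fun x => V x - Z x) x) (pow0 _)).
have mZt := emeasurable_funM (measurable_cst (t `^ (1 - q))%:E) mZ'.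
have mVt := emeasurable_funM (measurable_cst ((1 - t) `^ (1 - q))%:E) mVZ.
rewrite -(ge0_integralD mu mD (fun x _ => mule_ge0 (pow0 _) (pair0 Z x)) mZt
  (fun x _ => mule_ge0 (pow0 _) (pair0 (fun x => V x - Z x) x)) mVt).
apply: le_integral_nonneg => x _; first by rewrite lee_fin power_pair_ge0.
rewrite -!EFinM -EFinD lee_fin.
apply: (@le_trans _ _ (power_pair p q (a x) (enorm (Z x) + enorm (V x - Z x)))); last first.
  by apply: power_pair_convex => //; exact: enorm_ge0.
apply: power_pair_le => //; first exact: enorm_ge0.
by apply: le_trans (enormD _ _); rewrite addrC subrK.
Qed.

Lemma energy_cvg Z (V : nat -> T -> 'cV[R]_n) (c : nat -> R) :
  measurable_coords D Z -> (forall k, measurable_coords D (V k)) ->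
  (energy Z < +oo)%E -> (forall k, energy (fun x => (V k x - Z x)%R) <= (c k)%:E)%E ->
  c k @[k --> \oo] --> (0 : R) -> (energy (V k) @[k --> \oo] --> energy Z)%E.
Proof.
move=> mZ mV Zoo Vc c0.
apply: (energy_squeezee (lt_le_trans p1 pq) (energy_ge0 Z) Zoo _ _ _ _ Vc c0) => k.
- exact: energy_ge0.
- exact: energy_ge0.
- by move=> t t0 t1; exact: energy_convex.
move=> t t0 t1.
have -> : (energy (fun x => (V k x - Z x)%R) = energy (fun x => (Z x - V k x)%R)).
  by apply: eq_integral => x _; rewrite enormBC.
exact: (energy_convex (mV k) mZ t0 t1).
Qed.

End power_pair_integrals.

Lemma powR_harmonic_cvg0 (R : realType) (C r : R) : 0 <= C -> 0 < r ->
  ((C * k.+1%:R^-1) `^ r @[k --> \oo] --> (0 : R)).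
Proof.
move=> C0 r0; apply/cvgrPdist_le => c c0.
have c10 : 0 < c `^ r^-1 by rewrite powR_gt0.
have : (C * k.+1%:R^-1 @[k --> \oo] --> C * (0 : R)).
  by apply: cvgMl_tmp; exact: cvg_harmonic.
rewrite mulr0 => /cvgrPdist_le/(_ _ c10) H.
near=> k.
have : `|0 - C * k.+1%:R^-1| <= c `^ r^-1 by near: k.
rewrite !sub0r !normrN !ger0_norm ?powR_ge0 ?mulr_ge0// => ck.
have -> : c = (c `^ r^-1) `^ r by rewrite -powRrM mulVf ?gt_eqF// powRr1// ltW.
by apply: ge0_ler_powR; rewrite ?nnegrE ?mulr_ge0 ?powR_ge0 ?(ltW r0).
Unshelve. all: by end_near. Qed.

Lemma bounded_Lp d (T : measurableType d) (R : realType) (mu : {measure set T -> \bar R})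
    (D : set T) (om h : T -> R) (p C : R) : measurable D -> 0 <= p -> 0 <= C ->
  measurable_fun D om -> (forall x, D x -> `|h x| <= C) ->
  (\int[mu]_(x in D) (`|om x| `^ p)%:E < +oo)%E ->
  (\int[mu]_(x in D) (`|om x * h x| `^ p)%:E < +oo)%E.
Proof.
move=> mD p0 C0 mom hC omoo.
apply: (@le_lt_trans _ _ ((C `^ p)%:E * \int[mu]_(x in D) (`|om x| `^ p)%:E)%E).
  have m1 : measurable_fun D (fun x => (`|om x| `^ p)%:E).
    apply/measurable_EFinP; apply: (measurableT_comp (measurable_powR _)).
    exact: measurableT_comp.
  have q0 x : (0 <= (`|om x| `^ p)%:E)%E by rewrite lee_fin powR_ge0.
  have q1 : (0 <= (C `^ p)%:E)%E by rewrite lee_fin powR_ge0.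
  rewrite -(ge0_integralZl mu mD m1 (fun x _ => q0 x) q1).
  apply: le_integral_nonneg => x Dx; first by rewrite lee_fin powR_ge0.
  rewrite -EFinM lee_fin normrM powRM// mulrC ler_wpM2r ?powR_ge0//.
  by apply: ge0_ler_powR; rewrite ?nnegrE// hC.
apply: lte_mul_pinfty => //.
by rewrite lee_fin powR_ge0.
Qed.

(** * Bounded functions in weighted Sobolev spaces *)

Section membership.
Context {R : realType} {n : nat}.
Local Notation cV := 'cV[R]_n.
Local Notation leb := (@lebesgue_cV R n).
Implicit Types (B : set cV) (f g omega : cV -> R) (G : cV -> cV) (p e C : R).

Lemma ball_average_bounded e g x : 0 < e -> leb.-integrable setT (EFin \o g) ->
  `|ball_average e g x| <= (vol n e)^-1 * fine (\int[leb]_y `|g y|%:E)%E.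
Proof.
move=> e0 ig; have v0 := @vol_gt0 R n e e0.
have fin : (\int[leb]_y `|g y|%:E)%E \is a fin_num.
  by rewrite ge0_fin_numE ?integral_ge0//; have /integrableP[_] := ig.
rewrite -lee_fin EFinM fineK//.
apply: le_trans (le_average (measurable_eball_rel e) v0 ig x) _.
apply: lee_wpmul2l; first by rewrite lee_fin invr_ge0 ltW.
by apply: subset_integral_nonneg => // y _; rewrite lee_fin.
Qed.

Lemma bounded_sobolev B omega p f G C : measurable B -> (leb B < +oo)%E -> 0 < p ->
  0 <= C -> weak_gradient B f G -> measurable_fun B f -> measurable_coords B G ->
  (forall x, B x -> `|f x| <= C) -> (forall x, B x -> enorm (G x) <= C) ->
  Lp B p%:E omega ->
  W1 B +oo%E f G /\ wW1 B omega p%:E f G.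
Proof.
move=> mB Boo p0 C0 fG mf mG fC GC [mom omoo].
have GC' x : B x -> `|enorm (G x)| <= C by move=> /GC; rewrite ger0_norm ?enorm_ge0.
have mG' : measurable_fun B (fun x => enorm (G x)) by exact: measurable_enorm.
have L1 (h : cV -> R) : measurable_fun B h -> (forall x, B x -> `|h x| <= C) -> Lp B 1%:E h.
  move=> mh hC; apply/Lp1_integrable; apply: measurable_bounded_integrable => //.
  by exists C; split; [exact: num_real|move=> M CM y /hC /le_trans; apply; exact: ltW].
have wL (h : cV -> R) : measurable_fun B h -> (forall x, B x -> `|h x| <= C) -> wLp B omega p%:E h.
  move=> mh hC; split; [exact: mh|split; first exact: (measurable_funM mom mh)].
  apply: (Lpnorm_lty B (fun x => omega x * h x) p0).2.
  exact: (bounded_Lp mB (ltW p0) C0 mom hC ((Lpnorm_lty B omega p0).1 omoo)).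
have Loo (h : cV -> R) : measurable_fun B h -> (forall x, B x -> `|h x| <= C) -> Lp B +oo%E h.
  by move=> mh hC; exact: bounded_Lp_oo mh hC C0.
split; first by split; [exact: fG|exact: (Loo _ mf fC)|exact: (Loo _ mG' GC')].
split; first by split; [exact: fG|exact: (L1 _ mf fC)|exact: (L1 _ mG' GC')].
- exact: (wL _ mf fC).
- exact: (wL _ mG' GC').
Qed.

Lemma wLpnorm_cvg0 B omega p (h : nat -> cV -> R) C : 0 < p -> 0 <= C ->
  (forall k, \int[leb]_(x in B) (`|omega x * h k x| `^ p)%:E <=
    (C * k.+1%:R^-1)%:E)%E ->
  (wLpnorm B omega p%:E (h k) @[k --> \oo] --> 0%:E)%E.
Proof.
move=> p0 C0 H.
apply: (@squeeze_cvge _ _ _ _ (cst 0%E) _ (fun k => ((C * k.+1%:R^-1) `^ p^-1)%:E)).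
- apply: nearW => k; rewrite /= /wLpnorm LpnormE// poweR_ge0/=.
  have := H k; set I := (\int[leb]_(x in _) _)%E => Ik.
  have I0 : (0 <= I)%E by apply: integral_ge0 => x _; rewrite lee_fin powR_ge0.
  rewrite -poweR_EFin; apply: gt0_ler_poweR => //.
- by rewrite invr_ge0 ltW.
- by rewrite in_itv/= I0 leey.
- by rewrite in_itv/= leey andbT; exact: le_trans Ik.
- exact: cvg_cst.
- by apply: cvg_EFin; [exact: nearW|apply: powR_harmonic_cvg0; rewrite ?invr_gt0].
Qed.

End membership.

Lemma near_right_of (R : realType) (P : R -> Prop) :
  (exists2 e1, 0 < e1 & forall e, 0 < e -> e < e1 -> P e) -> \forall e \near 0^'+, P e.
Proof.
move=> [e1 e10 H]; near=> e; apply: H; near: e; first exact: nbhs_right_gt.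
exact: nbhs_right_lt.
Unshelve. all: by end_near. Qed.

Lemma compact_eball_subset (R : realType) (n : nat) (K D : set 'cV[R]_n) :
  compact K -> open D -> K `<=` D ->
  exists2 e, 0 < e & forall x, K x -> eball x e `<=` D.
Proof.
move=> /compact_near_coveringP cK oD KD.
have H : \forall e \near 0^'+, K `<=` [set x | eball x e `<=` D].
  apply: cK => x Kx.
  have /nbhs_eballP[d d0 dD] : nbhs x D by apply: open_nbhs_nbhs; split => //; exact: KD.
  have d20 : 0 < d / 2 by rewrite divr_gt0.
  exists (eball x (d / 2), [set e | e < d / 2]).
    split=> /=; first by apply/nbhs_eballP; exists (d / 2).
    exact: nbhs_right_lt.
  move=> [z e] /= [zx ed] y yz; apply: dD.
  apply: le_lt_trans (enorm_dist _ z _) _; rewrite [ltRHS](splitr d).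
  by apply: ltrD => //; exact: lt_trans ed.
by near (0:R)^'+ => e; exists e => //; near: e.
Unshelve. all: by end_near. Qed.

Lemma integral_weight_le d (T : measurableType d) (R : realType)
    (mu : {measure set T -> \bar R}) (D : set T) (u v h : T -> R) (p c : R) :
  measurable D -> 0 <= p -> 0 <= c ->
  measurable_fun D u -> measurable_fun D v -> measurable_fun D h ->
  (forall x, 0 <= u x) -> (forall x, 0 <= v x) ->
  {ae mu, forall x, u x <= c * v x} ->
  (\int[mu]_(x in D) ((u x * `|h x|) `^ p)%:E <=
    (c `^ p)%:E * \int[mu]_(x in D) ((v x * `|h x|) `^ p)%:E)%E.
Proof.
move=> mD p0 c0 mu' mv mh u0 v0 H.
have m1 (k : T -> R) : measurable_fun D k -> measurable_fun D (fun x => ((k x * `|h x|) `^ p)%:E).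
  move=> mk; apply/measurable_EFinP; apply: (measurableT_comp (measurable_powR _)).
  by apply: measurable_funM => //; exact: measurableT_comp.
have q0 (k : T -> R) x : (0 <= ((k x * `|h x|) `^ p)%:E)%E by rewrite lee_fin powR_ge0.
have q1 : (0 <= (c `^ p)%:E)%E by rewrite lee_fin powR_ge0.
rewrite -(ge0_integralZl mu mD (m1 _ mv) (fun x _ => q0 v x) q1).
apply: ae_ge0_le_integral => //.
- exact: m1.
- by move=> x _; exact: mule_ge0.
- by apply: emeasurable_funM => //; exact: m1.
apply: filterS H => x uv _; rewrite -EFinM lee_fin -powRM ?mulr_ge0//.
apply: ge0_ler_powR; rewrite ?nnegrE ?mulr_ge0//.
by rewrite mulrA ler_wpM2r.
Qed.

(** The factor 1 in the first comparison gives it the form that [integral_weight_le] expects. *)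
Lemma det_mean_comparable (R : realType) (n : nat) (M : 'cV[R]_n -> 'M[R]_n) (Lambda : R) :
  (0 < n)%N -> matrix_weight M ->
  {ae lebesgue_cV n, forall x, opnorm (M x) * opnorm (invmx (M x)) <= Lambda} ->
  {ae lebesgue_cV n, forall x, [/\ det_mean (M x) <= 1 * opnorm (M x),
    opnorm (M x) <= Lambda * det_mean (M x),
    forall z, enorm (M x *m z) <= Lambda * (det_mean (M x) * enorm z) &
    forall z, det_mean (M x) * enorm z <= Lambda * enorm (M x *m z)]}.
Proof.
move=> n0 [_ sM pM]; apply: filterS2 pM => x px cx; split.
- by rewrite mul1r; exact: det_mean_le_opnorm.
- exact: opnorm_le_det_mean.
- by move=> z; exact: enorm_mulmx_det_mean_le.
- by move=> z; exact: det_mean_enorm_le.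
Qed.

(** * Construction of the approximating sequence *)

Theorem lemma3p1 (R : realType) (n : nat) (hn : (2 <= n)%N)
  (kappa cb : R) (kappa_gt0 : 0 < kappa) (cb_gt0 : 0 < cb)
  (hkcb : log_bmo_constants n kappa cb)
  (Omega : set 'cV[R]_n) (Omega0 : Omega !=set0) (oOmega : open Omega)
  (cOmega : connected Omega) (bOmega : bounded_set Omega)
  (B Bt : set 'cV[R]_n) (ballB : is_eball B) (ballBt : is_eball Bt)
  (B_Bt : compactly_contained B Bt) (Bt_Omega : compactly_contained Bt Omega)
  (p q : R) (p_gt1 : 1 < p) (p_lt_q : p < q)
  (alpha : R) (alpha_gt0 : 0 < alpha) (alpha_le1 : alpha <= 1)
  (a : 'cV[R]_n -> R) (a_ge0 : forall x, Omega x -> 0 <= a x)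
  (a_holder : holder_space alpha Omega a)
  (hqp : q / p <= 1 + alpha / n%:R)
  (M : 'cV[R]_n -> 'M[R]_n) (hM : matrix_weight M)
  (Lambda : R) (Lambda_ge1 : 1 <= Lambda)
  (M_cond : {ae lebesgue_cV n,
    forall x, opnorm (M x) * opnorm (invmx (M x)) <= Lambda})
  (s p' : R) (hp' : p' = p / (p - 1))
  (hs : s^-1 = p^-1 - alpha / (n%:R * q))
  (M_bmo : (mxbmo Bt (fun x => logmx (M x))
    <= (Num.min kappa cb^-1 * Num.min p'^-1 s^-1)%:E)%E)
  (omega : 'cV[R]_n -> R) (homega : omega = fun x => opnorm (M x))
  (omega_Lploc : Lploc setT p%:E omega)
  (f : 'cV[R]_n -> R) (Df : 'cV[R]_n -> 'cV[R]_n)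
  (hf : wW1 Omega omega p%:E f Df)
  (Hf : (lebesgue_cV n).-integrable Bt
    (fun x => (Hfun p q a x (M x *m Df x))%:E)) :
  exists (fk : nat -> 'cV[R]_n -> R) (Dfk : nat -> 'cV[R]_n -> 'cV[R]_n),
    [/\ forall k, W1 B +oo%E (fk k) (Dfk k),
        forall k, wW1 B omega p%:E (fk k) (Dfk k),
        wW1norm B omega p%:E (fun x => fk k x - f x) (fun x => Dfk k x - Df x)
          @[k --> \oo] --> 0%:E &
        (\int[lebesgue_cV n]_(x in B) (Hfun p q a x (M x *m Dfk k x))%:E
          @[k --> \oo] -->
         \int[lebesgue_cV n]_(x in B) (Hfun p q a x (M x *m Df x))%:E)%E].
Proof.
have n0 : (0 < n)%N by exact: leq_trans hn.
have [cb' [rb [rb0 BE]]] := ballB; have [ct [rt [rt0 BtE]]] := ballBt.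
have mB : measurable B by rewrite BE; exact: measurable_eball.
have mBt : measurable Bt by rewrite BtE; exact: measurable_eball.
have Boo : (lebesgue_cV n B < +oo)%E by rewrite BE leb_eball ltry.
have Btoo : (lebesgue_cV n Bt < +oo)%E by rewrite BtE leb_eball ltry.
have oBt : open Bt by rewrite BtE; exact: open_eball.
have mO : measurable Omega by exact: open_measurable_cV.
have [cB clB] := B_Bt; have [cBt clBt] := Bt_Omega.
have BtO : Bt `<=` Omega by move=> x /subset_closure /clBt.
have [e0 e00 He0] := compact_eball_subset cB oBt clB.
have BBt x : B x -> eball x e0 `<=` Bt by move=> /subset_closure /He0.
have subB : B `<=` Bt by move=> x /subset_closure /clB.
have BO : B `<=` Omega by exact: subset_trans BtO.
have [mM sM pM] := hM.
pose w x := det_mean (M x).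
have w_gt0 x : 0 < w x by exact: expR_gt0.
have w_ge0 x : 0 <= w x by exact: ltW.
have mw : measurable_fun setT w by exact: measurable_det_mean.
have comp := det_mean_comparable n0 hM M_cond.
have Lambda_ge0 : 0 <= Lambda by exact: le_trans Lambda_ge1.
have om_ge0 x : 0 <= omega x by rewrite homega opnorm_ge0.
have mom : measurable_fun setT omega by case: omega_Lploc.
have p_gt0 : 0 < p by exact: lt_trans p_gt1.
have q_gt1 : 1 < q by exact: lt_trans p_lt_q.
have q_gt0 : 0 < q by exact: lt_trans q_gt1.
have pq := ltW p_lt_q.
have p10 : 0 < p - 1 by rewrite subr_gt0.
have q10 : 0 < q - 1 by rewrite subr_gt0.
pose q' := q / (q - 1).
have p'_gt0 : 0 < p' by rewrite hp' divr_gt0.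
have q'_gt0 : 0 < q' by rewrite divr_gt0.
have pp' : p^-1 + p'^-1 = 1.
  by rewrite hp'; field; rewrite !gt_eqF.
have qq' : q^-1 + q'^-1 = 1.
  by rewrite /q'; field; rewrite !gt_eqF.
have qpinv : q^-1 <= p^-1 by rewrite lef_pV2 ?posrE.
have nR : 0 < n%:R :> R by rewrite ltr0n.
have nR1 : 1 <= n%:R :> R by rewrite ler1n.
have sp : s^-1 <= p^-1.
  by rewrite hs lerBlDr lerDl divr_ge0 ?mulr_ge0 ?ltW.
(* Multiplied by q this reads q/p - alpha/n <= 1, the hypothesis on q/p; so the smallness assumed
   for [s] also serves [q]. *)
have sq : s^-1 <= q^-1.
  rewrite hs -(ler_pM2r q_gt0) mulVf ?gt_eqF//.
  have -> : (p^-1 - alpha / (n%:R * q)) * q = q / p - alpha / n%:R.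
    by field; rewrite !gt_eqF.
  by rewrite lerBlDr.
have p'inv : p'^-1 = 1 - p^-1 by rewrite -pp'; ring.
have q'inv : q'^-1 = 1 - q^-1 by rewrite -qq'; ring.
have inv_ge1 (t t' : R) : 0 < t -> 0 < t' -> t^-1 + t'^-1 = 1 -> 1 <= t.
  move=> t0 t'0 tt'; rewrite -[t]invrK invf_ge1 ?invr_gt0//.
  by rewrite -tt' lerDl invr_ge0 ltW.
have p'1 : 1 <= p' by apply: (inv_ge1 _ p) => //; rewrite addrC.
have q'1 : 1 <= q' by apply: (inv_ge1 _ q) => //; rewrite addrC.
pose m := Num.min p'^-1 s^-1.
have mp' : m <= p'^-1 by rewrite ge_min lexx.
have ms : m <= s^-1 by rewrite ge_min lexx orbT.
have wA x r : 0 < r -> eball x r `<=` Bt -> dual_ball_bounds w p p' q q' x r.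
  move=> r0 xBt; apply: (det_mean_dual_ball_bounds n0 kappa_gt0 cb_gt0 hkcb hM M_bmo) => //.
  - exact: ltW.
  - exact: ltW.
  - exact: le_trans ms sp.
  - exact: le_trans ms sq.
  - by apply: le_trans mp' _; rewrite p'inv q'inv lerB.
(* [a] is controlled only on [Omega]; extended by zero from [Bt] it is measurable and nonnegative
   everywhere. *)
pose at_ : 'cV[R]_n -> R := a \_ Bt.
have atE x : Bt x -> at_ x = a x by move=> Btx; rewrite /at_ patchE mem_set.
have at_ge0 x : 0 <= at_ x.
  by rewrite /at_ patchE; case: ifPn => //; rewrite inE => /BtO /a_ge0.
have [[Cm Ha] [Ch Hh]] := a_holder.
pose Ca := `|Ch|.
have Ca0 : 0 <= Ca by exact: normr_ge0.
have aholder x y : Omega x -> Omega y -> `|a x - a y| <= Ca * enorm (x - y) `^ alpha.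
  move=> Ox Oy; apply: le_trans (Hh x y Ox Oy) _.
  by rewrite ler_wpM2r ?powR_ge0// ler_norm.
have at_holder x y : Bt x -> Bt y -> `|at_ x - at_ y| <= Ca * enorm (x - y) `^ alpha.
  by move=> Btx Bty; rewrite !atE//; apply: aholder; exact: BtO.
have mat : measurable_fun setT at_.
  apply: (measurable_restrictT _ mBt).1.
  apply: measurable_funS mO BtO _; apply: (continuous_on_measurable_cV oOmega).
  exact: (holder_continuous oOmega alpha_gt0 aholder).
have [[fG _ _] [mf fL] [_ GL]] := hf.
have [fL1 GL1 _] := fG.
have mDf i : measurable_fun Omega (fun x => Df x i 0) by case: (GL1 i).
pose F := f \_ Bt; pose G i := (fun x => Df x i 0) \_ Bt.
have iF : (lebesgue_cV n).-integrable setT (EFin \o F).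
  exact: (local_integrable mBt Bt_Omega fL1).
have iG i : (lebesgue_cV n).-integrable setT (EFin \o G i).
  exact: (local_integrable mBt Bt_Omega (GL1 i)).
have F0 x : ~ Bt x -> F x = 0 by move=> Btx; rewrite /F patchE memNset.
have G0 i x : ~ Bt x -> G i x = 0 by move=> Btx; rewrite /G patchE memNset.
have FE x : Bt x -> F x = f x by move=> Btx; rewrite /F patchE mem_set.
have GE i x : Bt x -> G i x = Df x i 0 by move=> Btx; rewrite /G patchE mem_set.
have mpow (r : R) : measurable_fun Bt (fun x => (w x `^ r)%:E).
  by apply/measurable_EFinP/measurable_funTS; exact: (measurableT_comp (measurable_powR _)).
have wpow (r : R) x : (0 <= (w x `^ r)%:E)%E by rewrite lee_fin powR_ge0.
(* Stated for any bounded coefficient, to serve both zero (for [f]) and [at_] (for [Df]). [Bt] is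
   itself a ball, so the dual bounds apply to it. *)
have Woo b : (forall x, Bt x -> 0 <= b x <= Cm) -> (\int[lebesgue_cV n]_(x in Bt) (w x `^ p + b x * w x `^ q)%:E < +oo)%E.
  move=> bC.
  have [W [W0 Wp Wq _ _]] : dual_ball_bounds w p p' q q' ct rt.
    by apply: wA => //; rewrite -BtE.
  apply: (@le_lt_trans _ _ (\int[lebesgue_cV n]_(x in Bt) ((w x `^ p)%:E + (`|Cm|)%:E * (w x `^ q)%:E))%E).
    apply: le_integral_nonneg => x Btx; have /andP[b0 bCm] := bC _ Btx.
      by rewrite lee_fin addr_ge0 ?mulr_ge0 ?powR_ge0.
    rewrite -EFinM -EFinD lee_fin lerD2l ler_wpM2r ?powR_ge0//.
    exact: le_trans bCm (ler_norm _).
  have Cm0 : (0 <= (`|Cm|)%:E)%E by rewrite lee_fin.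
  have mpowC : measurable_fun Bt (fun x => ((`|Cm|)%:E * (w x `^ q)%:E)%E).
    exact: emeasurable_funM (measurable_cst _) (mpow q).
  rewrite (ge0_integralD _ mBt (fun x _ => wpow p x) (mpow p) (fun x _ => mule_ge0 Cm0 (wpow q x)) mpowC).
  rewrite (ge0_integralZl _ mBt (mpow q) (fun x _ => wpow q x) Cm0).
  apply: lte_add_pinfty.
    by rewrite BtE; exact: le_lt_trans Wp (ltry _).
  apply: lte_mul_pinfty => //; rewrite BtE; exact: le_lt_trans Wq (ltry _).
have mDfBt : measurable_coords Bt Df by move=> i; exact: measurable_funS (mDf i).
have mMBt i j : measurable_fun Bt (fun x => M x i j) by exact: measurable_funTS.
have mMDf : measurable_coords Bt (fun x => M x *m Df x) by exact: measurable_coords_mulmx.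
have compDf : {ae lebesgue_cV n, forall x, Bt x -> w x * enorm (Df x) <= Lambda * enorm (M x *m Df x)}.
  by apply: filterS comp => x [_ _ _ H] _; exact: H.
have Hoo : (\int[lebesgue_cV n]_(x in Bt) (power_pair p q (at_ x) (enorm (M x *m Df x)))%:E < +oo)%E.
  have /integrableP[_] := Hf; apply: le_lt_trans; apply: le_integral_nonneg => x Btx.
    by rewrite lee_fin power_pair_ge0.
  by rewrite lee_fin /power_pair atE// ler_norm.
have Goo i : (\int[lebesgue_cV n]_(x in Bt) (modular p q at_ w (G i) x)%:E < +oo)%E.
  have := integral_coord_power_pair_le p_gt1 pq mBt (measurable_funTS mat) at_ge0 i Lambda_ge1
    mDfBt (measurable_funTS mw) (measurable_enorm mMDf) w_ge0 (fun x => enorm_ge0 (M x *m Df x)) compDf.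
  move=> /le_lt_trans H; apply: le_lt_trans (H _ _); last first.
    by apply: lte_mul_pinfty => //; rewrite lee_fin powR_ge0.
  apply: le_integral_nonneg => x Btx; first by rewrite lee_fin power_pair_ge0.
  by rewrite lee_fin /modular GE.
(* With coefficient zero the modular is the plain p-energy, which is all that is known of [f]. *)
have modular0 h x : modular p q (cst 0) w h x = (w x * `|h x|) `^ p.
  by rewrite /modular /= mul0r addr0.
have Foo : (\int[lebesgue_cV n]_(x in Bt) (modular p q (cst 0) w F x)%:E < +oo)%E.
  have mfBt : measurable_fun Bt f by exact: measurable_funS mf.
  have compw : {ae lebesgue_cV n, forall x, w x <= 1 * omega x}.
    by rewrite homega; apply: filterS comp => x [].
  have := integral_weight_le mBt (ltW p_gt0) ler01 (measurable_funTS mw) (measurable_funTS mom)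
    mfBt w_ge0 om_ge0 compw.
  rewrite powR1 mul1e => H; apply: le_lt_trans (le_lt_trans H _).
    apply: le_integral_nonneg => x Btx; first by rewrite lee_fin power_pair_ge0.
    by rewrite lee_fin modular0 FE.
  have := (Lpnorm_lty Omega (fun x => omega x * f x) p_gt0).1 fL.2; apply: le_lt_trans.
  apply: (@le_trans _ _ (\int[lebesgue_cV n]_(x in Omega) ((omega x * `|f x|) `^ p)%:E)%E).
    by apply: subset_integral_nonneg => // x _; rewrite lee_fin powR_ge0.
  apply: le_integral_nonneg => x _; first by rewrite lee_fin powR_ge0.
  by rewrite normrM (ger0_norm (om_ge0 x)).
have at_le x : Bt x -> 0 <= at_ x <= Cm.
  move=> Btx; rewrite at_ge0 atE//=; apply: le_trans (Ha x (BtO _ Btx)).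
  exact: ler_norm.
have zero_le x : Bt x -> 0 <= (cst 0 : 'cV[R]_n -> R) x <= Cm.
  by move=> Btx; rewrite lexx/=; have /andP[] := at_le _ Btx; exact: le_trans.
have zero_holder x y : Bt x -> Bt y ->
    `|(cst 0 : 'cV[R]_n -> R) x - (cst 0 : 'cV[R]_n -> R) y| <= 0 * enorm (x - y) `^ alpha.
  by move=> _ _; rewrite subrr normr0 mul0r.
have cvgF := ball_modular_cvg n0 mB mBt e00 BBt mw w_gt0 (measurable_cst (0:R)) (fun _ => lexx 0)
  p_gt0 p'_gt0 pp' q_gt0 q'_gt0 qq' pq (lexx 0) alpha_gt0 hqp zero_holder
  wA (ltW p_gt1) Btoo (Woo _ zero_le) iF F0 Foo.
have cvgG i := ball_modular_cvg n0 mB mBt e00 BBt mw w_gt0 mat at_ge0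
  p_gt0 p'_gt0 pp' q_gt0 q'_gt0 qq' pq Ca0 alpha_gt0 hqp at_holder
  wA (ltW p_gt1) Btoo (Woo _ at_le) (iG i) (@G0 i) (Goo i).
(* A common radius for [F] and the [n] components of [G]: each precision is attained by all small
   radii. *)
have /choice[e He] (k : nat) : exists e, [/\ 0 < e, e <= e0,
    (\int[lebesgue_cV n]_(x in B) (modular p q (cst 0) w (fun x => ball_average e F x - F x)%R x)%:E <=
      (k.+1%:R^-1)%:E)%E &
    forall i, (\int[lebesgue_cV n]_(x in B) (modular p q at_ w (fun x => ball_average e (G i) x - G i x)%R x)%:E <=
      (k.+1%:R^-1)%:E)%E].
  have k0 : 0 < k.+1%:R^-1 :> R by rewrite invr_gt0.
  have nF := near_right_of (cvgF _ k0).
  have nG : \forall e \near 0^'+, forall i,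
      (\int[lebesgue_cV n]_(x in B) (modular p q at_ w (fun x => ball_average e (G i) x - G i x)%R x)%:E <=
        (k.+1%:R^-1)%:E)%E.
    by apply: filter_forall => i; exact: near_right_of (cvgG i _ k0).
  near (0:R)^'+ => e; exists e; split.
  - by near: e; exact: nbhs_right_gt.
  - by near: e; exact: nbhs_right_le.
  - by near: e.
  - by near: e.
pose fk k := ball_average (e k) F.
pose Dfk k : 'cV[R]_n -> 'cV[R]_n := fun x => \col_i ball_average (e k) (G i) x.
have e_gt0 k : 0 < e k by have [] := He k.
have eBt k x : B x -> eball x (e k) `<=` Bt.
  move=> Bx y xy; apply: (BBt _ Bx); rewrite /eball/=.
  by apply: lt_le_trans xy _; have [] := He k.
have fkG k : weak_gradient B (fk k) (Dfk k).
  exact: (weak_gradient_ball_average mBt (e_gt0 k) (eBt k) Bt_Omega fG).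
have mavg k g : (lebesgue_cV n).-integrable setT (EFin \o g) -> measurable_fun setT (ball_average (e k) g).
  exact: (measurable_average (measurable_eball_rel (e k)) (@eball_sym _ _ (e k))
  (fun x => leb_eball x (e k)) (vol_gt0 (e_gt0 k))).
have mfk k : measurable_fun B (fk k) by exact: measurable_funTS (mavg k F iF).
have mDfk k : measurable_coords B (Dfk k).
  move=> i; rewrite (_ : (fun x => _) = ball_average (e k) (G i)).
    exact: measurable_funTS (mavg k _ (iG i)).
  by apply/funext => x; rewrite mxE.
(* For a fixed radius the averages of an integrable function are bounded; the bound may grow with
   [k]. *)
have mem k : W1 B +oo%E (fk k) (Dfk k) /\ wW1 B omega p%:E (fk k) (Dfk k).
  pose N (g : 'cV[R]_n -> R) := (vol n (e k))^-1 * fine (\int[lebesgue_cV n]_y `|g y|%:E)%E.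
  have N0 g : 0 <= N g.
    rewrite mulr_ge0 ?invr_ge0 ?(ltW (vol_gt0 (e_gt0 k)))// fine_ge0//.
    by apply: integral_ge0 => y _; rewrite lee_fin.
  have NP g x : (lebesgue_cV n).-integrable setT (EFin \o g) -> `|ball_average (e k) g x| <= N g.
    by move=> ig; exact: ball_average_bounded.
  apply: (bounded_sobolev (C := N F + \sum_i N (G i)) mB Boo p_gt0 _ (fkG k) (mfk k) (mDfk k)).
  - by rewrite addr_ge0// sumr_ge0.
  - by move=> x _; apply: le_trans (NP F x iF) _; rewrite lerDl sumr_ge0.
  - move=> x _; apply: le_trans (enorm_le_sum _) _.
    apply: (@le_trans _ _ (\sum_i N (G i))); last by rewrite lerDr.
    by apply: ler_sum => i _; rewrite mxE; exact: NP.
  - have [_ H] := omega_Lploc; apply: (Lp_subset p_gt0 mB _ (@subset_closure _ B)).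
      exact: compact_measurable_cV.
    by apply: H.
pose V k x := Dfk k x - Df x.
have mDfB : measurable_coords B Df by move=> i; exact: measurable_funS (mDf i).
have mMB i j : measurable_fun B (fun x => M x i j) by exact: measurable_funTS.
have mV k : measurable_coords B (V k) by exact: measurable_coordsB.
have VG k i x : B x -> V k x i 0 = ball_average (e k) (G i) x - G i x.
  by move=> /subB Btx; rewrite GE// !mxE.
have Vsum k : (\sum_(i < n) \int[lebesgue_cV n]_(x in B) (modular p q at_ w (fun x => V k x i 0) x)%:E <=
    (n%:R * k.+1%:R^-1)%:E)%E.
  have -> : n%:R * k.+1%:R^-1 = \sum_(i < n) k.+1%:R^-1 :> R.
    by rewrite sumr_const card_ord mulr_natl.
  rewrite -sumEFin; apply: lee_sum => i _; have [_ _ _ /(_ i)] := He k; apply: le_trans.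
  apply: le_integral_nonneg => x Bx; first by rewrite lee_fin power_pair_ge0.
  by rewrite lee_fin /modular VG.
(* The bracket comes from comparing |M z| with the coordinates of w z; the last factor counts the
   coordinates. *)
pose C := (Lambda `^ q * n%:R `^ q) * n%:R.
have C0 : 0 <= C by rewrite !mulr_ge0 ?powR_ge0.
(* Used with y = omega |V k| for the norm of the gradients and with y = |M (V k)| for the energies;
   both are at most Lambda w |V k|. *)
have Vpair k (y : 'cV[R]_n -> R) : measurable_fun B y -> (forall x, 0 <= y x) ->
    {ae lebesgue_cV n, forall x, B x -> y x <= Lambda * (w x * enorm (V k x))} ->
    (\int[lebesgue_cV n]_(x in B) (power_pair p q (at_ x) (y x))%:E <= (C * k.+1%:R^-1)%:E)%E.
  move=> my y0 yV.
  apply: le_trans (integral_power_pair_le p_gt1 pq mB (measurable_funTS mat) at_ge0 n0 Lambda_ge1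
    (mV k) (measurable_funTS mw) my w_ge0 y0 yV) _.
  rewrite /C -mulrA [in leRHS]EFinM.
  by apply: lee_wpmul2l; [rewrite lee_fin mulr_ge0 ?powR_ge0|exact: Vsum].
have fdiff k : (\int[lebesgue_cV n]_(x in B) (`|omega x * (fk k x - f x)| `^ p)%:E <=
    (Lambda `^ p * k.+1%:R^-1)%:E)%E.
  have mfB : measurable_fun B f by exact: measurable_funS mf.
  have compom : {ae lebesgue_cV n, forall x, omega x <= Lambda * w x}.
    by rewrite homega; apply: filterS comp => x [].
  have H := integral_weight_le mB (ltW p_gt0) Lambda_ge0 (measurable_funTS mom) (measurable_funTS mw)
    (measurable_funB (mfk k) mfB) om_ge0 w_ge0 compom.
  apply: le_trans (le_trans H _).
    apply: le_integral_nonneg => x _; first by rewrite lee_fin powR_ge0.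
    by rewrite normrM (ger0_norm (om_ge0 x)).
  rewrite EFinM; apply: lee_wpmul2l; first by rewrite lee_fin powR_ge0.
  have [_ _ + _] := He k; apply: le_trans.
  apply: le_integral_nonneg => x Bx; first by rewrite lee_fin powR_ge0.
  by rewrite modular0 FE//; exact: subB.
have gdiff k : (\int[lebesgue_cV n]_(x in B) (`|omega x * enorm (V k x)| `^ p)%:E <=
    (C * k.+1%:R^-1)%:E)%E.
  pose y x := omega x * enorm (V k x).
  have y0 x : 0 <= y x by rewrite mulr_ge0 ?enorm_ge0.
  have my : measurable_fun B y.
    exact: measurable_funM (measurable_funTS mom) (measurable_enorm (mV k)).
  apply: le_trans (Vpair k y my y0 _).
    apply: le_integral_nonneg => x _; first by rewrite lee_fin powR_ge0.
    by rewrite lee_fin (ger0_norm (y0 x)) lerDl mulr_ge0 ?powR_ge0.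
  apply: filterS comp => x [_ H _ _] _.
  by rewrite /y mulrA ler_wpM2r ?enorm_ge0// homega.
have ediff k : (\int[lebesgue_cV n]_(x in B) (power_pair p q (at_ x)
    (enorm (M x *m Dfk k x - M x *m Df x)%R))%:E <= (C * k.+1%:R^-1)%:E)%E.
  under eq_integral do rewrite -mulmxBr.
  apply: Vpair; first exact: measurable_enorm (measurable_coords_mulmx mMB (mV k)).
    by move=> x; exact: enorm_ge0.
  by apply: filterS comp => x [_ _ H _] _; exact: H.
exists fk, Dfk; split.
- by move=> k; have [] := mem k.
- by move=> k; have [] := mem k.
- rewrite -[X in _ --> X]adde0; apply: cvgeD => //.
    exact: (wLpnorm_cvg0 p_gt0 (powR_ge0 Lambda p) fdiff).
  exact: (wLpnorm_cvg0 p_gt0 C0 gdiff).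
have energyE (U : 'cV[R]_n -> 'cV[R]_n) : (\int[lebesgue_cV n]_(x in B) (Hfun p q a x (M x *m U x))%:E =
    \int[lebesgue_cV n]_(x in B) (power_pair p q (at_ x) (enorm (M x *m U x)))%:E)%E.
  by apply: eq_integral => x /[!inE] Bx; rewrite /power_pair atE//; exact: subB.
rewrite energyE; under eq_fun do rewrite energyE.
apply: (energy_cvg p_gt1 pq mB (measurable_funTS mat) at_ge0
  (measurable_coords_mulmx mMB mDfB) (fun k => measurable_coords_mulmx mMB (mDfk k))
  _ ediff).
  apply: le_lt_trans Hoo; apply: subset_integral_nonneg => // x _.
  by rewrite lee_fin power_pair_ge0.
rewrite -[X in _ --> X](mulr0 C); apply: cvgMl_tmp; exact: cvg_harmonic.
Unshelve. all: by end_near. Qed.
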